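(* Let $s=\frac12$, $f\in L^2(\Omega)$, and let $w\in\mathcal V$ be the weak solution of $w_{tt}+\Delta_xw=0$ in $Q$, $w_t(\cdot,0)=-f$ in $\Omega$, $w=0$ on $\partial\Omega\times(0,\infty)$; put $\mathbf p:=\nabla_{xt}w$. Let $N\ge1$, let $0<\theta_1\le\dots\le\theta_N$ be numbers, and let $\psi_1,\dots,\psi_N\in H^1_0(\Omega)$ be functions with $\Delta_x\psi_j\in L^2(\Omega)$. Set $\gamma_j:=\int_\Omega f\psi_j\,dx$, $\rho_j:=\Delta_x\psi_j+\theta_j\psi_j$, $$\widetilde w(x,t):=\sum_{j=1}^N\theta_j^{-1/2}\gamma_j\psi_j(x)e^{-\theta_j^{1/2}t},$$ $$\mathbf y:=\Big\{\sum_{j=1}^N\gamma_j\theta_j^{-1/2}\nabla\psi_j(x)e^{-\theta_j^{1/2}t},\ \sum_{j=1}^N\gamma_j\theta_j^{-1}\Delta_x\psi_j(x)e^{-\theta_j^{1/2}t}\Big\},$$ $$S_N^2:=\sum_{j=1}^N\sum_{k=1}^N\frac{\gamma_j\gamma_k}{\theta_j\theta_k(\theta_j^{1/2}+\theta_k^{1/2})}\int_\Omega\rho_j\rho_k\,dx,\qquad S_N\ge 0,$$ and ${\rm e}_w:=\widetilde w-w$, $\mathbf e_{\mathbf p}:=\mathbf y-\mathbf p$. Then $$|||\nabla_{xt}{\rm e}_w|||\le S_N+C_F^{1/2}\Big(\int_\Omega\Big|\sum_{j=1}^N\gamma_j\theta_j^{-1}\Delta_x\psi_j+f\Big|^2dx\Big)^{1/2},$$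 and, for every $\alpha\in(0,1)$, $$(1-\alpha)|||\nabla_{xt}{\rm e}_w|||^2+|||\mathbf e_{\mathbf p}|||^2\le S_N^2+\frac{C_F}{\alpha}\int_\Omega\Big|\sum_{j=1}^N\theta_j^{-1}\gamma_j\Delta_x\psi_j+f\Big|^2dx.$$
   Context: $\Omega\subset\mathbb R^d$, $d\ge1$, is a bounded connected open set with Lipschitz boundary, $Q:=\Omega\times(0,+\infty)$ with points $(x,t)$, $\nabla_{xt}w=\{\nabla_xw,w_t\}$. For scalar or vector functions on $Q$, $|||v|||^2:=\int_Q|v|^2\,dxdt$ (the case $s=\frac12$ of the weighted norm with weight $t^{1-2s}$). The space $\mathcal V$ is the closure of smooth functions on $\overline Q$ with bounded support vanishing on $\partial\Omega\times(0,\infty)$ with respect to the norm $|||\nabla_{xt}w|||$; $w(\cdot,0)$ is the trace on $\Omega\times\{0\}$. The boundary value problem for $w$ is understood weakly: $\int_Q\nabla_{xt}w\cdot\nabla_{xt}\eta\,dxdt=\int_\Omega f\,\eta(x,0)\,dx$ for all $\eta\in\mathcal V$. $C_F:=\lambda_1^{-1/2}$ with $\lambda_1$ the minimal eigenvalue of the Dirichlet Laplacian in $\Omega$. *)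

(* Defs.v *)
From HB Require Import structures.
From mathcomp Require Import all_boot all_order all_algebra.
From mathcomp Require Import all_classical all_reals all_analysis.

Set Implicit Arguments.
Unset Strict Implicit.
Unset Printing Implicit Defensive.

Import Order.TTheory GRing.Theory Num.Theory.
Import numFieldNormedType.Exports.

Local Open Scope classical_set_scope.
Local Open Scope ring_scope.

(* the Borel sigma-algebra of R^n, generated by the coordinates *)
Definition rV_display : measure_display. Proof. by constructor. Qed.

Section measurable_rV.
Context (R : realType) (n : nat).

Let coor (i : 'I_n) (v : 'rV[R]_n) : measurableTypeR R := v ord0 i.

Let rV_set0 : g_sigma_preimage coor set0.
Proof. exact: sigma_algebra0. Qed.

Let rV_setC A : g_sigma_preimage coor A -> g_sigma_preimage coor (~` A).
Proof. exact: sigma_algebraC. Qed.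

Let rV_bigcup (F : (set 'rV[R]_n)^nat) :
  (forall i, g_sigma_preimage coor (F i)) ->
  g_sigma_preimage coor (\bigcup_i (F i)).
Proof. exact: sigma_algebra_bigcup. Qed.

HB.instance Definition _ := @isMeasurable.Build rV_display
  'rV[R]_n (g_sigma_preimage coor) rV_set0 rV_setC rV_bigcup.

Lemma measurable_coord (i : 'I_n) :
  measurable_fun [set: 'rV[R]_n] (fun v : 'rV[R]_n => v ord0 i).
Proof.
move=> _ Y mY; rewrite setTI; apply: sub_sigma_algebra => /=.
rewrite -bigcup_seq/=; exists i => /=; first by rewrite mem_index_enum.
by exists Y => //; rewrite setTI.
Qed.

Lemma measurable_fun_rV d (T : measurableType d) (f : T -> 'rV[R]_n) :
  (forall i, measurable_fun [set: T] (fun x => f x ord0 i)) ->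
  measurable_fun [set: T] f.
Proof.
move=> fi; have smi : g_sigma_preimage (fun i => coor i \o f) `<=` measurable.
  apply: smallest_sub; first exact: sigma_algebra_measurable.
  move=> A; rewrite -bigcup_seq => -[i _ [B mB <-]].
  by apply: fi.
move=> _ B mB; rewrite setTI; apply: smi.
by rewrite g_sigma_preimage_comp; exists B => //; rewrite setTI.
Qed.

End measurable_rV.

Section lebesgue_rV.
Context (R : realType).

Definition rcons_rV n (p : 'rV[R]_n * measurableTypeR R) : 'rV[R]_n.+1 :=
  \row_i (if unlift ord_max i is Some j then p.1 ord0 j else p.2).

Lemma measurable_rcons_rV n : measurable_fun setT (@rcons_rV n).
Proof.
apply: measurable_fun_rV => i.
under eq_fun do rewrite mxE.
case: unliftP => [j _|_]; last exact: measurable_snd.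
exact: (measurableT_comp (measurable_coord j) measurable_fst).
Qed.

Definition rcons_measure n
    (mu : {measure set ('rV[R]_n * measurableTypeR R) -> \bar R}) :
    {measure set 'rV[R]_n.+1 -> \bar R} :=
  measure_function_pushforward__canonical__measure_function_Measure
    mu (@measurable_rcons_rV n).

(* n-dimensional Lebesgue measure, as an iterated product; see lebesgue_rV_box *)
Fixpoint lebesgue_rV_rec n : {measure set 'rV[R]_n -> \bar R} :=
  if n is m.+1 then rcons_measure (lebesgue_rV_rec m \x lebesgue_measure)%E
  else dirac (0 : 'rV[R]_0).

Definition lebesgue_rV n : set 'rV[R]_n -> \bar R := lebesgue_rV_rec n.

Arguments lebesgue_rV n _ : clear implicits.

HB.instance Definition _ n := Measure.copy (lebesgue_rV n) (lebesgue_rV_rec n).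

Lemma measurable_box n (A : 'I_n -> set (measurableTypeR R)) :
  (forall i, measurable (A i)) ->
  measurable [set v : 'rV[R]_n | forall i, A i (v ord0 i)].
Proof.
move=> mA.
rewrite (_ : [set v | _] = \bigcap_(i in [set: 'I_n])
  ((fun v : 'rV[R]_n => v ord0 i : measurableTypeR R) @^-1` A i)); last first.
  by apply/seteqP; split => [v Av i _|v Av i]; exact: Av.
apply: fin_bigcap_measurable => // i _.
by rewrite -[X in measurable X]setTI; exact: (@measurable_coord R n i measurableT _ (mA i)).
Qed.

Lemma lebesgue_rV_box n (A : 'I_n -> set (measurableTypeR R)) :
  (forall i, measurable (A i)) ->
  lebesgue_rV n [set v | forall i, A i (v ord0 i)] =
  (\prod_(i < n) lebesgue_measure (A i))%E.
Proof.
rewrite /lebesgue_rV; elim: n A => [|n IHn] A mA.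
  rewrite big_ord0 /= diracE.
  by rewrite mem_set//; case.
rewrite big_ord_recr/= -IHn//.
rewrite -product_measure1E//; last first.
  exact: (@measurable_box _ (fun i => A (widen_ord (leqnSn n) i))).
rewrite /pushforward; congr (_ _).
apply/seteqP; split => [[v t]/= Avt|[v t]/= [Av At] i].
  split; last by have := Avt ord_max; rewrite mxE unlift_none.
  move=> i; have := Avt (lift ord_max i); rewrite mxE liftK.
  by rewrite (_ : lift _ _ = widen_ord (leqnSn n) i)//; apply/val_inj/lift_max.
rewrite mxE; case: unliftP => [j ->|->//].
by rewrite (_ : lift _ _ = widen_ord (leqnSn n) j)//; apply/val_inj/lift_max.
Qed.

Lemma sigma_finite_lebesgue_rV n : sigma_finite setT (lebesgue_rV n).
Proof.
exists (fun k => [set v : 'rV[R]_n |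
  forall i, `[- k%:R, k%:R : measurableTypeR R]%classic (v ord0 i)]).
  apply/esym/seteqP; split => // v _.
  exists (Num.trunc (\sum_i `|v ord0 i|)).+1 => //= i.
  rewrite in_itv/= -ler_norml (le_trans _ (ltW (truncnS_gt _)))//.
  by rewrite (bigD1 i)//= lerDl sumr_ge0.
move=> k; pose A (_ : 'I_n) : set (measurableTypeR R) := `[- k%:R, k%:R]%classic.
have mA i : measurable (A i) by exact: measurable_itv.
split; first exact: (measurable_box mA).
rewrite (lebesgue_rV_box mA) (eq_bigr (fun=> (k%:R + k%:R)%:E)) => [|i _].
  by rewrite prodEFin ltry.
rewrite /A lebesgue_measure_itv/= lte_fin -EFinB opprK.
case: ltP => // k0; congr (_%:E); apply/esym/eqP.
by rewrite eq_le addr_ge0// -lerBrDl sub0r k0.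
Qed.

HB.instance Definition _ n := @Measure_isSigmaFinite.Build _ _ R (lebesgue_rV n)
  (sigma_finite_lebesgue_rV n).

End lebesgue_rV.
Arguments lebesgue_rV R n _ : clear implicits.

Section smooth.
Context (R : realType) (V : normedModType R).

(* C^oo: all iterated directional derivatives are differentiable everywhere *)
Definition smooth (f : V -> R) : Prop := forall (vs : seq V) (x : V),
  differentiable (foldr (fun v (g : V -> R) => (fun y => 'D_v g y)) f vs) x.

Definition test_function (U : set V) (phi : V -> R) : Prop :=
  smooth phi /\
  exists K : set V, [/\ compact K, K `<=` U & forall x, ~ K x -> phi x = 0].

Definition topological_boundary (A : set V) : set V := closure A `\` A°.

End smooth.

Section L2.
Context (R : realType) (disp : measure_display) (T : measurableType disp).
Context (mu : {measure set T -> \bar R}).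

Definition L2sq (D : set T) (f : T -> R) : \bar R :=
  (\int[mu]_(x in D) ((f x) ^+ 2)%:E)%E.

Definition L2 (D : set T) (f : T -> R) : Prop :=
  measurable_fun D f /\ (L2sq D f < +oo)%E.

End L2.

Section domain.
Context (R : realType) (d : nat).
Local Notation E := 'rV[R]_d.
Local Notation muE := (lebesgue_rV R d).

Definition dot (u v : E) : R := \sum_i u ord0 i * v ord0 i.

Definition grad (phi : E -> R) (x : E) : E :=
  \row_i 'D_(delta_mx ord0 i) phi x.

(* Near each boundary point, Omega is the strict epigraph of a Lipschitz
   function over the hyperplane orthogonal to some unit vector nu; the
   function g is evaluated only at projections onto that hyperplane. *)
Definition lipschitz_boundary (Omega : set E) : Prop :=
  forall x, topological_boundary Omega x ->
  exists (nu : E) (r k : R) (g : E -> R),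
    [/\ dot nu nu = 1, 0 < r,
        forall y z, `|g y - g z| <= k * `|y - z|
      & forall y, ball x r y ->
          (Omega y <-> g (y - dot y nu *: nu) < dot y nu)].

Definition lipschitz_domain (Omega : set E) : Prop :=
  [/\ open Omega, connected Omega, bounded_set Omega
    & lipschitz_boundary Omega].

Definition vL2sq (Omega : set E) (G : E -> E) : \bar R :=
  (\int[muE]_(x in Omega) (dot (G x) (G x))%:E)%E.

(* u belongs to H^1(Omega) and G is (a representative of) its weak gradient *)
Definition H1 (Omega : set E) (u : E -> R) (G : E -> E) : Prop :=
  [/\ L2 muE Omega u, forall i, L2 muE Omega (fun x => G x ord0 i)
    & forall phi, test_function Omega phi -> forall i,
        \int[muE]_(x in Omega) (u x * grad phi x ord0 i) =
        - \int[muE]_(x in Omega) (G x ord0 i * phi x)].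

(* closure of C_c^oo(Omega) in H^1(Omega) *)
Definition H10 (Omega : set E) (u : E -> R) (G : E -> E) : Prop :=
  H1 Omega u G /\
  exists phi : nat -> E -> R,
    [/\ forall n, test_function Omega (phi n),
        (fun n => L2sq muE Omega (fun x => phi n x - u x)) @ \oo --> 0%E
      & (fun n => vL2sq Omega (fun x => grad (phi n) x - G x)) @ \oo --> 0%E].

(* the distributional divergence of G is L, an L^2 function; when G is the
   weak gradient of psi, L is the Laplacian of psi *)
Definition L2_divergence (Omega : set E) (G : E -> E) (L : E -> R) : Prop :=
  L2 muE Omega L /\
  forall phi, test_function Omega phi ->
    \int[muE]_(x in Omega) dot (G x) (grad phi x) =
    - \int[muE]_(x in Omega) (L x * phi x).

(* the Dirichlet eigenvalue problem - Delta u = lambda u in weak form *)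
Definition dirichlet_eigenvalue (Omega : set E) (lambda : R) : Prop :=
  exists (u : E -> R) (G : E -> E),
    [/\ H10 Omega u G, (0 < L2sq muE Omega u)%E
      & forall v H, H10 Omega v H ->
          \int[muE]_(x in Omega) dot (G x) (H x) =
          lambda * \int[muE]_(x in Omega) (u x * v x)].

Definition min_dirichlet_eigenvalue (Omega : set E) (lambda : R) : Prop :=
  dirichlet_eigenvalue Omega lambda /\
  forall mu, dirichlet_eigenvalue Omega mu -> lambda <= mu.

End domain.

Section cylinder.
Context (R : realType) (d : nat).
Local Notation E := 'rV[R]_d.
Local Notation muE := (lebesgue_rV R d).

Definition lebesgue_xt : {measure set (E * measurableTypeR R) -> \bar R} :=
  (muE \x @lebesgue_measure R)%E.
Local Notation muQ := lebesgue_xt.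

Definition cylinder (Omega : set E) : set (E * R) :=
  Omega `*` [set t | 0 < t].

Definition dot_xt (a b : E * R) : R := dot a.1 b.1 + a.2 * b.2.

Definition grad_xt (phi : E * R -> R) (z : E * R) : E * R :=
  (\row_i 'D_((delta_mx ord0 i, 0) : E * R) phi z, 'D_((0, 1) : E * R) phi z).

Definition vL2sq_xt (Omega : set E) (q : E * R -> E * R) : \bar R :=
  (\int[muQ]_(z in cylinder Omega) (dot_xt (q z) (q z))%:E)%E.

Definition H1_xt (Omega : set E) (w : E * R -> R) (p : E * R -> E * R) : Prop :=
  [/\ L2 muQ (cylinder Omega) w,
      forall i, L2 muQ (cylinder Omega) (fun z => (p z).1 ord0 i),
      L2 muQ (cylinder Omega) (fun z => (p z).2)
    & forall phi : E * R -> R, test_function (cylinder Omega) phi ->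
      (forall i, \int[muQ]_(z in cylinder Omega)
                    (w z * (grad_xt phi z).1 ord0 i) =
               - \int[muQ]_(z in cylinder Omega) ((p z).1 ord0 i * phi z)) /\
      \int[muQ]_(z in cylinder Omega) (w z * (grad_xt phi z).2) =
      - \int[muQ]_(z in cylinder Omega) ((p z).2 * phi z)].

(* smooth functions on the closed cylinder (restrictions of smooth functions
   on R^(d+1)), with bounded support, vanishing on the lateral boundary *)
Definition V_smooth (Omega : set E) (phi : E * R -> R) : Prop :=
  [/\ smooth phi,
      bounded_set (closure (cylinder Omega) `&` [set z : E * R | phi z != 0])
    & forall x t, topological_boundary Omega x -> 0 < t -> phi (x, t) = 0].

(* w belongs to V, with weak gradient p and trace g on Omega x {0}.  On
   V_smooth, the norm of the gradient controls the L^2 norm of the function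
   (Friedrichs) and of its restriction to t = 0, so the closure for the
   gradient norm consists of L^2 functions, and the approximations converge
   in L^2 together with their traces. *)
Definition in_V (Omega : set E) (w : E * R -> R) (p : E * R -> E * R)
    (g : E -> R) : Prop :=
  [/\ H1_xt Omega w p, L2 muE Omega g
    & exists phi : nat -> E * R -> R,
      [/\ forall n, V_smooth Omega (phi n),
          (fun n => vL2sq_xt Omega (fun z => grad_xt (phi n) z - p z))
            @ \oo --> 0%E,
          (fun n => L2sq muQ (cylinder Omega) (fun z => phi n z - w z))
            @ \oo --> 0%E
        & (fun n => L2sq muE Omega (fun x => phi n (x, 0) - g x))
            @ \oo --> 0%E]].

Definition weak_solution (Omega : set E) (f : E -> R)
    (w : E * R -> R) (p : E * R -> E * R) : Prop :=
  (exists g, in_V Omega w p g) /\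
  forall eta H h, in_V Omega eta H h ->
    \int[muQ]_(z in cylinder Omega) dot_xt (p z) (H z) =
    \int[muE]_(x in Omega) (f x * h x).

End cylinder.

(* Main.v *)
Require Import Defs.
From HB Require Import structures.
From mathcomp Require Import all_boot all_order all_algebra.
From mathcomp Require Import all_classical all_reals all_analysis.
From mathcomp Require Import measurable_realfun ring lra.

Set Implicit Arguments.
Unset Strict Implicit.
Unset Printing Implicit Defensive.

Import Order.TTheory GRing.Theory Num.Theory.
Import numFieldNormedType.Exports.

Local Open Scope classical_set_scope.
Local Open Scope ring_scope.

(* Put P := grad e_w and D := e_p - P = y - grad w_tilde. The x-components of D vanish and its
   t-component is the sum of gamma_j / theta_j * rho_j(x) * exp(- sqrt(theta_j) t), so that
   |||D|||^2 = S_N^2 because exp(- a t) and exp(- b t) have inner product 1 / (a + b) on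
   (0, oo). Since y is divergence free in Q, Green's formula and the weak equation tested with
   e_w, which belongs to V, turn the inner product of e_p and P into - \int_Omega r e_w(x, 0),
   where r := \sum_j gamma_j / theta_j * Laplacian(psi_j) + f. The trace inequality
   \int_Omega eta(x, 0)^2 <= C_F |||grad eta|||^2 in V, which combines - 2 \int_Q eta eta_t with
   the Friedrichs inequality on every slice t = const, bounds this inner product, and both
   estimates follow by expanding |||D|||^2.

   The Friedrichs inequality needs that the infimum of the Rayleigh quotient is a Dirichlet
   eigenvalue, hence at least lambda_1. A minimizing sequence is Cauchy along an ultrafilter:
   by the Poincare inequality on small cubes, finitely many bounded linear functionals control
   the L^2 norm up to a small fraction of the energy, and the parallelogram law then controls
   the gradients. The boundary condition of V is pointwise, so a slice of a smooth function of V
   is approximated by test functions by truncating its values near its zero set. *)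

(** * Smooth functions and cut-offs *)

(** The field y copies the x-components of grad w_tilde and takes the t-component that makes its
    divergence vanish: a exp(- a t) Laplacian(psi) cancels the t-derivative of exp(- a t)
    Laplacian(psi). Hence D measures only the defects rho_j of the eigenvalue equation, while the
    t-component of e_p at t = 0 is formally the residual r, the defect in the expansion of f.
    Nothing is known of w beyond membership in V and the weak equation, so each identity for e_w is
    proved for the smooth functions of V and carried to the limit. Two features of the definitions
    shape the work. The number lambda_1 is given as the least number that has an eigenfunction, not
    as an infimum, so the infimum of the Rayleigh quotient must be shown to be attained, which takes
    compactness. And a smooth function of V satisfies its boundary condition only pointwise and is
    arbitrary outside the closed cylinder, so its slices are not limits of test functions by
    definition. *)

Section smooth_functions.
Context (R : realType).

(** The coinductive reading of smoothness, by induction on the list of directions. Most smoothness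
    proofs below only exhibit a suitable class [C]. *)
Lemma smooth_class (V : normedModType R) (C : set (V -> R)) :
  (forall f, C f -> forall x, differentiable f x) ->
  (forall f, C f -> forall v, C (fun x => 'D_v f x)) ->
  forall f, C f -> smooth f.
Proof.
move=> Cdiff CD f Cf vs x; apply: Cdiff.
by elim: vs => //= v vs IH; exact: CD.
Qed.

Lemma smooth_differentiable (V : normedModType R) (f : V -> R) x :
  smooth f -> differentiable f x.
Proof. by move=> /(_ [::] x). Qed.

Lemma smooth_derivable (V : normedModType R) (f : V -> R) x v :
  smooth f -> derivable f x v.
Proof. by move=> sf; apply/diff_derivable/smooth_differentiable. Qed.

Lemma smooth_continuous (V : normedModType R) (f : V -> R) :
  smooth f -> continuous f.
Proof.
by move=> sf x; apply: differentiable_continuous; exact: smooth_differentiable.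
Qed.

(** [foldr] applies the last direction first, so the extra derivative is appended at the end of the
    list. *)
Lemma smooth_derive (V : normedModType R) (f : V -> R) v :
  smooth f -> smooth (fun x => 'D_v f x).
Proof. by move=> sf vs x; have := sf (rcons vs v) x; rewrite foldr_rcons. Qed.

Lemma smoothP (V : normedModType R) (f : V -> R) :
  (forall x, differentiable f x) ->
  (forall v, smooth (fun x => 'D_v f x)) -> smooth f.
Proof.
move=> df Df.
apply: (@smooth_class _ [set g | g = f \/ smooth g]); last by left.
- by move=> g [->|sg] x //; exact: smooth_differentiable.
- by move=> g [->|sg] v; right; [exact: Df|exact: smooth_derive].
Qed.

Lemma smooth_cst (V : normedModType R) (c : R) : smooth (fun _ : V => c).
Proof.
apply: (@smooth_class _ [set f | exists c, f = cst c]) => [f [a ->] x|f [a ->] v|].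
- exact: differentiable_cst.
- by exists 0; apply/funext => x; rewrite derive_cst.
- by exists c.
Qed.

(** Differentiating a product, a composite or an inverse mixes the functions with their derivatives,
    so a class built from a single operation is not stable under derivatives; the closure under all
    of them is. *)
Inductive smooth_expr (V : normedModType R) : (V -> R) -> Prop :=
| SmoothBase f of smooth f : smooth_expr f
| SmoothAdd f g of smooth_expr f & smooth_expr g :
    smooth_expr (fun x => f x + g x)
| SmoothMul f g of smooth_expr f & smooth_expr g :
    smooth_expr (fun x => f x * g x)
| SmoothComp (b : R -> R) f of smooth b & smooth_expr f :
    smooth_expr (fun x => b (f x))
| SmoothInv f of smooth_expr f & (forall x, f x != 0) :
    smooth_expr (fun x => (f x)^-1).

Lemma smooth_expr_diff (V : normedModType R) (f : V -> R) :
  smooth_expr f -> forall x, differentiable f x.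
Proof.
elim=> {f} [f sf x|f g _ df _ dg x|f g _ df _ dg x|b f sb _ df x|f _ df f0 x].
- exact: smooth_differentiable.
- by apply: (differentiableD (df x) (dg x)).
- by apply: (differentiableM (df x) (dg x)).
- by apply: differentiable_comp => //; exact: smooth_differentiable.
- exact: differentiableV.
Qed.

Lemma derive_comp_1d (V : normedModType R) (b : R -> R) (f : V -> R) x v :
  differentiable f x -> differentiable b (f x) ->
  'D_v (fun x => b (f x)) x = 'D_1 b (f x) * 'D_v f x.
Proof.
move=> df db; rewrite deriveE; last exact: differentiable_comp.
rewrite (diff_comp df db)/= -[X in 'd b _ X]mulr1 -[_ * 1]/(_ *: 1) linearZ/=.
by rewrite -!deriveE// -[LHS]/(_ * _) mulrC.
Qed.

Lemma smooth_expr_derive (V : normedModType R) (f : V -> R) :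
  smooth_expr f -> forall v, smooth_expr (fun x => 'D_v f x).
Proof.
elim=> {f} [f sf v|f g ef Df eg Dg v|f g ef Df eg Dg v|b f sb ef Df v|f ef Df f0 v].
- by apply: SmoothBase; exact: smooth_derive.
- rewrite (_ : (fun x => _) = (fun x => 'D_v f x + 'D_v g x)).
    exact: SmoothAdd.
  apply/funext => x; apply: deriveD; apply: diff_derivable;
  exact: smooth_expr_diff.
- rewrite (_ : (fun x => _) = (fun x => f x * 'D_v g x + g x * 'D_v f x)).
    by apply: SmoothAdd; apply: SmoothMul.
  apply/funext => x; apply: deriveM; apply: diff_derivable;
  exact: smooth_expr_diff.
- rewrite (_ : (fun x => _) = (fun x => 'D_1 b (f x) * 'D_v f x)).
    by apply: SmoothMul => //; apply: (@SmoothComp _ (fun y => 'D_1 b y)) => //; exact: smooth_derive.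
  apply/funext => x; apply: derive_comp_1d; first exact: smooth_expr_diff.
  exact: smooth_differentiable.
- rewrite (_ : (fun x => _) = (fun x => -1 * ((f x)^-1 * (f x)^-1) * 'D_v f x)).
    apply: SmoothMul => //; apply: SmoothMul; last by apply: SmoothMul; exact: SmoothInv.
    exact/SmoothBase/smooth_cst.
  apply/funext => x; rewrite deriveV//; last exact/diff_derivable/smooth_expr_diff.
  by rewrite -exprVn expr2 mulN1r.
Qed.

Lemma smooth_exprP (V : normedModType R) (f : V -> R) :
  smooth_expr f -> smooth f.
Proof. by apply: smooth_class f; [exact: smooth_expr_diff|exact: smooth_expr_derive]. Qed.

Lemma smoothV (V : normedModType R) (f : V -> R) :
  smooth f -> (forall x, f x != 0) -> smooth (fun x => (f x)^-1).
Proof. by move=> sf f0; apply/smooth_exprP/SmoothInv => //; exact: SmoothBase. Qed.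

Lemma smoothD (V : normedModType R) (f g : V -> R) :
  smooth f -> smooth g -> smooth (fun x => f x + g x).
Proof. by move=> sf sg; apply/smooth_exprP/SmoothAdd; exact: SmoothBase. Qed.

Lemma smoothM (V : normedModType R) (f g : V -> R) :
  smooth f -> smooth g -> smooth (fun x => f x * g x).
Proof. by move=> sf sg; apply/smooth_exprP/SmoothMul; exact: SmoothBase. Qed.

Lemma smooth_comp (V : normedModType R) (b : R -> R) (f : V -> R) :
  smooth b -> smooth f -> smooth (fun x => b (f x)).
Proof. by move=> sf sg; apply/smooth_exprP/SmoothComp => //; exact: SmoothBase. Qed.

Lemma smoothZ (V : normedModType R) (c : R) (f : V -> R) :
  smooth f -> smooth (fun x => c * f x).
Proof. by move=> sf; apply: smoothM => //; exact: smooth_cst. Qed.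

Lemma smoothB (V : normedModType R) (f g : V -> R) :
  smooth f -> smooth g -> smooth (fun x => f x - g x).
Proof.
move=> sf sg; rewrite (_ : (fun x => _) = (fun x => f x + (-1) * g x)).
  by apply: smoothD => //; exact: smoothZ.
by apply/funext => x; rewrite mulN1r.
Qed.

(** The two difference quotients coincide for every increment. The main use is for slices, where [A]
    inserts a fixed coordinate. *)
Lemma derive_affine (V W : normedModType R) (A L : W -> V) (f : V -> R) x v :
  (forall h : R, A (h *: v + x) = h *: L v + A x) ->
  'D_v (fun x => f (A x)) x = 'D_(L v) f (A x).
Proof.
move=> AL; rewrite /derive (_ : (fun h => _) =
  (fun h => h^-1 *: ((f \o shift (A x)) (h *: L v) - f (A x)))) //.
by apply/funext => h /=; rewrite AL.
Qed.

Lemma derivable_affine (V W : normedModType R) (A L : W -> V) (f : V -> R) x v :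
  (forall h : R, A (h *: v + x) = h *: L v + A x) ->
  derivable (fun x => f (A x)) x v = derivable f (A x) (L v).
Proof.
move=> AL; rewrite /derivable (_ : (fun h => _) =
  (fun h => h^-1 *: ((f \o shift (A x)) (h *: L v) - f (A x)))) //.
by apply/funext => h /=; rewrite AL.
Qed.

Lemma smooth_affine (V W : normedModType R) (A L : W -> V) (f : V -> R) :
  (forall (h : R) x v, A (h *: v + x) = h *: L v + A x) ->
  (forall x, differentiable A x) ->
  smooth f -> smooth (fun x => f (A x)).
Proof.
move=> AL dA sf.
apply: (@smooth_class _ [set g | exists2 f, smooth f & g = (fun x => f (A x))]).
- move=> _ [g sg ->] x; apply: differentiable_comp => //.
  exact: smooth_differentiable.
- move=> _ [g sg ->] v; exists (fun y => 'D_(L v) g y); first by apply: smooth_derive.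
  by apply/funext => x; exact: derive_affine.
- by exists f.
Qed.

Lemma near0_differentiable (V : normedModType R) (f : V -> R) x :
  (\forall y \near x, f y = 0) -> differentiable f x.
Proof.
move=> f0; have fo : f \o shift x = cst (f x) + (\0 : {linear V -> R}) +o_ 0 id.
  apply/eqaddoP => _/posnumP[e].
  have f0' : \forall h \near 0, f (h + x) = 0.
    by move: (f0); rewrite (near_shift 0 x) subr0.
  near=> h; rewrite /= !fctE/= (nbhs_singleton f0) (near f0' h)//.
  by rewrite addr0 subrr normr0 mulr_ge0.
apply/diff_locallyP.
have -> : 'd f x = (\0 : {linear V -> R}) :> (V -> R).
  by apply: diff_unique => //; exact: cst_continuous.
by split => //; exact: cst_continuous.
Unshelve. all: by end_near. Qed.

(** Near a point the function is [g] plus a difference that vanishes on a neighbourhood, hence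
    differentiable; and functions that agree near a point have derivatives that agree near it, so
    the local property is stable under derivatives. This glues a truncated function with zero. *)
Lemma smooth_locally (V : normedModType R) (f : V -> R) :
  (forall x : V, exists2 g, smooth g & \forall y \near x, f y = g y) -> smooth f.
Proof.
move=> lf; apply: (@smooth_class _
  [set f | forall x : V, exists2 g, smooth g & \forall y \near x, f y = g y]) => //.
- move=> h lh x; have [g sg hg] := lh x.
  have -> : h = g \+ (h \- g) by apply/funext => y /=; rewrite addrC subrK.
  apply: differentiableD; first exact: smooth_differentiable.
  apply: near0_differentiable; near=> y.
  by rewrite /= (near hg y) ?subrr//.
- move=> h lh v x; have [g sg hg] := lh x.
  exists (fun y => 'D_v g y); first by apply: smooth_derive.
  have hg' := nbhs_interior hg.
  near=> y; have hgy : \forall z \near y, h z = g z by near: y.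
  have [->|v0] := eqVneq v 0; first by rewrite !derive0.
  exact: near_eq_derive.
Unshelve. all: by end_near. Qed.

(** A direction in dimension one is a number [v], and differentiating [c * b k] along it gives
    [c * v * b k.+1]; the multiples of the [b k] are thus a stable class. *)
Lemma smooth_chain (b : nat -> R -> R) :
  (forall k (x : R), is_derive x (1 : R) (b k) (b k.+1 x)) -> smooth (b 0%N).
Proof.
move=> db.
have dc k c (x : R) : is_derive x (1 : R) (fun x => c * b k x) (c * b k.+1 x).
  exact: (@is_deriveZ _ _ _ (b k) c x 1 _ (db k x)).
have df k c (x : R) : differentiable (fun x => c * b k x) x.
  by apply/derivable1_diffP; have /@ex_derive := dc k c x.
apply: (@smooth_class _ [set f | exists c k, f = (fun x => c * b k x)]).
- by move=> _ [c [k ->]].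
- move=> _ [c [k ->]] v; exists (c * v), k.+1; apply/funext => x.
  rewrite deriveE// -[X in 'd _ _ X]mulr1 -[X in 'd _ _ X]/(v *: 1) linearZ.
  by rewrite -deriveE//; have /@derive_val -> := dc k c x; rewrite -[LHS]/(v * _) mulrA (mulrC v).
- by exists 1, 0%N; apply/funext => x; rewrite mul1r.
Qed.

Lemma smooth_antiderivative (b B : R -> R) :
  (forall x : R, is_derive x (1 : R) B (b x)) -> smooth b -> smooth B.
Proof.
move=> dB sb; have dfB x : differentiable B x.
  by apply/derivable1_diffP; have /@ex_derive := dB x.
apply: smoothP => // v.
rewrite (_ : (fun x => _) = (fun x => v * b x)); first exact: smoothZ.
apply/funext => x; rewrite deriveE// -[X in 'd _ _ X]mulr1.
by rewrite -[X in 'd _ _ X]/(v *: 1) linearZ -deriveE//; have /@derive_val -> := dB x.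
Qed.

End smooth_functions.

(** * Flat functions, smooth steps and truncations *)

Section cutoff.
Context (R : realType).

(** The exponential dominates each single term of its power series. *)
Lemma expr_expRN_bounded (n : nat) :
  exists2 C : R, 0 <= C & forall y, 0 <= y -> y ^+ n * expR (- y) <= C.
Proof.
case: n => [|n].
  by exists 1 => // y y0; rewrite expr0 mul1r expR_le1 oppr_le0.
exists (n.+1)`!%:R => // y y0; rewrite expRN ler_pdivrMr ?expR_gt0//.
have n0 : (0 < n.+1`!%:R :> R) by rewrite ltr0n fact_gt0.
rewrite -ler_pdivrMl// mulrC; apply: le_trans (expR_ge1Dxn n y0).
by rewrite lerDr.
Qed.

Lemma horner_expRN_bounded (p : {poly R}) :
  exists2 C : R, 0 <= C & forall y, 0 <= y -> `|p.[y]| * expR (- y) <= C.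
Proof.
have [C C0 HC] : exists2 C : nat -> R, (forall n, 0 <= C n) &
    forall n y, 0 <= y -> y ^+ n * expR (- y) <= C n.
  have /choice[C HC] : forall n, exists C : R, 0 <= C /\
      forall y, 0 <= y -> y ^+ n * expR (- y) <= C.
    by move=> n; have [C C0 HC] := expr_expRN_bounded n; exists C.
  by exists C => n; have [] := HC n.
exists (\sum_(i < size p) `|p`_i| * C i) => [|y y0].
  by apply: sumr_ge0 => i _; rewrite mulr_ge0.
rewrite horner_coef; apply: (le_trans (ler_wpM2r (expR_ge0 _) (ler_norm_sum _ _ _))).
rewrite mulr_suml; apply: ler_sum => i _.
by rewrite normrM -mulrA ler_wpM2l// (ger0_norm (exprn_ge0 _ y0)) HC.
Qed.

(* All derivatives of exp(-1/x) have the form p(1/x) exp(-1/x). *)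
Definition flat (p : {poly R}) (x : R) : R :=
  if 0 < x then p.[x^-1] * expR (- x^-1) else 0.

Lemma is_derive_flat (p : {poly R}) (x : R) :
  is_derive x 1 (flat p) (flat ('X^2 * (p - p^`())) x).
Proof.
have [x0|x0|<-] := ltgtP 0 x.
- have xn0 : x != 0 by rewrite gt_eqF.
  have nr : \forall y \near x, p.[y^-1] * expR (- y^-1) = flat p y.
    near=> y; rewrite /flat ifT//; near: y; exact: lt_nbhsr.
  apply: (near_eq_is_derive nr).
  rewrite /flat x0 hornerM hornerXn hornerD hornerN.
  have dV : is_derive x 1 (fun y : R => y^-1) (- x ^- 2).
    apply: is_derive_eq; first exact: is_deriveV.
    by rewrite -[LHS]/(_ * _) mulr1.
  have dp : is_derive x (1 : R) (fun y : R => p.[y^-1]) (p^`().[x^-1] * (- x ^- 2)).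
    exact: (@is_derive1_comp _ (horner p) (fun y => y^-1)).
  have dN : is_derive x (1 : R) (fun y : R => - y^-1) (x ^- 2).
    by apply: is_derive_eq; rewrite opprK.
  have de : is_derive x (1 : R) (fun y : R => expR (- y^-1)) (expR (- x^-1) * x ^- 2).
    exact: (@is_derive1_comp _ expR (fun y => - y^-1)).
  apply: is_derive_eq; rewrite /GRing.scale/= -exprVn; ring.
- have nr : \forall y \near x, cst 0 y = flat p y.
    near=> y; rewrite /flat ltNge ifF//; apply/negbTE; rewrite negbK ltW//.
    by near: y; exact: lt_nbhsl.
  apply: (near_eq_is_derive nr).
  by rewrite /flat ltNge (ltW x0)/=; exact: is_derive_cst.
(* The difference quotient at [0] is [h * (y ^+ 2 * p.[y] * exp(- y))] with [y = 1 / h], so the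
   bound for ['X^2 * p] makes it at most [C * h]. *)
have [C C0 HC] := horner_expRN_bounded ('X^2 * p).
suff lim0 : (fun h : R => h^-1 *: ((flat p \o shift 0) (h *: (1:R)) - flat p 0))
    @ 0^' --> flat ('X^2 * (p - p^`())) 0.
  apply: DeriveDef; [exact: (cvgP _ lim0)|exact: (cvg_lim _ lim0)].
rewrite {2 3}/flat ltxx.
have C1 : 0 < C + 1 by rewrite ltr_wpDl.
apply/cvgr0Pnorm_le => e e0; near=> h.
rewrite /= subr0 addr0 -[_ *: 1]/(_ * 1) mulr1 /flat; case: ifPn => [h0|_].
  apply: (@le_trans _ _ (C * h)); last first.
    apply: (@le_trans _ _ ((C + 1) * h)); first by rewrite ler_wpM2r ?(ltW h0)// lerDl.
    rewrite -ler_pdivlMl// mulrC; apply: le_trans (ler_norm _) _; near: h.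
    by apply: dnbhs0_le; exact: divr_gt0.
  have hV : 0 <= h^-1 by rewrite invr_ge0 ltW.
  have := HC _ hV; rewrite hornerM hornerXn -(ler_pM2r h0); apply: le_trans.
  rewrite -[_ *: _]/(_ * _) !normrM (ger0_norm hV) (ger0_norm (expR_ge0 _)).
  rewrite le_eqVlt; apply/orP; left; apply/eqP; field.
  by rewrite gt_eqF.
by rewrite scaler0 normr0 ltW.
Unshelve. all: by end_near.
Qed.

Lemma smooth_flat (p : {poly R}) : smooth (flat p).
Proof.
apply: (@smooth_chain _ (fun k => flat (iter k (fun p => 'X^2 * (p - p^`())) p))).
by move=> k x; exact: is_derive_flat.
Qed.

Lemma smooth_shift1d (a c : R) (b : R -> R) :
  smooth b -> smooth (fun x => b (a + c * x)).
Proof.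
apply: (@smooth_affine _ _ _ (fun x : R => a + c * x) (fun x => c * x)).
  by move=> h x v; rewrite -[h *: v]/(h * v) -[_ *: _]/(_ * _); ring.
by move=> x; apply/derivable1_diffP/ex_derive.
Qed.

(** The classical quotient [u / (u + v)] of flat functions that are positive for [x > 1] and for
    [x < 2]; these half-lines cover the line, so the denominator never vanishes. *)
Lemma smooth_step : exists B : R -> R, [/\ smooth B, (forall x, 0 <= B x <= 1),
  (forall x, x <= 1 -> B x = 0) & (forall x, 2 <= x -> B x = 1)].
Proof.
pose u x := flat 1 (-1 + 1 * x); pose v x := flat 1 (2 + (-1) * x).
have fge0 x : 0 <= flat 1 x.
  by rewrite /flat; case: ifP => // _; rewrite hornerC mul1r expR_ge0.
have fgt0 x : 0 < x -> 0 < flat 1 x.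
  by rewrite /flat => ->; rewrite hornerC mul1r expR_gt0.
have fle0 x : x <= 0 -> flat 1 x = 0.
  by rewrite /flat leNgt => /negbTE ->.
have uv0 x : 0 < u x + v x.
  have [x1|x1] := ltP 1 x.
    by apply: ltr_pwDl; [apply: fgt0; lra|exact: fge0].
  by apply: ltr_wpDl; [exact: fge0|apply: fgt0; lra].
have uv1 x : u x + v x != 0 by rewrite gt_eqF.
exists (fun x => u x * (u x + v x)^-1); split.
- apply: smoothM; first exact/smooth_shift1d/smooth_flat.
  by apply: smoothV => //; apply: smoothD; exact/smooth_shift1d/smooth_flat.
- move=> x; rewrite divr_ge0 ?(ltW (uv0 _)) ?fge0//=.
  by rewrite ler_pdivrMr// mul1r lerDl fge0.
- by move=> x x1; rewrite {1}/u fle0 ?mul0r//; lra.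
- move=> x x2; have vx : v x = 0; last by have := uv1 x; rewrite vx addr0 => ux0; rewrite divff.
  by rewrite /v fle0//; lra.
Qed.

(** Since [b] vanishes up to [1], integrating from [0] also gives the primitive at negative [x],
    where the interval is empty. *)
Lemma antiderivative (b : R -> R) : continuous b -> (forall x, x <= 1 -> b x = 0) ->
  exists2 H : R -> R, (forall x : R, is_derive x (1 : R) H (b x)) &
    forall x, x <= 1 -> H x = 0.
Proof.
move=> cb b0; pose H x := (\int[lebesgue_measure]_(t in [set` `[0, x]]) b t)%R.
have H0 x : x <= 1 -> H x = 0.
  move=> x1; rewrite /H; apply: etrans (_ : \int[lebesgue_measure]_(t in `[0, x]) 0 = 0).
    apply: eq_Rintegral => t /set_mem /=; rewrite in_itv/= => /andP[_ tx].
    by rewrite b0// (le_trans tx).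
  by rewrite Rintegral_cst ?mul0r.
exists H => // x; have [x1|x1] := ltP x 1.
  have nr : \forall y \near x, cst 0 y = H y.
    by near=> y; rewrite H0// ltW//; near: y; exact: lt_nbhsl.
  apply: (near_eq_is_derive nr).
  by rewrite b0 ?(ltW x1)//; exact: is_derive_cst.
have := @continuous_FTC1_closed _ b 0 x (x + 1) _ _ _ (cb x).
case.
- by rewrite ltrDl.
- apply: continuous_compact_integrable; first exact: segment_compact.
  by apply: continuous_subspaceT.
- by rewrite (lt_le_trans _ x1).
- by move=> dH <-; rewrite derive1E; exact: derivableP.
Unshelve. all: by end_near. Qed.

(* The rescaled functions [e * G (s / e)] truncate a function near its zero set without
   increasing its Dirichlet energy. *)
Lemma smooth_truncation : exists G g : R -> R,
  [/\ smooth G, (forall x : R, is_derive x (1 : R) G (g x)), (forall x, 0 <= g x <= 1),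
     (forall x, `|x| <= 1 -> G x = 0) & (forall x, `|G x - x| <= 2)].
Proof.
have [B [sB B01 B0 B1]] := smooth_step.
have [H dH H0] := antiderivative (smooth_continuous sB) B0.
have sH : smooth H by exact: smooth_antiderivative dH sB.
have dHN (x : R) : is_derive x (1 : R) (fun x => H (- x)) (- B (- x)).
  rewrite -mulrN1.
  exact: (@is_derive1_comp _ H -%R x _ _ (dH (- x)) (is_deriveNid x 1)).
have HC (x : R) : {for x, continuous H}.
  exact: (smooth_continuous sH).
have Hx (x : R) : 0 <= x -> x - 2 <= H x <= x.
  move=> x0.
  have key (a b : R) : a <= b -> 0 <= H b - H a <= b - a.
    move=> ab.
    have [c _ ->] := @MVT_segment _ H B a b ab (fun x _ => dH x)
      (continuous_subspaceT HC).
    have /andP[c0 c1] := B01 c.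
    by rewrite mulr_ge0 ?subr_ge0//= ler_piMl ?subr_ge0.
  have h0 : H 0 = 0 by exact: H0.
  have [x2|x2] := leP x 2.
    by have := key 0 x x0; rewrite h0; lra.
  have [c + Hc] := @MVT_segment _ H B 2 x (ltW x2) (fun x _ => dH x)
      (continuous_subspaceT HC).
  rewrite in_itv/= => /andP[c2 _]; have Bc := B1 c c2.
  have := key 0 2 _; rewrite h0; move: Hc; rewrite Bc; lra.
(* [H] is a smoothed positive part that lags behind the identity by at most [2]. Its odd extension
   has an even derivative whose two terms are never nonzero together, which keeps it within
   [[0, 1]]. *)
exists (fun x => H x - H (- x)), (fun x => B x + B (- x)); split.
- apply: smoothB => //.
  rewrite (_ : (fun x => _) = (fun x => H (0 + (-1) * x))); first exact: smooth_shift1d.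
  by apply/funext => x; rewrite add0r mulN1r.
- move=> x; rewrite -[B (- x)]opprK; exact: is_deriveB.
- move=> x; have /andP[b0 b1] := B01 x; have /andP[c0 c1] := B01 (- x).
  rewrite addr_ge0//=; have [x1|x1] := leP x 1; first by rewrite B0// add0r.
  by rewrite (B0 (- x)) ?addr0//; lra.
- by move=> x; rewrite ler_norml => /andP[x1 x2]; rewrite !H0 ?subrr//; lra.
- move=> x; rewrite ler_norml; have [x0|x0] := leP 0 x.
    by have := Hx x x0; rewrite (H0 (- x)); lra.
  have := Hx (- x); rewrite (H0 x); lra.
Qed.

End cutoff.

(** * Square-integrable functions *)

Section semi_inner.
Context (R : realType) (V : lmodType R).

(* Functions are not identified almost everywhere, so [B] is only semidefinite on [S] and the
   convergence of [u_] to [u] is expressed as [B (u_ n - u) (u_ n - u) --> 0]. *)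
Definition semi_inner (S : set V) (B : V -> V -> R) :=
  [/\ S 0, forall a u v, S u -> S v -> S (a *: u + v),
     forall u v, S u -> S v -> B u v = B v u,
     forall a u v w, S u -> S v -> S w -> B (a *: u + v) w = a * B u w + B v w
   & forall u, S u -> 0 <= B u u].

Context (S : set V) (B : V -> V -> R) (SB : semi_inner S B).

Lemma semi_innerS0 : S 0. Proof. by case: SB. Qed.

Lemma semi_innerSL a u v : S u -> S v -> S (a *: u + v).
Proof. by case: SB => _ + _ _ _; apply. Qed.

Lemma semi_innerSD u v : S u -> S v -> S (u + v).
Proof. by move=> Su Sv; rewrite -[u]scale1r; exact: semi_innerSL. Qed.

Lemma semi_innerSZ a u : S u -> S (a *: u).
Proof. by move=> Su; rewrite -[_ *: _]addr0; exact: (semi_innerSL _ Su semi_innerS0). Qed.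

Lemma semi_innerSB u v : S u -> S v -> S (u - v).
Proof. by move=> Su Sv; rewrite -[- v]scaleN1r addrC; exact: semi_innerSL. Qed.

Lemma semi_innerC u v : S u -> S v -> B u v = B v u.
Proof. by case: SB => _ _ + _ _; apply. Qed.

Lemma semi_innerL a u v w : S u -> S v -> S w ->
  B (a *: u + v) w = a * B u w + B v w.
Proof. by case: SB => _ _ _ + _; apply. Qed.

Lemma semi_inner_ge0 u : S u -> 0 <= B u u.
Proof. by case: SB => _ _ _ _; apply. Qed.

Lemma semi_inner0 w : S w -> B 0 w = 0.
Proof.
move=> Sw; have := semi_innerL (-1) semi_innerS0 semi_innerS0 Sw.
by rewrite scaler0 add0r mulN1r addNr.
Qed.

Lemma semi_innerZ a u w : S u -> S w -> B (a *: u) w = a * B u w.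
Proof.
move=> Su Sw; rewrite -[_ *: _]addr0 semi_innerL// ?semi_inner0 ?addr0//.
exact: semi_innerS0.
Qed.

Lemma semi_innerD u v w : S u -> S v -> S w -> B (u + v) w = B u w + B v w.
Proof. by move=> *; rewrite -[u]scale1r semi_innerL// mul1r scale1r. Qed.

Lemma semi_innerB u v w : S u -> S v -> S w -> B (u - v) w = B u w - B v w.
Proof.
by move=> *; rewrite -scaleN1r addrC semi_innerL// mulN1r addrC.
Qed.

Lemma semi_innerDr u v w : S u -> S v -> S w -> B w (u + v) = B w u + B w v.
Proof.
move=> *; rewrite semi_innerC//; last exact: semi_innerSD.
by rewrite semi_innerD// !(@semi_innerC w).
Qed.

Lemma semi_innerBr u v w : S u -> S v -> S w -> B w (u - v) = B w u - B w v.
Proof.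
move=> *; rewrite semi_innerC//; last exact: semi_innerSB.
by rewrite semi_innerB// !(@semi_innerC w).
Qed.

Lemma semi_innerZr a u w : S u -> S w -> B w (a *: u) = a * B w u.
Proof.
move=> *; rewrite semi_innerC//; last exact: semi_innerSZ.
by rewrite semi_innerZ// (@semi_innerC w).
Qed.

Lemma semi_inner_sqrD a u v : S u -> S v ->
  B (a *: u + v) (a *: u + v) = a ^+ 2 * B u u + 2 * a * B u v + B v v.
Proof.
move=> Su Sv; have Sau := semi_innerSZ a Su.
rewrite semi_innerL//; last exact: semi_innerSD.
rewrite !semi_innerDr// !semi_innerZr// (@semi_innerC v u)//; ring.
Qed.

Lemma semi_inner_parallelogram u v : S u -> S v ->
  B (u - v) (u - v) + B (u + v) (u + v) = 2 * B u u + 2 * B v v.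
Proof.
move=> Su Sv; rewrite -[u in u + v]scale1r [u - v]addrC -scaleN1r.
rewrite !semi_inner_sqrD// (semi_innerC Sv Su); ring.
Qed.

Lemma semi_inner_sub_le u v : S u -> S v ->
  B (u - v) (u - v) <= 2 * B u u + 2 * B v v.
Proof.
move=> Su Sv; rewrite -(semi_inner_parallelogram Su Sv) lerDl.
exact/semi_inner_ge0/semi_innerSD.
Qed.

Lemma semi_inner_CS u v : S u -> S v -> B u v ^+ 2 <= B u u * B v v.
Proof.
move=> Su Sv.
have H a : 0 <= a ^+ 2 * B u u + 2 * a * B u v + B v v.
  by rewrite -semi_inner_sqrD//; apply/semi_inner_ge0/semi_innerSL.
have Bu := semi_inner_ge0 Su; have Bv := semi_inner_ge0 Sv.
have [Bu0|Bu0] := eqVneq (B u u) 0.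
  suff -> : B u v = 0 by rewrite expr0n mulr_ge0.
  apply/eqP; apply: contraT => Buv.
  (* With [B u u = 0] the quadratic is affine in [a], and this choice of [a] would give it the value
     [-1]. *)
  have := H (- (B v v + 1) / (2 * B u v)).
  rewrite Bu0 mulr0 add0r (_ : _ + _ = -1); last by field.
  by rewrite ler0N1.
have := H (- B u v / B u u).
have -> : (- B u v / B u u) ^+ 2 * B u u + 2 * (- B u v / B u u) * B u v + B v v =
  (B u u * B v v - B u v ^+ 2) / B u u by field.
have Bupos : 0 < B u u by rewrite lt_def Bu0.
by rewrite pmulr_lge0 ?invr_gt0// subr_ge0.
Qed.

Lemma semi_inner_CS_sqrt u v : S u -> S v ->
  `|B u v| <= Num.sqrt (B u u) * Num.sqrt (B v v).
Proof.
move=> Su Sv; rewrite -sqrtrM ?semi_inner_ge0// -sqrtr_sqr.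
exact/ler_wsqrtr/semi_inner_CS.
Qed.

(** Expanding [B] around the limits leaves three terms with a factor that tends to zero in the
    seminorm; Cauchy-Schwarz disposes of each. *)
Lemma semi_inner_cvg (T : Type) (F : set_system T) {FF : Filter F}
    (u_ v_ : T -> V) u v :
  (forall n, S (u_ n)) -> (forall n, S (v_ n)) -> S u -> S v ->
  B (u_ n - u) (u_ n - u) @[n --> F] --> 0 ->
  B (v_ n - v) (v_ n - v) @[n --> F] --> 0 ->
  B (u_ n) (v_ n) @[n --> F] --> B u v.
Proof.
move=> Su_ Sv_ Su Sv Hu Hv.
have Sun n : S (u_ n - u) by exact: semi_innerSB.
have Svn n : S (v_ n - v) by exact: semi_innerSB.
have -> : (fun n => B (u_ n) (v_ n)) =
    (fun n => B (u_ n - u) (v_ n - v) + B (u_ n - u) v + B u (v_ n - v) + B u v).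
  apply/funext => n.
  have key a b : S a -> S b ->
      B (a + u) (b + v) = B a b + B a v + B u b + B u v.
    move=> Sa Sb; have Sbv := semi_innerSD Sb Sv.
    by rewrite semi_innerD// !semi_innerDr// addrA.
  by rewrite -key// !subrK.
have squ : Num.sqrt (B (u_ n - u) (u_ n - u)) @[n --> F] --> 0.
  by rewrite -sqrtr0; apply: continuous_cvg => //; exact: sqrt_continuous.
have sqv : Num.sqrt (B (v_ n - v) (v_ n - v)) @[n --> F] --> 0.
  by rewrite -sqrtr0; apply: continuous_cvg => //; exact: sqrt_continuous.
have CS0 (f g : T -> V) (l : R) : (forall n, S (f n)) -> (forall n, S (g n)) ->
    Num.sqrt (B (f n) (f n)) @[n --> F] --> 0 ->
    Num.sqrt (B (g n) (g n)) @[n --> F] --> l ->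
    B (f n) (g n) @[n --> F] --> 0.
  move=> Sf Sg Hf Hg; apply/norm_cvg0P.
  apply: (squeeze_cvgr (f := cst 0)
      (h := fun n => Num.sqrt (B (f n) (f n)) * Num.sqrt (B (g n) (g n)))).
  - by apply: nearW => n; rewrite normr_ge0 semi_inner_CS_sqrt.
  - exact: cvg_cst.
  - by rewrite -(mul0r l); exact: cvgM.
rewrite -[X in _ --> X]add0r; apply: cvgD; last exact: cvg_cst.
rewrite -[X in _ --> X]add0r; apply: cvgD.
  rewrite -[X in _ --> X]add0r; apply: cvgD; first exact: CS0 sqv.
  by apply: (CS0 _ _ (Num.sqrt (B v v))) => //; exact: cvg_cst.
under eq_fun do rewrite semi_innerC//.
by apply: (CS0 _ _ (Num.sqrt (B u u))) => //; exact: cvg_cst.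
Qed.

End semi_inner.

(** * The inner product of square-integrable vector functions *)

Section L2_inner.
Context (R : realType) d (T : measurableType d) (mu : {measure set T -> \bar R}).
Context (D : set T) (mD : measurable D).

Lemma L2_cst0 : L2 mu D (cst 0).
Proof.
split; first exact: measurable_cst.
rewrite /L2sq; under eq_integral do rewrite /= expr0n.
by rewrite integral0 ltry.
Qed.

Lemma L2_sqr_integrable f : L2 mu D f -> mu.-integrable D (fun x => (f x ^+ 2)%:E).
Proof.
move=> [mf f2]; apply/integrableP; split.
  by apply/measurable_EFinP; exact: measurable_funX.
apply: le_lt_trans f2; rewrite /L2sq le_eqVlt; apply/orP; left; apply/eqP.
by apply: eq_integral => x _; rewrite gee0_abs// lee_fin sqr_ge0.
Qed.

Lemma L2_integrableM f g : L2 mu D f -> L2 mu D g ->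
  mu.-integrable D (fun x => (f x * g x)%:E).
Proof.
move=> Lf Lg; have [mf _] := Lf; have [mg _] := Lg.
apply: (@le_integrable _ _ _ mu D mD _ (fun x => ((f x ^+ 2)%:E + (g x ^+ 2)%:E)%E)).
- by apply/measurable_EFinP; exact: measurable_funM.
- move=> x Dx; rewrite -EFinD !abse_EFin lee_fin (ger0_norm (addr_ge0 (sqr_ge0 _) (sqr_ge0 _))).
  rewrite ler_norml; apply/andP; split; nra.
- by apply: integrableD => //; exact: L2_sqr_integrable.
Qed.

Lemma L2_lin a f g : L2 mu D f -> L2 mu D g -> L2 mu D (fun x => a * f x + g x).
Proof.
move=> Lf Lg; have [mf _] := Lf; have [mg _] := Lg.
have mh : measurable_fun D (fun x => a * f x + g x).
  by apply: measurable_funD => //; apply: measurable_funM => //; exact: measurable_cst.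
split => //; have : mu.-integrable D (fun x => ((a ^+ 2 *+ 2)%:E * (f x ^+ 2)%:E + 2%:E * (g x ^+ 2)%:E)%E).
  by apply: integrableD => //; apply: integrableZl => //; exact: L2_sqr_integrable.
move=> /integrableP[_]; apply: le_lt_trans; rewrite /L2sq.
apply: ge0_le_integral => //.
- by move=> x _; rewrite lee_fin sqr_ge0.
- by apply/measurable_EFinP; exact: measurable_funX.
- apply: measurableT_comp => //; apply/measurable_EFinP => /=.
  apply: measurable_funD; apply: measurable_funM => //; exact: measurable_funX.
- move=> x _; rewrite -!EFinM -EFinD abse_EFin lee_fin; apply: le_trans (ler_norm _).
  rewrite -subr_ge0 (_ : _ - _ = (a * f x - g x) ^+ 2) ?sqr_ge0//; ring.
Qed.

Context (W : lmodType R) (I : finType) (c : I -> W -> R).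
Hypothesis clin : forall i a u v, c i (a *: u + v) = a * c i u + c i v.

(** The linear coordinates [c i] abstract from the target space, so that one development serves
    scalars, vectors of ['rV_d] and fields on the cylinder. *)
Definition L2vec (G : T -> W) := forall i, L2 mu D (fun x => c i (G x)).

Definition L2vec_inner (G H : T -> W) : R :=
  \int[mu]_(x in D) (\sum_i c i (G x) * c i (H x)).

Lemma L2vec_integrable G H : L2vec G -> L2vec H ->
  mu.-integrable D (EFin \o (fun x => \sum_i c i (G x) * c i (H x))).
Proof.
move=> LG LH; rewrite (_ : EFin \o _ =
  (fun x => (\sum_i (c i (G x) * c i (H x))%:E)%E)).
  by apply: integrable_sum => // i _; exact: L2_integrableM.
by apply/funext => x; rewrite /= sumEFin.
Qed.

Lemma L2vec_semi_inner : semi_inner (L2vec : set (T -> W)) L2vec_inner.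
Proof.
split.
- move=> i; rewrite (_ : (fun x => _) = cst 0); first exact: L2_cst0.
  apply/funext => x /=.
  have := clin i (-1) 0 0; rewrite scaler0 add0r mulN1r addNr; exact.
- move=> a G H LG LH i; rewrite (_ : (fun x => _) = (fun x => a * c i (G x) + c i (H x))).
    exact: L2_lin.
  by apply/funext => x /=; rewrite -clin.
- move=> G H LG LH; apply: eq_Rintegral => x _.
  by apply: eq_bigr => i _; rewrite mulrC.
- move=> a G H K LG LH LK; rewrite /L2vec_inner.
  transitivity (\int[mu]_(x in D) (a * (\sum_i c i (G x) * c i (K x)) +
      \sum_i c i (H x) * c i (K x))).
    apply: eq_Rintegral => x _; rewrite mulr_sumr -big_split/=.
    by apply: eq_bigr => i _; rewrite clin; ring.
  have IG := L2vec_integrable LG LK.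
  rewrite RintegralD// ?RintegralZl//; last exact: L2vec_integrable.
  exact: (integrableZl mD a IG).
- move=> G LG; apply: Rintegral_ge0 => x _; apply: sumr_ge0 => i _.
  by rewrite -expr2 sqr_ge0.
Qed.

Lemma L2vec_innerE G H : L2vec G -> L2vec H ->
  (\int[mu]_(x in D) (\sum_i c i (G x) * c i (H x))%:E)%E = (L2vec_inner G H)%:E.
Proof.
move=> LG LH; rewrite /L2vec_inner /Rintegral fineK//.
by apply: integrable_fin_num => //; exact: L2vec_integrable.
Qed.

End L2_inner.

(** * Completeness of L^2 *)

Section L2_complete.
Context (R : realType) d (T : measurableType d) (mu : {measure set T -> \bar R}).
Context (D : set T) (mD : measurable D).

(* The weights [2 ^ k] make both the sum of the squares integrable and the increments
   pointwise summable. *)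
Lemma telescope_sqr_le (u : nat -> R) n m :
  (u (n + m)%N - u n) ^+ 2 <=
  2 * 2^-1 ^+ n * \sum_(n <= k < n + m) 2 ^+ k * (u k.+1 - u k) ^+ 2.
Proof.
elim: m n => [|m IH] n; first by rewrite addn0 subrr expr0n/= big_geq// mulr0.
rewrite big_ltn ?addnS ?ltnS ?leq_addr// -addSn; have := IH n.+1.
set S := \sum_(_ <= _ < _) _ => IHn.
have -> : 2 * 2^-1 ^+ n * (2 ^+ n * (u n.+1 - u n) ^+ 2 + S) =
   2 * (u n.+1 - u n) ^+ 2 + 2 * (2 * 2^-1 ^+ n.+1 * S).
  have : 2^-1 ^+ n * 2 ^+ n = 1 :> R by rewrite -exprMn mulVf ?expr1n.
  rewrite (exprS _ n); move: (2^-1 ^+ n) (2 ^+ n) ((u n.+1 - u n) ^+ 2) => q r X qr.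
  transitivity (2 * (q * r) * X + 2 * q * S); first by ring.
  by rewrite qr; field.
apply: (@le_trans _ _ (2 * (u n.+1 - u n) ^+ 2 + 2 * (u (n.+1 + m)%N - u n.+1) ^+ 2)).
  have := sqr_ge0 ((u n.+1 - u n) - (u (n.+1 + m)%N - u n.+1)); nra.
by rewrite lerD2l ler_pM2l.
Qed.

Lemma sum_half_le (n : nat) : \sum_(0 <= k < n) 2^-1 ^+ k <= 2 :> R.
Proof.
suff -> : \sum_(0 <= k < n) 2^-1 ^+ k = 2 - 2 * 2^-1 ^+ n :> R.
  by rewrite lerBlDr lerDl mulr_ge0// exprn_ge0.
elim: n => [|n IH]; first by rewrite big_geq// expr0 mulr1 subrr.
by rewrite big_nat_recr//= IH exprS; field.
Qed.

(** The Riesz-Fischer argument. The weighted sum [h] of the squared increments has integral at most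
    [2], and [2 * 2^-1 ^+ n * h] dominates all squares [(f (n + m) - f n) ^+ 2]. So the sequence
    converges wherever [h] is finite, and the bound survives in the limit [m --> oo]. *)
Lemma L2_complete (f : nat -> T -> R) : (forall n, L2 mu D (f n)) ->
  (forall n, L2sq mu D (fun x => (f n.+1 x - f n x)%R) <= (4^-1 ^+ n)%:E)%E ->
  exists g : T -> R, L2 mu D g /\
    forall n, (L2sq mu D (fun x => (f n x - g x)%R) <= (4 * 2^-1 ^+ n)%:E)%E.
Proof.
move=> Lf fc; pose e n x := 2 ^+ n * (f n.+1 x - f n x) ^+ 2.
have e0 n x : 0 <= e n x by rewrite mulr_ge0 ?sqr_ge0 ?exprn_ge0.
have mf n : measurable_fun D (f n) by have [] := Lf n.
have me n : measurable_fun D (EFin \o e n).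
  apply/measurable_EFinP; apply: measurable_funM; first exact: measurable_cst.
  by apply: measurable_funX; exact: measurable_funB.
pose h x := (\sum_(k <oo) (e k x)%:E)%E.
have h0 x : (0 <= h x)%E by apply: nneseries_ge0 => k _ _; rewrite lee_fin e0.
have mh : measurable_fun D h.
  by apply: (@ge0_emeasurable_sum _ _ _ _ (fun n x => (e n x)%:E) xpredT) => [k x _ _|k _]; [rewrite lee_fin e0|exact: me].
have ih : (\int[mu]_(x in D) h x <= 2%:E)%E.
  rewrite integral_nneseries//; last by move=> n x _; rewrite lee_fin e0.
  apply: lime_le; first by apply: is_cvg_nneseries => n _ _; apply: integral_ge0 => x _; rewrite lee_fin e0.
  apply: nearW => n; apply: (@le_trans _ _ (\sum_(0 <= k < n) (2^-1 ^+ k)%:E)%E); last first.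
    by rewrite sumEFin lee_fin sum_half_le.
  apply: lee_sum => k _; rewrite /e.
  under eq_integral do rewrite EFinM.
  rewrite ge0_integralZl//; last 2 first.
  - by apply/measurable_EFinP; apply: measurable_funX; exact: measurable_funB.
  - by move=> x _; rewrite lee_fin sqr_ge0.
  apply: le_trans (lee_wpmul2l _ (fc k)) _; first by rewrite lee_fin exprn_ge0.
  by rewrite -EFinM lee_fin -exprMn (_ : 2 * 4^-1 = 2^-1)//; field.
have fcauchy x n m : (((f (n + m)%N x - f n x) ^+ 2)%R%:E <= (2 * 2^-1 ^+ n)%R%:E * h x)%E.
  apply: (@le_trans _ _ ((2 * 2^-1 ^+ n)%:E * (\sum_(n <= k < n + m) (e k x)%:E))%E).
    by rewrite sumEFin -EFinM lee_fin (telescope_sqr_le (fun k => f k x)).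
  apply: lee_wpmul2l; first by rewrite lee_fin mulr_ge0// exprn_ge0.
  apply: (@le_trans _ _ (\sum_(0 <= k < n + m) (e k x)%:E)%E).
    rewrite [leRHS](@big_cat_nat _ _ _ n)//= ?leq_addr//.
    by rewrite leeDr// sume_ge0// => k _; rewrite lee_fin e0.
  by apply: nneseries_lim_ge => k _; rewrite lee_fin e0.
have small (H r : R) : 0 < r -> exists n, 2 * 2^-1 ^+ n * H < r.
  move=> r0; have : (fun n => 2 * 2^-1 ^+ n * H) @ \oo --> 2 * 0 * H.
    apply: cvgMl; apply: cvgMr; apply: cvg_expr.
    by rewrite ger0_norm// invf_lt1 ?ltr1n.
  rewrite mulr0 mul0r => /cvgr0Pnorm_lt/(_ r r0)[N _ HN]; exists N.
  by apply: le_lt_trans (ler_norm _) _; exact: HN N (leqnn N).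
have cA x : (h x < +oo)%E -> cvgn (fun n => f n x).
  move=> hx; apply/cauchy_cvgP; apply: cauchy_exP => r e_gt0.
  have hfin : h x \is a fin_num by rewrite ge0_fin_numE.
  have [n Hn] := small (fine (h x)) (r ^+ 2) (exprn_gt0 2 e_gt0).
  exists (f n x); exists n => //= m /= nm.
  rewrite /ball/= -(@ltr_pXn2r _ 2)// ?nnegrE ?normr_ge0 ?(ltW e_gt0)//.
  have := fcauchy x n (m - n)%N; rewrite subnKC// -(fineK hfin) -EFinM lee_fin.
  by rewrite -normrX ger0_norm ?sqr_ge0// -(sqrrN (f n x - f m x)) opprB => /le_lt_trans; apply.
(* Where [h] is infinite the sequence is replaced by zero, so that the limit exists at every point
   and is measurable; the bound by [h] is trivial there. *)
pose fA n x := if (h x < +oo)%E then f n x else 0.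
pose g x := limn (fun n => fA n x).
have fAg x : fA ^~ x @ \oo --> g x.
  rewrite /g; have [hx|hx] := boolP (h x < +oo)%E.
    rewrite (_ : fA ^~ x = f ^~ x); first exact: cA.
    by apply/funext => n; rewrite /fA hx.
  rewrite (_ : fA ^~ x = cst 0); first by rewrite lim_cst//; exact: cvg_cst.
  by apply/funext => n; rewrite /fA (negbTE hx).
have mg : measurable_fun D g.
  apply: (measurable_fun_cvg (h := fA)) => [n|x _]; last exact: fAg.
  apply: measurable_fun_if => //.
  - exact: measurable_fun_lte.
  - by apply: (measurable_funS mD) => // x [].
have fg n : (L2sq mu D (fun x => (f n x - g x)%R) <= (4 * 2^-1 ^+ n)%:E)%E.
  have c0 : (0 <= (2 * 2^-1 ^+ n)%:E :> \bar R)%E by rewrite lee_fin mulr_ge0// exprn_ge0.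
  apply: (@le_trans _ _ (\int[mu]_(x in D) ((2 * 2^-1 ^+ n)%:E * h x)))%E.
    apply: ge0_le_integral => //.
    - by move=> x _; rewrite lee_fin sqr_ge0.
    - by apply/measurable_EFinP; apply: measurable_funX; exact: measurable_funB.
    - exact: measurable_funeM.
    - move=> x Dx; have [hx|hx] := boolP (h x < +oo)%E; last first.
        have -> : h x = +oo%E by apply/eqP; rewrite -leye_eq leNgt.
        by rewrite gt0_muley ?leey// lte_fin mulr_gt0// exprn_gt0.
      have hfin : h x \is a fin_num by rewrite ge0_fin_numE.
      rewrite -(fineK hfin) -EFinM lee_fin.
      have gx : (fun m => (f n x - f (n + m)%N x) ^+ 2) @ \oo --> (f n x - g x) ^+ 2.
        rewrite expr2; under eq_fun do rewrite expr2.
        have lim1 : (fun m => f n x - f (n + m)%N x) @ \oo --> f n x - g x.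
          apply: cvgB; first exact: cvg_cst.
          have -> : (fun m => f (n + m)%N x) = (fun m => fA (m + n)%N x).
            by apply/funext => m; rewrite /fA hx addnC.
          by rewrite (cvg_shiftn n (fA ^~ x)).
        exact: cvgM.
      rewrite -(cvg_lim _ gx)//; apply: limr_le; first exact: (cvgP _ gx).
      apply: nearW => m /=.
      have := fcauchy x n m; rewrite -(fineK hfin) -EFinM lee_fin.
      by rewrite -(sqrrN (f n x - _)) opprB.
  rewrite ge0_integralZl//.
  apply: le_trans (lee_wpmul2l c0 ih) _; rewrite -EFinM lee_fin le_eqVlt; apply/orP; left.
  by apply/eqP; ring.
exists g; split => //.
have Lfg : L2 mu D (fun x => f 0%N x - g x).
  split; first exact: measurable_funB.
  by apply: le_lt_trans (fg 0%N) _; rewrite ltry.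
have := L2_lin mD (-1) Lfg (Lf 0%N).
by congr (L2 _ _ _); apply/funext => x /=; ring.
Qed.

Lemma L2vec_complete (W : lmodType R) (I : finType) (c : I -> W -> R)
    (mk : (I -> R) -> W) (f : nat -> T -> W) :
  (forall i a u v, c i (a *: u + v) = a * c i u + c i v) ->
  (forall a i, c i (mk a) = a i) ->
  (forall n, L2vec mu D c (f n)) ->
  (forall n, L2vec_inner mu D c (f n.+1 - f n) (f n.+1 - f n) <= 4^-1 ^+ n) ->
  exists g : T -> W, L2vec mu D c g /\
    L2vec_inner mu D c (f n - g) (f n - g) @[n --> \oo] --> 0.
Proof.
move=> clin cmk Lf fc.
have SI := L2vec_semi_inner mu mD clin.
have cB i u v : c i (u - v) = c i u - c i v.
  by rewrite addrC -scaleN1r clin mulN1r addrC.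
have Lsum G H : L2vec mu D c G -> L2vec mu D c H ->
    (L2vec_inner mu D c (G - H) (G - H))%:E =
    (\sum_i L2sq mu D (fun x => (c i (G x) - c i (H x))%R))%E.
  move=> LG LH; have LGH := semi_innerSB SI LG LH.
  rewrite -L2vec_innerE//.
  under eq_integral do rewrite -sumEFin.
  rewrite ge0_integral_sum//.
  - apply: eq_bigr => i _; apply: eq_integral => x _; congr (_%:E).
    by rewrite -expr2 -cB.
  - move=> i; apply/measurable_EFinP; apply: measurable_funM; exact: (LGH i).1.
  - by move=> i x _; rewrite lee_fin -expr2 sqr_ge0.
have /choice[g Hg] : forall i, exists g : T -> R, L2 mu D g /\
    forall n, (L2sq mu D (fun x => (c i (f n x) - g x)%R) <= (4 * 2^-1 ^+ n)%:E)%E.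
  move=> i; apply: L2_complete => [n|n]; first exact: Lf.
  have := fc n; rewrite -lee_fin Lsum//; apply: le_trans.
  rewrite (bigD1 i)//= leeDl// sume_ge0// => j _; apply: integral_ge0 => x _.
  by rewrite lee_fin sqr_ge0.
have Lg : L2vec mu D c (fun x => mk (fun i => g i x)).
  move=> i; rewrite (_ : (fun x => _) = g i); first by case: (Hg i).
  by apply/funext => x; rewrite cmk.
exists (fun x => mk (fun i => g i x)); split => //.
apply: (squeeze_cvgr (f := cst 0) (h := fun n => \sum_(i : I) 4 * 2^-1 ^+ n)).
- apply: nearW => n; rewrite (semi_inner_ge0 SI); last exact: (semi_innerSB SI).
  rewrite -lee_fin Lsum// -sumEFin; apply: lee_sum => i _.
  by under eq_fun do rewrite cmk; have [_] := Hg i.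
- exact: cvg_cst.
- rewrite (_ : (fun n => _) = (fun n => (4 * #|I|%:R) * 2^-1 ^+ n)); last first.
    by apply/funext => n; rewrite sumr_const -mulr_natr; ring.
  rewrite -[X in _ --> X](mulr0 (4 * #|I|%:R)); apply: cvgMr; apply: cvg_expr.
  by rewrite ger0_norm// invf_lt1 ?ltr1n.
Qed.

End L2_complete.

(** * Measurability and iterated integrals *)

Section open_measurable.
Context (R : realType).

(** An open set is the union of the countably many balls of center [pt c] and radius [k.+1%:R^-1]
    that it contains. This links the topology with the sigma-algebra generated by the coordinates,
    both on ['rV_n] and on its product with [R]. *)
Lemma open_bigcup_basis (T : pseudoMetricType R) (M : set (set T)) (C : countType)
    (pt : C -> T) :
  M set0 -> (forall F : nat -> set T, (forall k, M (F k)) -> M (\bigcup_k F k)) ->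
  (forall x e, 0 < e -> exists c, ball x e (pt c)) ->
  (forall c (k : nat), M (ball (pt c) k.+1%:R^-1)) ->
  forall A, open A -> M A.
Proof.
move=> M0 MU dpt Mb A oA.
pose F (n : nat) : set T :=
  if @unpickle (C * nat)%type n is Some (c, k) then
    if `[< ball (pt c) k.+1%:R^-1 `<=` A >] then ball (pt c) k.+1%:R^-1 else set0
  else set0.
have -> : A = \bigcup_n F n.
  apply/seteqP; split => [x Ax|x [n _]]; last first.
    by rewrite /F; case: unpickle => [[c k]|//]; case: ifPn => // /asboolP; apply.
  have /nbhs_ballP[e /= e0 eA] : nbhs x A by exact: open_nbhs_nbhs.
  have [k ke] : exists k : nat, k.+1%:R^-1 < e / 2.
    have := near_infty_natSinv_lt (PosNum (divr_gt0 e0 (ltr0n R 2))).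
    by move=> [k _ /(_ k)]/= => /(_ (leqnn k)) ?; exists k.
  have k0 : 0 < k.+1%:R^-1 :> R by rewrite invr_gt0.
  have [c xc] := dpt x _ k0.
  exists (pickle (c, k)) => //; rewrite /F pickleK ifT; first exact: ball_sym.
  apply/asboolP => y cy; apply: eA.
  have : ball x (k.+1%:R^-1 + k.+1%:R^-1) y by apply: ball_triangle cy.
  by apply: le_ball; rewrite (splitr e) lerD// ltW.
apply: MU => n; rewrite /F; case: unpickle => [[c k]|//].
by case: ifPn.
Qed.

Lemma ball_rat (x e : R) : 0 < e -> exists q : rat, ball x e (ratr q : R).
Proof.
move=> e0; have [q] := rat_in_itvoo (ltr_pwDr e0 (lexx x)).
rewrite in_itv/= => /andP[xq qe]; exists q.
by rewrite /ball/= ler0_norm; lra.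
Qed.

(** Balls for the maximum norm are cubes, hence measurable; rational vectors provide the countable
    set of centers. *)
Lemma open_measurable_rV n (A : set 'rV[R]_n) : open A -> measurable A.
Proof.
apply: (@open_bigcup_basis 'rV[R]_n (measurable : set (set 'rV[R]_n)) 'rV[rat]_n (map_mx ratr)) A => [||x e e0|c k].
- exact: measurable0.
- by move=> F mF; exact: bigcupT_measurable.
- have /choice[q Hq] := fun j => ball_rat (x ord0 j) e0.
  exists (\row_j q j); split => // i j; rewrite (ord1 i) !mxE; exact: Hq.
- rewrite (_ : ball _ _ = [set v : 'rV[R]_n | forall j,
     (ball (ratr (c ord0 j) : R) k.+1%:R^-1 : set (measurableTypeR R)) (v ord0 j)]).
    apply: (@measurable_box _ _ (fun j =>
      ball (ratr (c ord0 j) : R) k.+1%:R^-1 : set (measurableTypeR R))) => j.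
    exact: measurable_ball.
  apply/seteqP; split => [v [_ Hv] j|v Hv].
    by have := Hv ord0 j; rewrite !mxE.
  split; first by rewrite invr_gt0.
  by move=> i j; rewrite (ord1 i) !mxE; exact: Hv.
Qed.

Lemma open_measurable_rV_R n (A : set ('rV[R]_n * R)) : open A ->
  measurable (A : set ('rV[R]_n * measurableTypeR R)).
Proof.
apply: (@open_bigcup_basis ('rV[R]_n * R)%type
   (measurable : set (set ('rV[R]_n * measurableTypeR R)))
   ('rV[rat]_n * rat)%type (fun c => (map_mx ratr c.1, ratr c.2))) A => [||x e e0|[c r] k].
- exact: measurable0.
- by move=> F mF; exact: bigcupT_measurable.
- have /choice[q Hq] := fun j => ball_rat (x.1 ord0 j) e0.
  have [r Hr] := ball_rat x.2 e0.
  exists (\row_j q j, r); split => //=; split => // i j; rewrite (ord1 i) !mxE.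
  exact: Hq.
- rewrite (_ : ball _ _ = ball (map_mx ratr c : 'rV[R]_n) k.+1%:R^-1 `*`
     (ball (ratr r : R) k.+1%:R^-1 : set (measurableTypeR R)))//.
  apply: measurableX; last exact: measurable_ball.
  apply: open_measurable_rV; exact: ball_open.
Qed.

Lemma continuous_measurable_rV n (f : 'rV[R]_n -> R) (D : set 'rV[R]_n) :
  continuous f -> measurable_fun D f.
Proof.
move=> cf; apply: (measurable_funS measurableT) => //.
apply: (measurability _ (RGenOpens.measurableE R)) => _ [_ [a [b ->]] <-].
rewrite setTI; apply: open_measurable_rV.
by apply: open_comp => //; exact: itv_open.
Qed.

Lemma continuous_measurable_rV_R n (f : 'rV[R]_n * R -> R)
  (D : set ('rV[R]_n * measurableTypeR R)) :
  continuous f -> measurable_fun D f.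
Proof.
move=> cf; apply: (measurable_funS measurableT) => //.
apply: (measurability _ (RGenOpens.measurableE R)) => _ [_ [a [b ->]] <-].
rewrite setTI; apply: open_measurable_rV_R.
by apply: open_comp => //; exact: itv_open.
Qed.

End open_measurable.

(** * Fubini and Tonelli on rectangles *)

Section fubini_rectangle.
Context d1 d2 (T1 : measurableType d1) (T2 : measurableType d2) (R : realType).
Context (m1 : {sigma_finite_measure set T1 -> \bar R}).
Context (m2 : {sigma_finite_measure set T2 -> \bar R}).
Context (A : set T1) (B : set T2) (mA : measurable A) (mB : measurable B).
Local Open Scope ereal_scope.

Let mAB : measurable (A `*` B). Proof. exact: measurableX. Qed.

Let patchE1 (F : T1 * T2 -> \bar R) x :
  \int[m2]_y (F \_ (A `*` B)) (x, y) = ((fun x => \int[m2]_(y in B) F (x, y)) \_ A) x.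
Proof.
rewrite {2}/patch; case: ifPn => [xA|xA].
  rewrite [RHS]integral_mkcond; apply: eq_integral => y _.
  by rewrite /patch in_setX xA.
by apply: integral0_eq => y _; rewrite /patch in_setX (negbTE xA).
Qed.

Let patchE2 (F : T1 * T2 -> \bar R) y :
  \int[m1]_x (F \_ (A `*` B)) (x, y) = ((fun y => \int[m1]_(x in A) F (x, y)) \_ B) y.
Proof.
rewrite {2}/patch; case: ifPn => [yB|yB].
  rewrite [RHS]integral_mkcond; apply: eq_integral => x _.
  by rewrite /patch in_setX yB andbT.
by apply: integral0_eq => x _; rewrite /patch in_setX (negbTE yB) andbF.
Qed.

Lemma fubini_rectangle1 (F : T1 * T2 -> \bar R) :
  (m1 \x m2).-integrable (A `*` B) F ->
  \int[m1 \x m2]_(z in A `*` B) F z = \int[m1]_(x in A) \int[m2]_(y in B) F (x, y).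
Proof.
move=> /(integrable_mkcond _ mAB) iF.
rewrite integral_mkcond -(integral12_prod_meas1 iF) [RHS]integral_mkcond.
by apply: eq_integral => x _; rewrite /fubini_F patchE1.
Qed.

Lemma fubini_rectangle2 (F : T1 * T2 -> \bar R) :
  (m1 \x m2).-integrable (A `*` B) F ->
  \int[m1 \x m2]_(z in A `*` B) F z = \int[m2]_(y in B) \int[m1]_(x in A) F (x, y).
Proof.
move=> /(integrable_mkcond _ mAB) iF.
rewrite integral_mkcond -(integral21_prod_meas1 iF) [RHS]integral_mkcond.
by apply: eq_integral => x _; rewrite /fubini_G patchE2.
Qed.

Let patch_ge0 (F : T1 * T2 -> \bar R) : (forall z, (A `*` B) z -> 0 <= F z) ->
  forall z, 0 <= (F \_ (A `*` B)) z.
Proof. by move=> F0 z; rewrite /patch; case: ifPn => // /set_mem /F0. Qed.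

Lemma tonelli_rectangle1 (F : T1 * T2 -> \bar R) :
  measurable_fun (A `*` B) F -> (forall z, (A `*` B) z -> 0 <= F z) ->
  \int[m1 \x m2]_(z in A `*` B) F z = \int[m1]_(x in A) \int[m2]_(y in B) F (x, y).
Proof.
move=> /(measurable_restrictT _ mAB) mF F0.
rewrite integral_mkcond fubini_tonelli1//; last exact: patch_ge0.
rewrite [RHS]integral_mkcond.
by apply: eq_integral => x _; rewrite /fubini_F patchE1.
Qed.

Lemma tonelli_rectangle2 (F : T1 * T2 -> \bar R) :
  measurable_fun (A `*` B) F -> (forall z, (A `*` B) z -> 0 <= F z) ->
  \int[m1 \x m2]_(z in A `*` B) F z = \int[m2]_(y in B) \int[m1]_(x in A) F (x, y).
Proof.
move=> /(measurable_restrictT _ mAB) mF F0.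
rewrite integral_mkcond fubini_tonelli2//; last exact: patch_ge0.
rewrite [RHS]integral_mkcond.
by apply: eq_integral => x _; rewrite /fubini_G patchE2.
Qed.

Lemma measurable_tonelli_rectangle2 (F : T1 * T2 -> \bar R) :
  measurable_fun (A `*` B) F -> (forall z, (A `*` B) z -> 0 <= F z) ->
  measurable_fun B (fun y => \int[m1]_(x in A) F (x, y)).
Proof.
move=> /(measurable_restrictT _ mAB) mF F0; apply/(measurable_restrictT _ mB).
have := measurable_fun_fubini_tonelli_G (m1 := m1) _ mF (patch_ge0 F0).
by congr measurable_fun; apply/funext => x; exact: patchE2.
Qed.

Lemma measurable_fun_fst_rectangle d' (T' : measurableType d') (f : T1 -> T') :
  measurable_fun A f -> measurable_fun (A `*` B) (f \o fst).
Proof.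
move=> mf _ Y mY.
rewrite (_ : _ `&` _ = (A `&` f @^-1` Y) `*` B); first exact: measurableX (mf mA _ mY) mB.
by apply/seteqP; split => [[x y] [[/= Ax By] fY]|[x y] [[/= Ax fY] By]].
Qed.

Lemma measurable_fun_snd_rectangle d' (T' : measurableType d') (f : T2 -> T') :
  measurable_fun B f -> measurable_fun (A `*` B) (f \o snd).
Proof.
move=> mf _ Y mY.
rewrite (_ : _ `&` _ = A `*` (B `&` f @^-1` Y)); first exact: measurableX mA (mf mB _ mY).
by apply/seteqP; split => [[x y] [[/= Ax By] fY]|[x y] [/= Ax [By fY]]].
Qed.

Lemma L2sq_prod (f : T1 -> R) (b : T2 -> R) :
  L2 m1 A f -> L2 m2 B b ->
  L2sq (m1 \x m2) (A `*` B) (fun z => f z.1 * b z.2)%R = L2sq m1 A f * L2sq m2 B b.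
Proof.
move=> [mf f2] [mb b2].
have b0 : 0 <= L2sq m2 B b by apply: integral_ge0 => y _; rewrite lee_fin sqr_ge0.
have bfin : L2sq m2 B b \is a fin_num by rewrite ge0_fin_numE.
rewrite {1}/L2sq tonelli_rectangle1.
- transitivity (\int[m1]_(x in A) ((fine (L2sq m2 B b))%:E * (f x ^+ 2)%:E)).
    apply: eq_integral => x _ /=.
    transitivity (\int[m2]_(y in B) ((f x ^+ 2)%:E * (b y ^+ 2)%:E)).
      by apply: eq_integral => y _; rewrite exprMn EFinM.
    rewrite ge0_integralZl//.
    - by rewrite -[X in _ * X]/(L2sq m2 B b) fineK// muleC.
    - by apply/measurable_EFinP; exact: measurable_funX.
    - by move=> y _; rewrite lee_fin sqr_ge0.
    - by rewrite lee_fin sqr_ge0.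
  rewrite ge0_integralZl//.
  - by rewrite fineK// muleC.
  - by apply/measurable_EFinP; exact: measurable_funX.
  - by move=> y _; rewrite lee_fin sqr_ge0.
  - by rewrite lee_fin fine_ge0.
- apply/measurable_EFinP; apply: measurable_funX; apply: measurable_funM.
    exact: (measurable_fun_fst_rectangle mf).
  exact: (measurable_fun_snd_rectangle mb).
- by move=> z _; rewrite lee_fin sqr_ge0.
Qed.

Lemma L2_prod (f : T1 -> R) (b : T2 -> R) :
  L2 m1 A f -> L2 m2 B b -> L2 (m1 \x m2) (A `*` B) (fun z => f z.1 * b z.2)%R.
Proof.
move=> Lf Lb; split.
  apply: measurable_funM.
    exact: (measurable_fun_fst_rectangle Lf.1).
  exact: (measurable_fun_snd_rectangle Lb.1).
rewrite L2sq_prod//.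
have ge0 d' (T' : measurableType d') (m : {measure set T' -> \bar R}) E g :
    0 <= L2sq m E g by apply: integral_ge0 => y _; rewrite lee_fin sqr_ge0.
have fin d' (T' : measurableType d') (m : {measure set T' -> \bar R}) E g :
    L2 m E g -> L2sq m E g \is a fin_num by move=> [_ Lg]; rewrite ge0_fin_numE.
by rewrite ltey_eq fin_numM// fin.
Qed.

End fubini_rectangle.

Section bounded_fubini.
Context d1 d2 (T1 : measurableType d1) (T2 : measurableType d2) (R : realType).
Context (m1 : {sigma_finite_measure set T1 -> \bar R}).
Context (m2 : {sigma_finite_measure set T2 -> \bar R}).
Context (A : set T1) (B : set T2) (mA : measurable A) (mB : measurable B).
Hypotheses (Afin : (m1 A < +oo)%E) (Bfin : (m2 B < +oo)%E).

Lemma bounded_integrable d (T : measurableType d) (m : {measure set T -> \bar R})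
    (D : set T) (f : T -> R) (M : R) :
  measurable D -> (m D < +oo)%E -> measurable_fun D f ->
  (forall x, D x -> `|f x| <= M) -> m.-integrable D (EFin \o f).
Proof.
move=> mD Dfin mf fM; apply: measurable_bounded_integrable => //.
exists M; split; first exact: num_real.
by move=> N MN x Dx; apply: le_trans (fM _ Dx) _; exact: ltW.
Qed.

Lemma Rintegral_le_bound d (T : measurableType d) (m : {measure set T -> \bar R})
    (D : set T) (f : T -> R) (M : R) :
  measurable D -> (m D < +oo)%E -> measurable_fun D f ->
  (forall x, D x -> `|f x| <= M) -> `|\int[m]_(x in D) f x| <= M * fine (m D).
Proof.
move=> mD Dfin mf fM; have fi := bounded_integrable mD Dfin mf fM.
apply: le_trans (le_normr_Rintegral mD fi) _; rewrite -Rintegral_cst//.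
apply: le_Rintegral => //.
- exact: (integrable_norm fi).
- apply: (@bounded_integrable _ _ m D (cst M) `|M|) => //; exact: measurable_cst.
Qed.

Context (F : T1 * T2 -> R) (M : R).
Hypotheses (mF : measurable_fun setT F) (FM : forall x y, A x -> B y -> `|F (x, y)| <= M).

Lemma bounded_prod_integrable : (m1 \x m2)%E.-integrable (A `*` B) (EFin \o F).
Proof.
apply: (@bounded_integrable _ _ _ _ _ M).
- exact: measurableX.
- by rewrite [X in (X < _)%E](product_measure1E m1 m2 mA mB) ltey_eq fin_numM// ge0_fin_numE.
- exact: measurable_funS mF.
- by move=> [x y] [/= Ax By]; exact: FM.
Qed.

Lemma bounded_slice_integrable1 x : A x -> m2.-integrable B (EFin \o (fun y => F (x, y))).
Proof.
move=> Ax; apply: (bounded_integrable (M := M)) => //.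
  by apply: (measurable_funS measurableT) => //; exact: measurable_fun_pair2.
by move=> y By; exact: FM.
Qed.

Lemma bounded_slice_integrable2 y : B y -> m1.-integrable A (EFin \o (fun x => F (x, y))).
Proof.
move=> By; apply: (bounded_integrable (M := M)) => //.
  by apply: (measurable_funS measurableT) => //; exact: measurable_fun_pair1.
by move=> x Ax; exact: FM.
Qed.

Lemma bounded_fubini1 : \int[(m1 \x m2)%E]_(z in A `*` B) F z =
  \int[m1]_(x in A) \int[m2]_(y in B) F (x, y).
Proof.
rewrite /Rintegral fubini_rectangle1//; last exact: bounded_prod_integrable.
congr fine; apply: eq_integral => x /set_mem Ax; rewrite fineK//.
by apply: integrable_fin_num => //; exact: bounded_slice_integrable1.
Qed.

Lemma bounded_fubini2 : \int[(m1 \x m2)%E]_(z in A `*` B) F z =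
  \int[m2]_(y in B) \int[m1]_(x in A) F (x, y).
Proof.
rewrite /Rintegral fubini_rectangle2//; last exact: bounded_prod_integrable.
congr fine; apply: eq_integral => y /set_mem By; rewrite fineK//.
by apply: integrable_fin_num => //; exact: bounded_slice_integrable2.
Qed.

Lemma measurable_Rintegral1 : measurable_fun A (fun x => \int[m2]_(y in B) F (x, y)).
Proof.
have mAB := measurableX mA mB.
have iF := (integrable_mkcond _ mAB).1 bounded_prod_integrable.
have mG := measurableT_comp (fine_measurable measurableT) (measurable_fubini_F iF).
apply: (@eq_measurable_fun _ _ _ _ A (fine \o fubini_F m2 ((EFin \o F) \_ (A `*` B)))).
  move=> x xA /=; rewrite /fubini_F /Rintegral [in RHS]integral_mkcond; congr fine.
  by apply: eq_integral => y _; rewrite /patch in_setX xA.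
exact: (measurable_funS measurableT _ mG).
Qed.

Lemma measurable_Rintegral2 : measurable_fun B (fun y => \int[m1]_(x in A) F (x, y)).
Proof.
have mAB := measurableX mA mB.
have iF := (integrable_mkcond _ mAB).1 bounded_prod_integrable.
have mG := measurableT_comp (fine_measurable measurableT) (measurable_fubini_G iF).
apply: (@eq_measurable_fun _ _ _ _ B (fine \o fubini_G m1 ((EFin \o F) \_ (A `*` B)))).
  move=> y yB /=; rewrite /fubini_G /Rintegral [in RHS]integral_mkcond; congr fine.
  by apply: eq_integral => x _; rewrite /patch in_setX yB andbT.
exact: (measurable_funS measurableT _ mG).
Qed.

End bounded_fubini.

(** * Boxes and integration over the last coordinate *)

Section boxes.
Context (R : realType).
Local Notation leb := (@lebesgue_measure R).

(** The sides are half-open so that they split into disjoint intervals of the same kind. *)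
Definition box n (L : R) : set 'rV[R]_n :=
  [set v | forall i, `[- L, L[%classic (v ord0 i)].

Lemma measurable_bx n L : measurable (@box n L).
Proof.
by apply: (@measurable_box R n (fun=> `[- L, L[%classic : set (measurableTypeR R))) => i; exact: measurable_itv.
Qed.

Lemma box_fin n L : (lebesgue_rV R n (@box n L) < +oo)%E.
Proof.
rewrite (@lebesgue_rV_box _ _ (fun=> `[- L, L[%classic)) => [|i]; last exact: measurable_itv.
rewrite ltey_eq; apply/orP; left; apply: (big_ind (fun x => x \is a fin_num)) => //.
- by move=> x y xf yf; rewrite fin_numM.
- by move=> i _; rewrite lebesgue_measure_itv/=; case: ifP.
Qed.

Lemma rcons_rV_lift n (x : 'rV[R]_n) t i : rcons_rV (x, t) ord0 (lift ord_max i) = x ord0 i.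
Proof. by rewrite mxE liftK. Qed.

Lemma rcons_rV_max n (x : 'rV[R]_n) t : rcons_rV (x, t) ord0 ord_max = t.
Proof. by rewrite mxE unlift_none. Qed.

Lemma rcons_rV_row n (x : 'rV[R]_n) t :
  \row_i rcons_rV (x, t) ord0 (lift ord_max i) = x.
Proof. by apply/rowP => i; rewrite mxE rcons_rV_lift. Qed.

(** The product of [Q] and [J] inside ['rV_n.+1]; the last coordinate is singled out because
    [lebesgue_rV] is built by recursion on it. *)
Definition rbox n (Q : set 'rV[R]_n) (J : set R) : set 'rV[R]_n.+1 :=
  [set v | Q (\row_i v ord0 (lift ord_max i)) /\ J (v ord0 ord_max)].

Lemma preimage_rbox n (Q : set 'rV[R]_n) (J : set R) :
  @rcons_rV R n @^-1` rbox Q J = Q `*` J.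
Proof.
by apply/seteqP; split => [[x t]|[x t]]; rewrite /rbox/= rcons_rV_row rcons_rV_max.
Qed.

Lemma measurable_rbox n (Q : set 'rV[R]_n) (J : set (measurableTypeR R)) :
  measurable Q -> measurable J -> measurable (rbox Q J).
Proof.
move=> mQ mJ; apply: (@measurableI _ _ [set v : 'rV[R]_n.+1 | Q _] [set v | J _]).
  rewrite -[X in measurable X]setTI.
  suff : measurable_fun setT (fun v : 'rV[R]_n.+1 => \row_i v ord0 (lift ord_max i)).
    by move=> /(_ measurableT _ mQ).
  apply: measurable_fun_rV => i; under eq_fun do rewrite mxE; exact: measurable_coord.
rewrite -[X in measurable X]setTI.
exact: (@measurable_coord R n.+1 ord_max measurableT _ mJ).
Qed.

Lemma box_rbox n L : @box n.+1 L = rbox (@box n L) `[- L, L[%classic.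
Proof.
apply/seteqP; split => [v Hv|v [Hv1 Hv2] i].
  by split => [i|]; rewrite ?mxE; exact: Hv.
by case: (unliftP ord_max i) => [j ->|->//]; have := Hv1 j; rewrite mxE.
Qed.

Lemma ball_rcons n (x y : 'rV[R]_n) (s t e : R) :
  ball x e y -> ball s e t -> ball (rcons_rV (x, s)) e (rcons_rV (y, t)).
Proof.
move=> [e0 xy] st; split => // i j; rewrite (ord1 i).
by case: (unliftP ord_max j) => [k ->|->]; rewrite ?rcons_rV_lift ?rcons_rV_max.
Qed.

Lemma continuous_rcons n : continuous (fun z : 'rV[R]_n * R => rcons_rV z).
Proof.
move=> [x s]; apply/cvg_ballP => e e0; exists (ball x e, ball s e) => /=.
  by split; exact: nbhsx_ballx.
by move=> [y t] [/= xy st]; exact: ball_rcons.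
Qed.

Lemma continuous_rcons1 n (t : R) : continuous (fun x : 'rV[R]_n => rcons_rV (x, t)).
Proof.
move=> x; apply: (@continuous_comp _ _ _ (fun x => (x, t)) (@rcons_rV R n)).
  exact: (cvg_pair (@cvg_id _ (nbhs x)) (cvg_cst t)).
exact: continuous_rcons.
Qed.

Lemma continuous_rcons2 n (x : 'rV[R]_n) : continuous (fun t : R => rcons_rV (x, t)).
Proof.
move=> t; apply: (@continuous_comp _ _ _ (fun t => (x, t)) (@rcons_rV R n)).
  exact: (cvg_pair (cvg_cst x) (@cvg_id _ (nbhs t))).
exact: continuous_rcons.
Qed.

Lemma rcons_shift1 n (x : 'rV[R]_n) t i (h : R) :
  rcons_rV (h *: delta_mx ord0 i + x, t) =
  h *: delta_mx ord0 (lift ord_max i) + rcons_rV (x, t).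
Proof.
apply/rowP => j; rewrite !mxE; case: unliftP => [k ->|->]; rewrite ?mxE ?liftK ?unlift_none.
  by rewrite !eqxx/= (inj_eq lift_inj).
by rewrite eq_liftF andbF mulr0 add0r.
Qed.

Lemma rcons_shift2 n (x : 'rV[R]_n) (t h : R) :
  rcons_rV (x, h *: 1 + t) = h *: delta_mx ord0 ord_max + rcons_rV (x, t).
Proof.
apply/rowP => j; rewrite !mxE; case: unliftP => [k ->|->]; rewrite ?mxE ?liftK ?unlift_none.
  by rewrite lift_eqF andbF mulr0 add0r.
by rewrite !eqxx.
Qed.

Lemma box_bound n (L : R) (F : 'rV[R]_n -> R) : continuous F ->
  exists M, forall x : 'rV[R]_n, (forall i, `|x ord0 i| <= L) -> `|F x| <= M.
Proof.
move=> cF; have cK : compact [set v : 'rV[R]_n | forall i, `[- L, L]%classic (v ord0 i)].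
  by apply: (@rV_compact _ _ (fun=> `[- L, L]%classic)) => i; exact: segment_compact.
have /compact_bounded[M [_ HM]] : compact (F @` [set v : 'rV[R]_n | forall i, `[- L, L]%classic (v ord0 i)]).
  by apply: continuous_compact => //; exact: continuous_subspaceT.
exists (M + 1) => x xL; apply: (HM (M + 1)); first by rewrite ltrDl.
by exists x => // i; rewrite /= in_itv/= -ler_norml.
Qed.

Lemma box_norm n L (x : 'rV[R]_n) : box L x -> forall i, `|x ord0 i| <= L.
Proof. by move=> Bx i; have := Bx i; rewrite /= in_itv/= ler_norml => /andP[-> /ltW ->]. Qed.

Section rbox_integral.
Context (n : nat) (L : R) (Q : set 'rV[R]_n) (J : set (measurableTypeR R)).
Hypotheses (mQ : measurable Q) (mJ : measurable J).
Hypotheses (QL : Q `<=` box L) (JL : J `<=` `[- L, L[%classic).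
Context (F : 'rV[R]_n.+1 -> R) (cF : continuous F).

Lemma rbox_mQ : (lebesgue_rV R n Q < +oo)%E.
Proof.
apply: le_lt_trans (@box_fin n L); apply: le_measure => //; rewrite ?inE//.
exact: measurable_bx.
Qed.

Lemma rbox_mJ : (leb J < +oo)%E.
Proof.
apply: (@le_lt_trans _ _ (leb `[- L, L[%classic)); first by apply: le_measure; rewrite ?inE.
by rewrite lebesgue_measure_itv/=; case: ifP; rewrite ?ltry.
Qed.

Lemma rbox_bound : exists M, forall x t, Q x -> J t -> `|F (rcons_rV (x, t))| <= M.
Proof.
have [M HM] := box_bound L cF; exists M => x t Qx Jt; apply: HM; apply: box_norm.
rewrite box_rbox; split; rewrite ?rcons_rV_row ?rcons_rV_max; [exact: QL|exact: JL].
Qed.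

Lemma measurable_rcons_comp :
  measurable_fun setT (fun z : 'rV[R]_n * measurableTypeR R => F (rcons_rV z)).
Proof.
apply: (measurableT_comp _ (measurable_rcons_rV (n:=n))).
exact: continuous_measurable_rV.
Qed.

Lemma rbox_integrableE : (lebesgue_rV R n \x leb)%E.-integrable (Q `*` J)
   (EFin \o (fun z => F (rcons_rV z))).
Proof.
have [M HM] := rbox_bound.
exact: (bounded_prod_integrable mQ mJ rbox_mQ rbox_mJ measurable_rcons_comp HM).
Qed.

Lemma rbox_pushforward : \int[lebesgue_rV R n.+1]_(v in rbox Q J) F v =
  \int[(lebesgue_rV R n \x leb)%E]_(z in Q `*` J) F (rcons_rV z).
Proof.
rewrite /Rintegral; congr fine.
rewrite (@integral_pushforward _ _ _ _ R (@rcons_rV R n) (measurable_rcons_rV (n:=n))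
  (lebesgue_rV R n \x leb)%E (rbox Q J) (EFin \o F)) ?preimage_rbox//.
- by apply/measurable_EFinP; exact: continuous_measurable_rV.
- exact: rbox_integrableE.
- exact: measurable_rbox.
Qed.

Lemma rbox_integral1 : \int[lebesgue_rV R n.+1]_(v in rbox Q J) F v =
  \int[lebesgue_rV R n]_(x in Q) \int[leb]_(t in J) F (rcons_rV (x, t)).
Proof.
have [M HM] := rbox_bound; rewrite rbox_pushforward.
exact: (bounded_fubini1 mQ mJ rbox_mQ rbox_mJ measurable_rcons_comp HM).
Qed.

Lemma rbox_integral2 : \int[lebesgue_rV R n.+1]_(v in rbox Q J) F v =
  \int[leb]_(t in J) \int[lebesgue_rV R n]_(x in Q) F (rcons_rV (x, t)).
Proof.
have [M HM] := rbox_bound; rewrite rbox_pushforward.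
exact: (bounded_fubini2 mQ mJ rbox_mQ rbox_mJ measurable_rcons_comp HM).
Qed.

Lemma rbox_measurable2 :
  measurable_fun J (fun t => \int[lebesgue_rV R n]_(x in Q) F (rcons_rV (x, t))).
Proof.
have [M HM] := rbox_bound.
exact: (measurable_Rintegral2 mQ mJ rbox_mQ rbox_mJ measurable_rcons_comp HM).
Qed.

Lemma rbox_bounded2 : exists M, forall t, J t ->
  `|\int[lebesgue_rV R n]_(x in Q) F (rcons_rV (x, t))| <= M.
Proof.
have [M HM] := rbox_bound; exists (M * fine (lebesgue_rV R n Q)) => t Jt.
apply: Rintegral_le_bound => //.
- exact: rbox_mQ.
- apply: continuous_measurable_rV => x.
  by apply: continuous_comp; [exact: continuous_rcons1|exact: cF].
- by move=> x Qx; exact: HM.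
Qed.

Lemma rbox_integrable1 : (lebesgue_rV R n).-integrable Q
  (EFin \o (fun x => \int[leb]_(t in J) F (rcons_rV (x, t)))).
Proof.
have [M HM] := rbox_bound.
apply: (bounded_integrable (M := M * fine (leb J))) => //.
- exact: rbox_mQ.
- exact: (measurable_Rintegral1 mQ mJ rbox_mQ rbox_mJ measurable_rcons_comp HM).
- move=> x Qx; apply: Rintegral_le_bound => //.
  + exact: rbox_mJ.
  + apply: (measurable_funS measurableT) => //; apply: continuous_measurable_fun => t.
    by apply: continuous_comp; [exact: continuous_rcons2|exact: cF].
  + by move=> t Jt; exact: HM.
Qed.

Lemma rbox_integrable2 :
  leb.-integrable J (EFin \o (fun t => \int[lebesgue_rV R n]_(x in Q) F (rcons_rV (x, t)))).
Proof.
have [M HM] := rbox_bounded2.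
by apply: (bounded_integrable mJ rbox_mJ _ HM); exact: rbox_measurable2.
Qed.

End rbox_integral.

End boxes.

(** * Poincare inequalities on boxes *)

Section integral_estimates.
Context (R : realType) d (T : measurableType d) (m : {measure set T -> \bar R}).
Context (D : set T) (mD : measurable D).

(** Scalar functions enter the framework of [L2vec] as vectors with one coordinate. *)
Lemma scalar_lin (i : 'I_1) (a : R) (u v : R^o) : (a *: u + v : R) = a * u + v.
Proof. by []. Qed.

Lemma L2_inner1E (f g : T -> R) :
  L2vec_inner m D (W := R^o) (fun (_ : 'I_1) x => x) f g = \int[m]_(x in D) (f x * g x).
Proof. by apply: eq_Rintegral => x _; rewrite big_ord1. Qed.

Lemma Rintegral_CS (f g : T -> R) : L2 m D f -> L2 m D g ->
  (\int[m]_(x in D) (f x * g x)) ^+ 2 <=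
  (\int[m]_(x in D) (f x ^+ 2)) * (\int[m]_(x in D) (g x ^+ 2)).
Proof.
move=> Lf Lg; have SI := L2vec_semi_inner m mD scalar_lin.
have := @semi_inner_CS _ _ _ _ SI f g (fun=> Lf) (fun=> Lg).
by rewrite !L2_inner1E.
Qed.

Hypothesis (Dfin : (m D < +oo)%E).

Lemma bounded_L2 (f : T -> R) (M : R) : measurable_fun D f ->
  (forall x, D x -> `|f x| <= M) -> L2 m D f.
Proof.
move=> mf fM; split => //.
have : m.-integrable D (EFin \o (fun x => f x ^+ 2)).
  apply: (bounded_integrable (M := M ^+ 2)) => //; first exact: measurable_funX.
  by move=> x Dx; rewrite normrX lerXn2r ?nnegrE ?normr_ge0 ?fM// (le_trans _ (fM _ Dx)).
move=> /integrableP[_]; apply: le_lt_trans; rewrite /L2sq le_eqVlt; apply/orP; left; apply/eqP.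
by apply: eq_integral => x _ /=; rewrite ger0_norm// sqr_ge0.
Qed.

Lemma Rintegral_sqr_le (f : T -> R) (M : R) : measurable_fun D f ->
  (forall x, D x -> `|f x| <= M) ->
  (\int[m]_(x in D) f x) ^+ 2 <= fine (m D) * \int[m]_(x in D) (f x ^+ 2).
Proof.
move=> mf fM; have L1 : L2 m D (cst 1).
  by apply: (@bounded_L2 _ 1) => [|x _]; [exact: measurable_cst|rewrite normr1].
have := Rintegral_CS L1 (bounded_L2 mf fM).
under eq_Rintegral do rewrite mul1r.
rewrite [X in _ <= X * _](_ : _ = fine (m D))//.
under eq_Rintegral do rewrite expr1n.
by rewrite Rintegral_cst// mul1r.
Qed.

(** The integral of [f ^+ 2] exceeds that of the squared mean by the variance, and [W] bounds the
    squared oscillation of [f]. *)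
Lemma variance_le (f : T -> R) (M W : R) : measurable_fun D f ->
  (forall x, D x -> `|f x| <= M) -> 0 < fine (m D) ->
  (forall x y, D x -> D y -> (f x - f y) ^+ 2 <= W) ->
  \int[m]_(x in D) (f x ^+ 2) <=
  (fine (m D))^-1 * (\int[m]_(x in D) f x) ^+ 2 + fine (m D) * W.
Proof.
move=> mf fM h0 fW; set h := fine (m D); set S := \int[m]_(x in D) f x.
have icst (c : R) : m.-integrable D (EFin \o cst c).
  apply: (@bounded_integrable _ _ _ m D (cst c) `|c|) => //; exact: measurable_cst.
have fi := bounded_integrable mD Dfin mf fM.
have f2i : m.-integrable D (EFin \o (fun x => f x ^+ 2)).
  apply: (bounded_integrable (M := M ^+ 2)) => //; first exact: measurable_funX.
  by move=> x Dx; rewrite normrX lerXn2r ?nnegrE ?normr_ge0 ?fM// (le_trans _ (fM _ Dx)).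
(* The deviation from the mean is the average over [y] of [f x - f y], each of absolute value at
   most [Num.sqrt W]. *)
have key x : D x -> (f x - S / h) ^+ 2 <= W.
  move=> Dx; have W0 : 0 <= W by apply: le_trans (fW x x Dx Dx); exact: sqr_ge0.
  have bd : `|\int[m]_(y in D) (f x - f y)| <= Num.sqrt W * h.
    apply: Rintegral_le_bound => //.
      by apply: measurable_funB => //; exact: measurable_cst.
    by move=> y Dy; rewrite -sqrtr_sqr ler_wsqrtr// fW.
  have -> : f x - S / h = h^-1 * \int[m]_(y in D) (f x - f y).
    rewrite (RintegralB mD (icst (f x)) fi) Rintegral_cst// -/h -/S.
    by rewrite mulrBr mulrCA mulVf ?mulr1 ?gt_eqF// mulrC.
  rewrite exprMn -[X in _ <= X](sqr_sqrtr W0).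
  rewrite exprVn mulrC ler_pdivrMr ?exprn_gt0// -exprMn -[leLHS]ger0_norm ?sqr_ge0// normrX.
  by rewrite lerXn2r ?nnegrE ?mulr_ge0 ?sqrtr_ge0 ?(ltW h0)// .
have : \int[m]_(x in D) ((f x - S / h) ^+ 2) <= W * h.
  rewrite -Rintegral_cst//; apply: le_Rintegral => //.
    apply: (bounded_integrable (M := W)) => //.
      by apply: measurable_funX; apply: measurable_funB => //; exact: measurable_cst.
    by move=> x Dx; rewrite ger0_norm ?sqr_ge0// key.
  exact: icst.
have [q qE] : exists q, q = (S / h) ^+ 2 by eexists.
have -> : \int[m]_(x in D) ((f x - S / h) ^+ 2) =
    \int[m]_(x in D) (f x ^+ 2 - (2 * (S / h) * f x - q)).
  by apply: eq_Rintegral => x _; rewrite qE; ring.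
have i1 : m.-integrable D (EFin \o (fun x => 2 * (S / h) * f x)).
  exact: (integrableZl mD _ fi).
have i2 : m.-integrable D (EFin \o (fun x => 2 * (S / h) * f x - q)).
  exact: (integrableB mD i1 (icst _)).
rewrite RintegralB// (RintegralB mD i1 (icst _)) RintegralZl// Rintegral_cst// -/h -/S.
rewrite (_ : _ - _ = \int[m]_(x in D) f x ^+ 2 - h^-1 * S ^+ 2); last first.
  by rewrite qE; field; rewrite gt_eqF.
by rewrite lerBlDr addrC [W * h]mulrC.
Qed.

Lemma le_Rintegral_set (E : set T) (f : T -> R) : measurable E -> E `<=` D ->
  m.-integrable D (EFin \o f) -> (forall x, D x -> 0 <= f x) ->
  \int[m]_(x in E) f x <= \int[m]_(x in D) f x.
Proof.
move=> mE ED fi f0; apply: fine_le.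
- by apply: integrable_fin_num => //; exact: (integrableS mD).
- exact: integrable_fin_num.
- by apply: ge0_subset_integral => //; exact: (measurable_int _ fi).
Qed.

Lemma Rintegral_sum (I : finType) (f : I -> T -> R) :
  (forall i, m.-integrable D (EFin \o f i)) ->
  \int[m]_(x in D) (\sum_i f i x) = \sum_i \int[m]_(x in D) f i x.
Proof.
move=> fi; rewrite /Rintegral; under eq_integral do rewrite -sumEFin.
rewrite (integral_sum mD fi) sum_fine//.
by move=> i _; apply: integrable_fin_num => //; exact: fi.
Qed.

End integral_estimates.

(** * Calculus on an interval *)

Section one_dim.
Context (R : realType).
Local Notation leb := (@lebesgue_measure R).

Lemma continuous_segment_bound (f : R -> R) (a b : R) : continuous f ->
  exists M, forall t, a <= t <= b -> `|f t| <= M.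
Proof.
move=> cf; have /compact_bounded[M [_ HM]] : compact (f @` `[a, b]).
  apply: continuous_compact; last exact: segment_compact.
  exact: continuous_subspaceT.
exists (M + 1) => x xab; apply: (HM (M + 1)); first by rewrite ltrDl.
by exists x.
Qed.

Lemma leb_itv_co (a b : R) : a <= b -> leb `[a, b[ = (b - a)%:E.
Proof.
move=> ab; rewrite lebesgue_measure_itv/= lte_fin; case: ltP => // ba.
by rewrite -(@le_anti _ _ b a) ?subrr// ab ba.
Qed.

Lemma continuous_itv_integrable (f : R -> R) (a b : R) : continuous f ->
  leb.-integrable `[a, b[ (EFin \o f).
Proof.
move=> cf; have [M HM] := continuous_segment_bound a b cf.
apply: (bounded_integrable (M := M)) => //.
- by have [ab|ba] := leP a b; [rewrite [X in (X < _)%E](leb_itv_co ab) ltry|rewrite set_itv_ge ?measure0// bnd_simp -leNgt ltW].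
- apply: (measurable_funS measurableT) => //; exact: continuous_measurable_fun.
- by move=> t /=; rewrite in_itv/= => /andP[ta /ltW tb]; apply: HM; rewrite ta.
Qed.

Lemma FTC_segment (F f : R -> R) (a b : R) : a <= b ->
  (forall t : R, is_derive t (1 : R) F (f t)) -> continuous f ->
  \int[leb]_(t in `[a, b[) f t = F b - F a.
Proof.
move=> ab dF cf; have [->|ab'] := eqVneq a b.
  by rewrite set_itv_ge ?bnd_simp ?ltxx// Rintegral_set0 subrr.
have {}ab : a < b by rewrite lt_def eq_sym ab'.
rewrite Rintegral_itv_bndo_bndc; last exact: continuous_itv_integrable.
have cF : continuous F.
  by move=> x; apply/differentiable_continuous/derivable1_diffP; have /@ex_derive := dF x.
rewrite /Rintegral (@continuous_FTC2 _ f F)//.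
- exact: continuous_subspaceT.
- split => [x _||].
  + by have /@ex_derive := dF x.
  + exact/cvg_at_right_filter/cF.
  + exact/cvg_at_left_filter/cF.
- by move=> x _; rewrite derive1E; have /@derive_val := dF x.
Qed.

Lemma Rintegral_itv_split (f : R -> R) (a b c : R) : a <= b -> b <= c ->
  leb.-integrable `[a, c[ (EFin \o f) ->
  \int[leb]_(t in `[a, c[) f t =
  \int[leb]_(t in `[a, b[) f t + \int[leb]_(t in `[b, c[) f t.
Proof.
move=> ab bc fi; have E : `[a, c[%classic = `[a, b[%classic `|` `[b, c[%classic :> set R.
  by apply: itv_bndbnd_setU; rewrite bnd_simp.
rewrite E; rewrite E in fi; apply: Rintegral_setU => //.
rewrite disj_set2E; apply/eqP/seteqP; split => // t []/=; rewrite !in_itv/= => /andP[_ tb] /andP[bt _].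
by have := lt_le_trans tb bt; rewrite ltxx.
Qed.

Lemma Rintegral_itv_partition (f : R -> R) (a h : R) (K : nat) : 0 <= h ->
  leb.-integrable `[a, a + K%:R * h[ (EFin \o f) ->
  \int[leb]_(t in `[a, a + K%:R * h[) f t =
  \sum_(j < K) \int[leb]_(t in `[a + j%:R * h, a + j.+1%:R * h[) f t.
Proof.
move=> h0; elim: K => [|K IH] fi.
  by rewrite big_ord0 mul0r addr0 set_itv_ge ?bnd_simp ?ltxx// Rintegral_set0.
have hK : a + K%:R * h <= a + K.+1%:R * h by rewrite lerD2l ler_wpM2r// ler_nat.
rewrite (@Rintegral_itv_split _ _ (a + K%:R * h))//; last by rewrite lerDl mulr_ge0.
rewrite IH ?big_ord_recr//.
apply: (integrableS _ _ _ fi) => //; apply: subset_itvl; exact: hK.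
Qed.

(** The fundamental theorem of calculus and Cauchy-Schwarz on the interval between [s] and [t],
    which is then enlarged to [[a, b[]. *)
Lemma sqr_increment_le (F f : R -> R) (a b s t : R) :
  (forall t : R, is_derive t (1 : R) F (f t)) -> continuous f ->
  a <= s < b -> a <= t < b ->
  (F t - F s) ^+ 2 <= (b - a) * \int[leb]_(t in `[a, b[) (f t ^+ 2).
Proof.
move=> dF cf.
wlog st : s t / s <= t => [H sab tab|/andP[as_ sb] /andP[at_ tb]].
  have [st|/ltW ts] := leP s t; first exact: H.
  by rewrite -sqrrN opprB; exact: H.
have ab : a <= b by rewrite (le_trans as_)// ltW.
have cf2 : continuous (fun t => f t ^+ 2).
  by move=> x; apply: (@continuous_comp _ _ _ f (fun y => y ^+ 2)); [exact: cf|exact: exprn_continuous].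
rewrite -(FTC_segment st dF cf).
have [M HM] := continuous_segment_bound s t cf.
have fin : (leb `[s, t[ < +oo)%E by rewrite [X in (X < _)%E](leb_itv_co st) ltry.
apply: le_trans (@Rintegral_sqr_le _ _ _ leb _ _ fin f M _ _) _ => //.
- by apply: (measurable_funS measurableT) => //; exact: continuous_measurable_fun.
- by move=> x /=; rewrite in_itv/= => /andP[sx /ltW xt]; apply: HM; rewrite sx.
rewrite [X in fine X](leb_itv_co st)/=; apply: ler_pM.
- by rewrite subr_ge0.
- by apply: Rintegral_ge0 => x _; exact: sqr_ge0.
- by rewrite lerB// ltW.
- apply: le_Rintegral_set => //.
  + by move=> x /=; rewrite !in_itv/= => /andP[sx xt]; rewrite (le_trans as_ sx)/= (lt_trans xt).
  + exact: continuous_itv_integrable.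
  + by move=> x _; exact: sqr_ge0.
Qed.

End one_dim.

(** * Friedrichs and Poincare inequalities on boxes by induction on the dimension *)

Section C1_functions.
Context (R : realType).
Local Notation leb := (@lebesgue_measure R).

(** The regularity carried through the inductions on the dimension: it passes to slices and is
    enough for Fubini and for the fundamental theorem of calculus. *)
Definition C1_rV n (g : 'rV[R]_n -> R) :=
  [/\ continuous g, (forall x i, derivable g x (delta_mx ord0 i))
    & forall i, continuous (fun x => 'D_(delta_mx ord0 i) g x)].

Lemma smooth_C1 n (g : 'rV[R]_n -> R) : smooth g -> C1_rV g.
Proof.
move=> sg; split => [|x i|i]; first exact: smooth_continuous.
  exact: smooth_derivable.
by apply: smooth_continuous; exact: smooth_derive.
Qed.

Lemma derive_slice1 n (g : 'rV[R]_n.+1 -> R) (x : 'rV[R]_n) t i :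
  'D_(delta_mx ord0 i) (fun x => g (rcons_rV (x, t))) x =
  'D_(delta_mx ord0 (lift ord_max i)) g (rcons_rV (x, t)).
Proof.
apply: (@derive_affine _ _ _ (fun x => rcons_rV (x, t))
  (fun _ => delta_mx ord0 (lift ord_max i))) => h.
exact: rcons_shift1.
Qed.

Lemma C1_slice1 n (g : 'rV[R]_n.+1 -> R) t : C1_rV g ->
  C1_rV (fun x => g (rcons_rV (x, t))).
Proof.
move=> [cg dg cDg]; split.
- by move=> x; apply: continuous_comp; [exact: continuous_rcons1|exact: cg].
- move=> x i; rewrite (@derivable_affine _ _ _ (fun x => rcons_rV (x, t))
    (fun _ => delta_mx ord0 (lift ord_max i))) => [|h]; last exact: rcons_shift1.
  exact: dg.
- move=> i; under eq_fun do rewrite derive_slice1.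
  move=> x; apply: (@continuous_comp _ _ _ (fun x => rcons_rV (x, t))
    (fun x => 'D_(delta_mx ord0 (lift ord_max i)) g x)); first exact: continuous_rcons1.
  exact: cDg.
Qed.

Lemma derive_slice2 n (g : 'rV[R]_n.+1 -> R) (x : 'rV[R]_n) (t : R) : C1_rV g ->
  is_derive t (1 : R) (fun t => g (rcons_rV (x, t)))
    ('D_(delta_mx ord0 ord_max) g (rcons_rV (x, t))).
Proof.
move=> [cg dg cDg].
have Aff (h : R) : rcons_rV (x, h *: (1 : R) + t) =
    h *: delta_mx ord0 ord_max + rcons_rV (x, t) by exact: rcons_shift2.
apply: DeriveDef; last first.
  exact: (@derive_affine _ _ _ (fun t => rcons_rV (x, t)) (fun _ => delta_mx ord0 ord_max)).
by rewrite (@derivable_affine _ _ _ (fun t => rcons_rV (x, t)) (fun _ => delta_mx ord0 ord_max)).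
Qed.

Lemma continuous_slice2 n (g : 'rV[R]_n.+1 -> R) (x : 'rV[R]_n) i : C1_rV g ->
  continuous (fun t => 'D_(delta_mx ord0 i) g (rcons_rV (x, t))).
Proof.
move=> [cg dg cDg] t.
apply: (@continuous_comp _ _ _ (fun t => rcons_rV (x, t)) (fun x => 'D_(delta_mx ord0 i) g x)).
  exact: continuous_rcons2.
exact: cDg.
Qed.

Lemma box_integral1 n L (F : 'rV[R]_n.+1 -> R) : continuous F ->
  \int[lebesgue_rV R n.+1]_(v in box L) F v =
  \int[lebesgue_rV R n]_(x in box L) \int[leb]_(t in `[- L, L[) F (rcons_rV (x, t)).
Proof.
by move=> cF; rewrite box_rbox (@rbox_integral1 _ _ L)//; exact: measurable_bx.
Qed.

Lemma box_integral2 n L (F : 'rV[R]_n.+1 -> R) : continuous F ->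
  \int[lebesgue_rV R n.+1]_(v in box L) F v =
  \int[leb]_(t in `[- L, L[) \int[lebesgue_rV R n]_(x in box L) F (rcons_rV (x, t)).
Proof.
by move=> cF; rewrite box_rbox (@rbox_integral2 _ _ L)//; exact: measurable_bx.
Qed.

Lemma box_integrable n L (F : 'rV[R]_n -> R) : continuous F ->
  (lebesgue_rV R n).-integrable (box L) (EFin \o F).
Proof.
move=> cF; have [M HM] := box_bound L cF.
apply: (bounded_integrable (M := M)).
- exact: measurable_bx.
- exact: box_fin.
- exact: continuous_measurable_rV.
- by move=> x Bx; apply: HM; exact: box_norm.
Qed.

(** A derivative in the last direction integrates to boundary values, which vanish; every other
    direction lies in a slice and is covered by the induction hypothesis. *)
Lemma box_integral_derive0 n (L : R) (g : 'rV[R]_n -> R) i : 0 <= L -> C1_rV g ->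
  (forall x : 'rV[R]_n, (exists j, L <= `|x ord0 j|) -> g x = 0) ->
  \int[lebesgue_rV R n]_(x in box L) 'D_(delta_mx ord0 i) g x = 0.
Proof.
move=> L0; elim: n => [|n IH] in g i *; first by case: i.
move=> Cg g0; have [_ _ cDg] := Cg.
case: (unliftP ord_max i) => [j ->|->].
  rewrite box_integral2; last exact: cDg.
  apply: etrans (_ : \int[leb]_(t in `[- L, L[) 0 = 0); last first.
    by rewrite Rintegral_cst ?mul0r.
  apply: eq_Rintegral => t _.
  under eq_Rintegral do rewrite -derive_slice1.
  apply: IH; first exact: C1_slice1.
  by move=> x [k Lk]; apply: g0; exists (lift ord_max k); rewrite rcons_rV_lift.
rewrite box_integral1; last exact: cDg.
apply: etrans (_ : \int[lebesgue_rV R n]_(x in box L) 0 = 0); last first.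
  by rewrite Rintegral_cst ?mul0r//; exact: measurable_bx.
apply: eq_Rintegral => x _.
rewrite (FTC_segment (F := fun t => g (rcons_rV (x, t))) _
  (fun t => @derive_slice2 _ g x t Cg) (@continuous_slice2 _ g x ord_max Cg)) ?ge0_cp//.
by rewrite !g0 ?subrr//; exists ord_max; rewrite rcons_rV_max ?normrN ger0_norm.
Qed.

Lemma continuous_sqr (T : topologicalType) (F : T -> R) :
  continuous F -> continuous (fun x => F x ^+ 2).
Proof.
move=> cF x; apply: (@continuous_comp _ _ _ F (fun y => y ^+ 2)); first exact: cF.
exact: exprn_continuous.
Qed.

(** One factor [L + L] comes from the increment estimate started at the face where the last
    coordinate is [- L] and [g] vanishes, the other from integrating over that coordinate. This
    crude constant serves only to make [lambda1] positive. *)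
Lemma box_friedrichs n (L : R) (g : 'rV[R]_n.+1 -> R) : 0 < L -> C1_rV g ->
  (forall x : 'rV[R]_n.+1, (exists j, L <= `|x ord0 j|) -> g x = 0) ->
  \int[lebesgue_rV R n.+1]_(x in box L) (g x ^+ 2) <=
  (L + L) ^+ 2 * \int[lebesgue_rV R n.+1]_(x in box L) ('D_(delta_mx ord0 ord_max) g x ^+ 2).
Proof.
move=> L0 Cg g0; have [cg _ cDg] := Cg.
have cD2 := continuous_sqr (cDg ord_max).
have mB := @measurable_bx R n L.
have mI : measurable (`[- L, L[%classic : set (measurableTypeR R)) by [].
have LL : - L < L by lra.
have cgx x : continuous (fun t => g (rcons_rV (x, t)) ^+ 2).
  apply: continuous_sqr => t.
  by apply: continuous_comp; [exact: continuous_rcons2|exact: cg].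
have cDx x : continuous (fun t => 'D_(delta_mx ord0 ord_max) g (rcons_rV (x, t)) ^+ 2).
  by apply: continuous_sqr; exact: continuous_slice2.
have iI (c : R) : leb.-integrable `[- L, L[ (EFin \o cst c).
  by apply: continuous_itv_integrable; exact: cst_continuous.
have iD := @rbox_integrable1 _ n L _ _ mB mI (fun _ => id) (fun _ => id) _ cD2.
have ig := @rbox_integrable1 _ n L _ _ mB mI (fun _ => id) (fun _ => id) _ (continuous_sqr cg).
rewrite box_integral1; last exact: continuous_sqr.
rewrite box_integral1// -RintegralZl//; apply: le_Rintegral => //.
  exact: (integrableZl mB _ iD).
move=> x Bx; set D := (X in _ <= _ * X).
apply: (@le_trans _ _ (\int[leb]_(t in `[- L, L[) ((L + L) * D))); last first.
  by rewrite Rintegral_cst// [X in fine X](leb_itv_co (ltW LL))/= opprK expr2 mulrAC.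
apply: le_Rintegral => //; [exact: continuous_itv_integrable|exact: (iI ((L + L) * D))|].
move=> t /= tI; have gL : g (rcons_rV (x, - L)) = 0.
  by apply: g0; exists ord_max; rewrite rcons_rV_max normrN ger0_norm// ltW.
have LI : - L <= - L < L by rewrite lexx LL.
have := sqr_increment_le (fun t => @derive_slice2 _ g x t Cg)
  (@continuous_slice2 _ g x ord_max Cg) LI tI.
by rewrite gL subr0 opprK.
Qed.

Lemma big_ord_recr_lift n (F : 'I_n.+1 -> R) :
  \sum_(j < n.+1) F j = \sum_(j < n) F (lift ord_max j) + F ord_max.
Proof.
rewrite big_ord_recr/=; congr (_ + _); apply: eq_bigr => j _; congr F.
by apply/val_inj; exact/esym/lift_max.
Qed.

(** The difference of two slice integrals is the integral of vertical increments. Cauchy-Schwarz in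
    [x] yields the volume, and the increment estimate in the last coordinate yields the height. *)
Lemma slice_mean_increment_le n (L u v s t : R) (Q : set 'rV[R]_n) (g : 'rV[R]_n.+1 -> R) :
  C1_rV g -> measurable Q -> Q `<=` box L -> - L <= u -> v <= L ->
  u <= s < v -> u <= t < v ->
  (\int[lebesgue_rV R n]_(x in Q) g (rcons_rV (x, t)) -
   \int[lebesgue_rV R n]_(x in Q) g (rcons_rV (x, s))) ^+ 2 <=
  fine (lebesgue_rV R n (box L)) * ((v - u) * \int[lebesgue_rV R n]_(x in box L)
     \int[leb]_(t in `[u, v[) ('D_(delta_mx ord0 ord_max) g (rcons_rV (x, t)) ^+ 2)).
Proof.
move=> Cg mQ QL Lu vL sI tI; have [cg _ cDg] := Cg.
have mB := @measurable_bx R n L.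
have mJ : measurable (`[u, v[%classic : set (measurableTypeR R)) by [].
have JL : `[u, v[ `<=` `[- L, L[%classic.
  by move=> r /=; rewrite !in_itv/= => /andP[ur rv]; rewrite (le_trans Lu ur) (lt_le_trans rv vL).
have uv : u <= v by move: sI => /andP[us /ltW]; exact: le_trans.
have iD := @rbox_integrable1 _ n L _ _ mB mJ (fun _ => id) JL _ (continuous_sqr (cDg ord_max)).
have csl r : continuous (fun x => g (rcons_rV (x, r))) by have [] := C1_slice1 r Cg.
have islB r : (lebesgue_rV R n).-integrable (box L) (EFin \o (fun x => g (rcons_rV (x, r)))).
  exact: box_integrable.
have isl r : (lebesgue_rV R n).-integrable Q (EFin \o (fun x => g (rcons_rV (x, r)))).
  exact: integrableS (islB r).
have cdif : continuous (fun x => g (rcons_rV (x, t)) - g (rcons_rV (x, s))).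
  by move=> x; apply: (continuousB (csl t x) (csl s x)).
rewrite -RintegralB//.
have [M HM] := box_bound L cdif.
have QM x : Q x -> `|g (rcons_rV (x, t)) - g (rcons_rV (x, s))| <= M.
  by move=> Qx; apply: HM; exact: box_norm (QL _ Qx).
apply: le_trans (Rintegral_sqr_le mQ (rbox_mQ mQ QL) (continuous_measurable_rV cdif) QM) _.
apply: ler_pM.
- exact: fine_ge0.
- by apply: Rintegral_ge0 => x _; exact: sqr_ge0.
- apply: fine_le.
  + by rewrite ge0_fin_numE//; exact: rbox_mQ mQ QL.
  + by rewrite ge0_fin_numE//; exact: box_fin.
  + by apply: le_measure; rewrite ?inE.
- apply: (@le_trans _ _ (\int[lebesgue_rV R n]_(x in box L)
      ((g (rcons_rV (x, t)) - g (rcons_rV (x, s))) ^+ 2))).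
    apply: le_Rintegral_set => //.
      by apply: box_integrable; exact: continuous_sqr.
    by move=> x _; exact: sqr_ge0.
  rewrite -RintegralZl//; apply: le_Rintegral => //.
  + by apply: box_integrable; exact: continuous_sqr.
  + exact: (integrableZl mB _ iD).
  + move=> x Bx; exact: (sqr_increment_le (fun t => @derive_slice2 _ g x t Cg)
      (@continuous_slice2 _ g x ord_max Cg) sI tI).
Qed.

(* On a small cube, [int g^2] is controlled by the square of the mean of [g] and a small multiple
   of the Dirichlet energy; splitting a large cube into small ones yields finitely many
   functionals which control the L^2 norm up to a small fraction of the energy. *)
Lemma box_poincare n (L e : R) : 0 < L -> 0 < e ->
  exists (I : finType) (c : I -> R) (Q : I -> set 'rV[R]_n),
    [/\ (forall i, 0 <= c i), (forall i, measurable (Q i)), (forall i, Q i `<=` box L)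
      & forall g, C1_rV g ->
        \int[lebesgue_rV R n]_(x in box L) (g x ^+ 2) <=
        \sum_i c i * (\int[lebesgue_rV R n]_(x in Q i) g x) ^+ 2 +
        e * \sum_(j < n) \int[lebesgue_rV R n]_(x in box L)
               ('D_(delta_mx ord0 j) g x ^+ 2)].
Proof.
move=> L0; elim: n => [|n IH] in e *.
  (* In dimension zero the space is a point of mass one, and a single functional gives the squared
     norm exactly. *)
  move=> e0; exists unit, (fun=> 1), (fun=> box L); split => //.
  - by move=> _; exact: measurable_bx.
  - by move=> _ x.
  - move=> g _; rewrite big_ord0 mulr0 addr0 (big_pred1 tt) => [|[]//].
    have E (F : 'rV[R]_0 -> R) : \int[lebesgue_rV R 0]_(x in box L) F x = F 0.
      rewrite (_ : F = cst (F 0)); last by apply/funext => x; rewrite (thinmx0 x).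
      rewrite Rintegral_cst; last exact: measurable_bx.
      rewrite [X in _ * fine X](@lebesgue_rV_box R 0 (fun=> `[- L, L[%classic)) => [|[]//].
      by rewrite big_ord0 mulr1.
    by rewrite !E mul1r.
move=> e0; have [I [c [Q [c0 mQ QL HI]]]] := IH _ e0.
pose V := fine (lebesgue_rV R n (box L)).
have V0 : 0 <= V by exact: fine_ge0.
pose C := (\sum_i c i) * (V + 1).
have C0 : 0 <= C by rewrite mulr_ge0 ?sumr_ge0// addr_ge0.
(* The strips of height [h] are so thin that the vertical energy, which the variance estimate
   multiplies by [C * h ^+ 2], enters with a factor at most [e]. *)
have [K HK] : exists K : nat, C * ((L + L) / K.+1%:R) ^+ 2 <= e.
  exists (Num.trunc (C * (L + L) ^+ 2 / e)).
  set K := Num.trunc _; have HK : C * (L + L) ^+ 2 / e <= K.+1%:R.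
    by apply/ltW; exact: truncnS_gt.
  have K0 : 0 < K.+1%:R :> R by rewrite ltr0n.
  have K1 : 1 <= K.+1%:R :> R by rewrite ler1n.
  rewrite expr_div_n mulrA ler_pdivrMr ?exprn_gt0//.
  move: HK; rewrite ler_pdivrMr// => /le_trans; apply.
  by rewrite mulrC ler_pM2l// expr2 ler_peMl// ltW.
pose h : R := (L + L) / K.+1%:R.
have h0 : 0 < h by rewrite divr_gt0// addr_gt0.
pose J (j : 'I_K.+1) : set R := `[- L + j%:R * h, - L + j.+1%:R * h[%classic.
have mJ j : measurable (J j : set (measurableTypeR R)) by exact: measurable_itv.
have hKE : L = - L + K.+1%:R * h by rewrite /h; field; rewrite addrC natr1.
have JL j : J j `<=` `[- L, L[%classic.
  move=> t; rewrite /J/= !in_itv/= => /andP[jt tj]; apply/andP; split.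
    by apply: le_trans jt; rewrite lerDl mulr_ge0// ltW.
  apply: (lt_le_trans tj); rewrite {2}hKE lerD2l ler_wpM2r ?(ltW h0)//.
  by rewrite ler_nat.
have hj (j : 'I_K.+1) : - L + j.+1%:R * h - (- L + j%:R * h) = h.
  by rewrite -natr1; ring.
have le_j (j : 'I_K.+1) : - L + j%:R * h <= - L + j.+1%:R * h.
  by rewrite -subr_ge0 hj ltW.
have lebJ j : leb (J j) = h%:E by rewrite /J leb_itv_co// hj.
have IE : `[- L, L[%classic = `[- L, - L + K.+1%:R * h[%classic :> set R by rewrite -hKE.
have mB := @measurable_bx R n L.
have mI : measurable (`[- L, L[%classic : set (measurableTypeR R)) by [].
(* Each functional of dimension [n] is integrated over each strip; the factor [1 / h] is the one of
   the variance estimate on an interval of length [h]. *)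
exists (I * 'I_K.+1)%type, (fun p => c p.1 / h), (fun p => rbox (Q p.1) (J p.2)).
split.
- by move=> [i j]/=; rewrite divr_ge0 ?(ltW h0).
- by move=> [i j]/=; exact: measurable_rbox.
- by move=> [i j]/= v; rewrite box_rbox => -[/= Qv Jv]; split; [exact: QL Qv|exact: JL Jv].
move=> g Cg; have [cg _ cDg] := Cg.
pose D k := \int[lebesgue_rV R n.+1]_(x in box L) ('D_(delta_mx ord0 k) g x ^+ 2).
have cD2 k := continuous_sqr (cDg k).
have cg2 := continuous_sqr cg.
pose a i t := \int[lebesgue_rV R n]_(x in Q i) g (rcons_rV (x, t)).
pose Dj (j : 'I_K.+1) := \int[lebesgue_rV R n]_(x in box L)
  \int[leb]_(t in J j) ('D_(delta_mx ord0 ord_max) g (rcons_rV (x, t)) ^+ 2).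
have ma i : measurable_fun `[- L, L[ (a i).
  exact: (@rbox_measurable2 _ n L _ _ (mQ i) mI (QL i) (fun _ => id) _ cg).
have a_bd i : exists M, forall t, - L <= t < L -> `|a i t| <= M.
  have [M HM] := @rbox_bounded2 _ n L _ _ (mQ i) (QL i) (fun _ => id) _ cg.
  by exists M => t tI; exact: HM.
have lebI := @rbox_mJ R L _ mI (fun _ => id).
have ia2 i : leb.-integrable `[- L, L[ (EFin \o (fun t => a i t ^+ 2)).
  have [M HM] := a_bd i.
  apply: (bounded_integrable (M := M ^+ 2) mI lebI); first exact: (measurable_funX 2 (ma i)).
  move=> t tI; rewrite normrX lerXn2r ?nnegrE ?normr_ge0 ?HM//.
  exact: le_trans (HM _ tI).
(* The induction hypothesis on every slice, integrated over the last coordinate: the functionals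
   become the functions [a i] of that coordinate, and the energy collects all directions but the
   last. *)
have slice_le : \int[lebesgue_rV R n.+1]_(x in box L) (g x ^+ 2) <=
    \sum_i c i * \int[leb]_(t in `[- L, L[) (a i t ^+ 2) +
    e * \sum_(j < n) D (lift ord_max j).
  rewrite box_integral2//.
  have iDk j : leb.-integrable `[- L, L[ (EFin \o (fun t =>
      \int[lebesgue_rV R n]_(x in box L) ('D_(delta_mx ord0 (lift ord_max j)) g (rcons_rV (x, t)) ^+ 2))).
    exact: (@rbox_integrable2 _ n L _ _ mB mI (fun _ => id) (fun _ => id) _ (cD2 (lift ord_max j))).
  have i1 : leb.-integrable `[- L, L[ (EFin \o (fun t => \sum_i c i * a i t ^+ 2)).
    rewrite (_ : _ \o _ = (fun t => (\sum_i (c i * a i t ^+ 2)%:E)%E)); last first.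
      by apply/funext => t /=; rewrite sumEFin.
    by apply: integrable_sum => // i _; exact: (integrableZl mI _ (ia2 i)).
  have i3 : leb.-integrable `[- L, L[ (EFin \o (fun t => \sum_(j < n)
      \int[lebesgue_rV R n]_(x in box L) ('D_(delta_mx ord0 (lift ord_max j)) g (rcons_rV (x, t)) ^+ 2))).
    rewrite (_ : _ \o _ = (fun t => (\sum_(j < n) (\int[lebesgue_rV R n]_(x in box L)
       ('D_(delta_mx ord0 (lift ord_max j)) g (rcons_rV (x, t)) ^+ 2))%:E)%E)); last first.
      by apply/funext => t /=; rewrite sumEFin.
    by apply: integrable_sum => // j _; exact: iDk.
  have i2 := integrableZl mI e i3.
  apply: (@le_trans _ _ (\int[leb]_(t in `[- L, L[) (\sum_i c i * a i t ^+ 2 +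
     e * \sum_(j < n) \int[lebesgue_rV R n]_(x in box L)
       ('D_(delta_mx ord0 (lift ord_max j)) g (rcons_rV (x, t)) ^+ 2)))).
    apply: le_Rintegral => //.
    - exact: (@rbox_integrable2 _ n L _ _ mB mI (fun _ => id) (fun _ => id) _ cg2).
    - exact: (integrableD mI i1 i2).
    - move=> t _; apply: le_trans (HI _ (C1_slice1 t Cg)) _.
      apply: lerD; first exact: lexx.
      rewrite (ler_pM2l e0); apply: ler_sum => j _.
      rewrite le_eqVlt; apply/orP; left; apply/eqP; apply: eq_Rintegral => x _.
      by rewrite derive_slice1.
  rewrite RintegralD// Rintegral_sum//; last first.
    by move=> i; exact: (integrableZl mI _ (ia2 i)).
  rewrite RintegralZl//.
  rewrite Rintegral_sum//; apply: lerD.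
    by apply: ler_sum => i _; rewrite RintegralZl//; exact: ia2.
  by rewrite ler_pM2l//; apply: ler_sum => j _; rewrite /D box_integral2.
(* On each strip [a i] is compared with its mean; the last partial derivative controls its
   oscillation. *)
have a_le i : \int[leb]_(t in `[- L, L[) (a i t ^+ 2) <=
    \sum_j h^-1 * (\int[lebesgue_rV R n.+1]_(x in rbox (Q i) (J j)) g x) ^+ 2 +
    (V + 1) * h ^+ 2 * D ord_max.
  have [M HM] := a_bd i.
  have DjE : D ord_max = \sum_j Dj j.
    rewrite /D box_integral1// -Rintegral_sum//; last first.
      by move=> j; exact: (@rbox_integrable1 _ n L _ _ mB (mJ j) (fun _ => id) (JL j) _ (cD2 ord_max)).
    apply: eq_Rintegral => x _; rewrite IE Rintegral_itv_partition ?(ltW h0)//.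
    rewrite -IE; apply: continuous_itv_integrable; apply: continuous_sqr.
    exact: continuous_slice2.
  have := ia2 i; rewrite IE => iai.
  rewrite (Rintegral_itv_partition (ltW h0) iai).
  rewrite DjE mulr_sumr -big_split/=; apply: ler_sum => j _.
  have h1 : fine (leb (J j)) = h by rewrite [X in fine X]lebJ.
  have jM t : J j t -> `|a i t| <= M by move=> /JL; exact: HM.
  have mJa : measurable_fun (J j) (a i) by apply: (measurable_funS mI (JL j)); exact: ma.
  have Jfin : (leb (J j) < +oo)%E by rewrite [X in (X < _)%E]lebJ ltry.
  have W t s : J j t -> J j s -> (a i t - a i s) ^+ 2 <= (V + 1) * (h * Dj j).
    move=> Jt Js.
    have Lj : - L <= - L + j%:R * h by rewrite lerDl mulr_ge0// ltW.
    have jL : - L + j.+1%:R * h <= L.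
      by rewrite [leRHS]hKE lerD2l ler_wpM2r ?(ltW h0)// ler_nat.
    apply: le_trans (slice_mean_increment_le Cg (mQ i) (QL i) Lj jL Js Jt) _.
    rewrite hj -/V -/(Dj j) ler_wpM2r ?lerDl//.
    rewrite mulr_ge0 ?(ltW h0)//; apply: Rintegral_ge0 => x _.
    by apply: Rintegral_ge0 => r _; exact: sqr_ge0.
  have := variance_le (mJ j) Jfin mJa jM; rewrite h1 => /(_ _ h0 W) /le_trans; apply.
  rewrite (rbox_integral2 (L := L))// lerD2l le_eqVlt; apply/orP; left; apply/eqP; ring.
apply: (le_trans slice_le).
rewrite -(pair_bigA _ (fun i j => c i / h *
  (\int[lebesgue_rV R n.+1]_(x in rbox (Q i) (J j)) g x) ^+ 2))/=.
rewrite [X in _ <= _ + e * X](big_ord_recr_lift D).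
rewrite [e * (_ + _)]mulrDr [leRHS]addrA [leRHS]addrAC lerD2r.
apply: (@le_trans _ _ (\sum_i (\sum_j c i / h *
    (\int[lebesgue_rV R n.+1]_(x in rbox (Q i) (J j)) g x) ^+ 2 +
    c i * (V + 1) * h ^+ 2 * D ord_max))).
  apply: ler_sum => i _; apply: le_trans (ler_wpM2l (c0 i) (a_le i)) _.
  rewrite mulrDr mulr_sumr !mulrA lerD2r; apply: ler_sum => j _.
  by rewrite !mulrA.
rewrite big_split/= lerD2l -!mulr_suml -/C.
apply: ler_wpM2r; last exact: HK.
by rewrite /D; apply: Rintegral_ge0 => x _; exact: sqr_ge0.
Qed.

End C1_functions.

Section L2_instances.
Context (R : realType) d (T : measurableType d) (mu : {measure set T -> \bar R}).
Context (D : set T) (mD : measurable D).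

Lemma L2_semi_inner : semi_inner (L2 mu D : set (T -> R^o))
  (fun f g => \int[mu]_(x in D) (f x * g x)).
Proof.
have SI := L2vec_semi_inner mu mD (@scalar_lin R).
split.
- exact: L2_cst0.
- by move=> a u v Lu Lv; exact: (L2_lin mD a Lu Lv).
- move=> u v Lu Lv; have := semi_innerC SI (fun=> Lu) (fun=> Lv).
  by rewrite !L2_inner1E.
- move=> a u v w Lu Lv Lw.
  by have := semi_innerL SI a (fun=> Lu) (fun=> Lv) (fun=> Lw); rewrite !L2_inner1E.
- by move=> u Lu; apply: Rintegral_ge0 => x _; rewrite -expr2 sqr_ge0.
Qed.

Lemma L2sqE (f : T -> R) : L2 mu D f ->
  L2sq mu D f = (\int[mu]_(x in D) (f x * f x))%:E.
Proof.
move=> Lf; rewrite /Rintegral fineK//.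
by apply: integrable_fin_num => //; exact: L2_integrableM.
Qed.

Lemma L2_sub (f g : T -> R) : L2 mu D f -> L2 mu D g -> L2 mu D (fun x => f x - g x).
Proof. by move=> Lf Lg; exact: (semi_innerSB L2_semi_inner Lf Lg). Qed.

Lemma L2_add (f g : T -> R) : L2 mu D f -> L2 mu D g -> L2 mu D (fun x => f x + g x).
Proof. by move=> Lf Lg; exact: (semi_innerSD L2_semi_inner Lf Lg). Qed.

Lemma L2_scale (a : R) (f : T -> R) : L2 mu D f -> L2 mu D (fun x => a * f x).
Proof. by move=> Lf; exact: (semi_innerSZ L2_semi_inner a Lf). Qed.

Lemma L2_sum (I : finType) (f : I -> T -> R) : (forall i, L2 mu D (f i)) ->
  L2 mu D (fun x => \sum_i f i x).
Proof.
move=> Lf; rewrite (_ : (fun x => _) = \sum_i (f i : T -> R^o)); last first.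
  by apply/funext => x; rewrite fct_sumE.
apply: (big_ind (fun f : T -> R^o => L2 mu D f)) => //; first exact: L2_cst0.
by move=> u v; exact: L2_add.
Qed.

(** A bridge between the extended-valued norms used in the definitions of [H10] and [in_V] and the
    real-valued forms of the abstract lemmas. *)
Lemma L2_cvgP (f_ : nat -> T -> R) (f : T -> R) :
  (forall n, L2 mu D (f_ n)) -> L2 mu D f ->
  (L2sq mu D (fun x => f_ n x - f x)%R @[n --> \oo] --> 0%E) <->
  (\int[mu]_(x in D) ((f_ n x - f x) * (f_ n x - f x)) @[n --> \oo] --> 0).
Proof.
move=> Lf_ Lf.
have E : (fun n => L2sq mu D (fun x => f_ n x - f x)) =
    EFin \o (fun n => \int[mu]_(x in D) ((f_ n x - f x) * (f_ n x - f x))).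
  by apply/funext => n /=; rewrite L2sqE//; exact: L2_sub.
rewrite E; split => [H|H]; last by apply: cvg_EFin => //; exact: nearW.
by have /fine_cvgP[] := H.
Qed.

End L2_instances.

Section vector_L2.
Context (R : realType) (d : nat) (Omega : set 'rV[R]_d) (mO : measurable Omega).
Local Notation muE := (lebesgue_rV R d).

Definition L2v (G : 'rV[R]_d -> 'rV[R]_d) :=
  forall i, L2 muE Omega (fun x => G x ord0 i).

Lemma coord_lin (i : 'I_d) (a : R) (u v : 'rV[R]_d) :
  (a *: u + v) ord0 i = a * u ord0 i + v ord0 i.
Proof. by rewrite !mxE. Qed.

Lemma L2v_semi_inner : semi_inner (L2v : set ('rV[R]_d -> 'rV[R]_d))
  (fun G H => \int[muE]_(x in Omega) dot (G x) (H x)).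
Proof. exact: (L2vec_semi_inner muE mO coord_lin). Qed.

Lemma L2v_integrable G H : L2v G -> L2v H ->
  muE.-integrable Omega (EFin \o (fun x => dot (G x) (H x))).
Proof. by move=> LG LH; exact: (L2vec_integrable mO (c := fun (i : 'I_d) (v : 'rV[R]_d) => v ord0 i) LG LH). Qed.

Lemma vL2sqE G : L2v G ->
  vL2sq Omega G = (\int[muE]_(x in Omega) dot (G x) (G x))%:E.
Proof. by move=> LG; exact: (L2vec_innerE mO (c := fun (i : 'I_d) (v : 'rV[R]_d) => v ord0 i) LG LG). Qed.

Lemma L2v_cvgP (G_ : nat -> 'rV[R]_d -> 'rV[R]_d) G :
  (forall n, L2v (G_ n)) -> L2v G ->
  (vL2sq Omega (fun x => G_ n x - G x)%R @[n --> \oo] --> 0%E) <->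
  (\int[muE]_(x in Omega) dot (G_ n x - G x) (G_ n x - G x) @[n --> \oo] --> 0).
Proof.
move=> LG_ LG.
have E : (fun n => vL2sq Omega (fun x => G_ n x - G x)) =
    EFin \o (fun n => \int[muE]_(x in Omega) dot (G_ n x - G x) (G_ n x - G x)).
  apply/funext => n /=; rewrite vL2sqE//.
  exact: (semi_innerSB L2v_semi_inner (LG_ n) LG).
rewrite E; split => [H|H]; last by apply: cvg_EFin => //; exact: nearW.
by have /fine_cvgP[] := H.
Qed.

End vector_L2.

(** * Test functions and the first Dirichlet eigenvalue *)

Section test_functions.
Context (R : realType) (V : normedModType R).
Implicit Types (U : set V) (phi psi : V -> R).

Lemma test_smooth U phi : test_function U phi -> smooth phi.
Proof. by case. Qed.

Lemma test_out U phi x : test_function U phi -> ~ U x -> phi x = 0.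
Proof. by move=> [_ [K [_ KU K0]]] Ux; apply: K0 => /KU. Qed.

Lemma test_lin U a phi psi : test_function U phi -> test_function U psi ->
  test_function U (fun x => a * phi x + psi x).
Proof.
move=> [sphi [K [cK KU K0]]] [spsi [K' [cK' K'U K'0]]]; split.
  by apply: smoothD => //; exact: smoothZ.
exists (K `|` K'); split; first exact: compactU.
- by move=> x [/KU|/K'U].
- by move=> x /not_orP[Kx K'x]; rewrite K0// K'0// mulr0 addr0.
Qed.

Lemma test_sub U phi psi : test_function U phi -> test_function U psi ->
  test_function U (fun x => phi x - psi x).
Proof.
move=> tphi tpsi; have := test_lin (-1) tpsi tphi.
by congr test_function; apply/funext => x; rewrite mulN1r addrC.
Qed.

Lemma test_derive U phi v : test_function U phi ->
  test_function U (fun x => 'D_v phi x).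
Proof.
move=> [sphi [K [cK KU K0]]]; split; first exact: smooth_derive.
exists K; split => // x Kx.
have : \forall y \near x, cst 0 y = phi y.
  have oK : open (~` K) by apply: closed_openC; apply: compact_closed cK; exact: norm_hausdorff.
  by near=> y; rewrite K0//; near: y; exact: open_nbhs_nbhs.
by move=> /near_eq_derive <-; exact: derive_cst.
Unshelve. all: by end_near. Qed.

End test_functions.

Section bounded_domain.
Context (R : realType) (d : nat) (Omega : set 'rV[R]_d) (L : R).
Hypotheses (L0 : 0 < L) (oO : open Omega).
Hypothesis (OL : forall x, Omega x -> forall i, `|x ord0 i| < L).
Local Notation muE := (lebesgue_rV R d).

Lemma domain_measurable : measurable Omega.
Proof. exact: open_measurable_rV. Qed.
Let mO := domain_measurable.

Lemma domain_box : Omega `<=` box L.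
Proof.
by move=> x /OL Ox i; have := Ox i; rewrite ltr_norml /= in_itv/= => /andP[/ltW -> ->].
Qed.

Lemma domain_fin : (muE Omega < +oo)%E.
Proof.
apply: le_lt_trans (@box_fin R d L); apply: le_measure; rewrite ?inE//.
- exact: measurable_bx.
- exact: domain_box.
Qed.

Lemma domain_bound (F : 'rV[R]_d -> R) : continuous F ->
  exists M, forall x, Omega x -> `|F x| <= M.
Proof.
move=> cF; have [M HM] := box_bound L cF.
by exists M => x Ox; apply: HM; exact/box_norm/domain_box.
Qed.

Lemma continuous_L2 (F : 'rV[R]_d -> R) : continuous F -> L2 muE Omega F.
Proof.
move=> cF; have [M HM] := domain_bound cF.
by apply: (bounded_L2 mO domain_fin _ HM); exact: continuous_measurable_rV.
Qed.

Lemma smooth_grad_L2v (F : 'rV[R]_d -> R) : smooth F -> L2v Omega (grad F).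
Proof.
move=> sF i; rewrite (_ : (fun x => _) = (fun x => 'D_(delta_mx ord0 i) F x)).
  by apply: continuous_L2; apply: smooth_continuous; exact: smooth_derive.
by apply/funext => x; rewrite mxE.
Qed.

Lemma Rintegral_domain_box (F : 'rV[R]_d -> R) : (forall x, ~ Omega x -> F x = 0) ->
  \int[muE]_(x in Omega) F x = \int[muE]_(x in box L) F x.
Proof.
move=> F0; rewrite Rintegral_mkcond [RHS]Rintegral_mkcond.
apply: eq_Rintegral => x _; rewrite /patch; case: ifPn => [xO|/negP xO].
  by rewrite mem_set//; apply: domain_box; exact: set_mem.
by case: ifPn => // _; rewrite F0// => /mem_set.
Qed.

Lemma test_box0 (phi : 'rV[R]_d -> R) : test_function Omega phi ->
  forall x : 'rV[R]_d, (exists j, L <= `|x ord0 j|) -> phi x = 0.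
Proof.
move=> tphi x [j Lj]; apply: (test_out tphi) => /OL /(_ j).
by rewrite ltNge Lj.
Qed.

(** The product [v * phi] vanishes outside [Omega], so its derivative integrates to zero over the
    surrounding box. *)
Lemma smooth_ibp (phi v : 'rV[R]_d -> R) i : test_function Omega phi -> smooth v ->
  \int[muE]_(x in Omega) (v x * 'D_(delta_mx ord0 i) phi x) =
  - \int[muE]_(x in Omega) ('D_(delta_mx ord0 i) v x * phi x).
Proof.
move=> tphi sv; have sphi := test_smooth tphi.
have sg : smooth (fun x => v x * phi x) by exact: smoothM.
have g0 (x : 'rV[R]_d) : (exists j, L <= `|x ord0 j|) -> v x * phi x = 0.
  by move=> Lx; rewrite (test_box0 tphi Lx) mulr0.
have := box_integral_derive0 i (ltW L0) (smooth_C1 sg) g0.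
have -> : (fun x => 'D_(delta_mx ord0 i) (fun x => v x * phi x) x) =
    (fun x => v x * 'D_(delta_mx ord0 i) phi x + 'D_(delta_mx ord0 i) v x * phi x).
  apply/funext => x; rewrite deriveM; [|exact: smooth_derivable|exact: smooth_derivable].
  by rewrite [in RHS](mulrC _ (phi x)).
rewrite -Rintegral_domain_box => [|x Ox]; last first.
  by rewrite (test_out tphi Ox) (test_out (test_derive (delta_mx ord0 i) tphi) Ox) !mulr0 addr0.
have iM (f g : 'rV[R]_d -> R) : smooth f -> smooth g ->
    muE.-integrable Omega (EFin \o (fun x => f x * g x)).
  move=> sf sg'; apply: (L2_integrableM mO);
    by apply: continuous_L2; exact: smooth_continuous.
rewrite RintegralD//.
- by move=> /eqP; rewrite addr_eq0 => /eqP.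
- by apply: iM => //; exact: smooth_derive.
- by apply: iM => //; exact: smooth_derive.
Qed.

Lemma test_H1 (phi : 'rV[R]_d -> R) : test_function Omega phi -> H1 Omega phi (grad phi).
Proof.
move=> tphi; have sphi := test_smooth tphi; split.
- by apply: continuous_L2; exact: smooth_continuous.
- exact: smooth_grad_L2v.
- move=> psi tpsi i.
  under eq_Rintegral do rewrite mxE.
  by rewrite smooth_ibp//; congr (- _); apply: eq_Rintegral => x _; rewrite mxE.
Qed.

Lemma grad_lin a (phi psi : 'rV[R]_d -> R) x : smooth phi -> smooth psi ->
  grad (fun x => a * phi x + psi x) x = a *: grad phi x + grad psi x.
Proof.
move=> sphi spsi; apply/rowP => i; rewrite !mxE.
rewrite deriveD; [|by apply: smooth_derivable; exact: smoothZ|exact: smooth_derivable].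
by rewrite deriveZ//; exact: smooth_derivable.
Qed.

Lemma grad_sub (phi psi : 'rV[R]_d -> R) x : smooth phi -> smooth psi ->
  grad (fun x => phi x - psi x) x = grad phi x - grad psi x.
Proof.
move=> sphi spsi; apply/rowP => i; rewrite !mxE.
by rewrite deriveB//; exact: smooth_derivable.
Qed.

Lemma dot_gradE (phi : 'rV[R]_d -> R) : smooth phi ->
  \int[muE]_(x in Omega) dot (grad phi x) (grad phi x) =
  \sum_(i < d) \int[muE]_(x in Omega) ('D_(delta_mx ord0 i) phi x ^+ 2).
Proof.
move=> sphi; rewrite /dot; under eq_Rintegral do under eq_bigr do rewrite mxE -expr2.
rewrite Rintegral_sum// => i; apply: L2_sqr_integrable.
by apply: continuous_L2; apply: smooth_continuous; exact: smooth_derive.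
Qed.

End bounded_domain.

(** * Rellich compactness along an ultrafilter *)

Section rellich.
Context (R : realType) (d : nat) (Omega : set 'rV[R]_d) (L : R).
Hypotheses (L0 : 0 < L) (oO : open Omega).
Hypothesis (OL : forall x, Omega x -> forall i, `|x ord0 i| < L).
Local Notation muE := (lebesgue_rV R d).
Let mO := domain_measurable oO.

Lemma ultra_fmap (T U : Type) (f : T -> U) (F : set_system T) :
  UltraFilter F -> UltraFilter (f @ F).
Proof.
move=> UF; split; first exact: fmap_proper_filter.
move=> G PG FG; apply/seteqP; split => // A GA.
have [//|FA] := in_ultra_setVsetC (f @^-1` A) UF.
have /FG GA' : (f @ F) (~` A) by [].
have := filterI GA GA'; rewrite setICr => G0.
by case: (@filter_not_empty _ _ PG); apply: G0.
Qed.

(** An ultrafilter replaces repeated extraction of subsequences: all bounded real sequences converge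
    along it simultaneously. *)
Lemma ultra_bounded_cvg (T : Type) (f : T -> R) (F : set_system T) (M : R) :
  UltraFilter F -> (forall n, `|f n| <= M) -> exists l : R, f @ F --> l.
Proof.
move=> UF fM; have := @segment_compact R (- M) M; rewrite compact_ultra.
move=> /(_ (f @ F) (ultra_fmap f UF))[|l [_ Fl]]; last by exists l.
by apply: nearW => n /=; rewrite in_itv/= -ler_norml.
Qed.

Lemma rellich (phi : nat -> 'rV[R]_d -> R) (U : set_system nat) (M e : R) :
  UltraFilter U -> 0 < e -> (forall n, test_function Omega (phi n)) ->
  (forall n, \int[muE]_(x in Omega) (phi n x * phi n x) <= M) ->
  (forall n, \int[muE]_(x in Omega) dot (grad (phi n) x) (grad (phi n) x) <= M) ->
  exists2 A, U A & forall k l, A k -> A l ->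
    \int[muE]_(x in Omega) ((phi k x - phi l x) * (phi k x - phi l x)) <= e.
Proof.
move=> UU e0 tphi NM EM.
have SI := L2_semi_inner muE mO; have SV := L2v_semi_inner mO.
have sphi n := test_smooth (tphi n).
have cphi n := smooth_continuous (sphi n).
have Lphi n : L2 muE Omega (phi n) by exact: (continuous_L2 oO OL).
have Lgrad n : L2v Omega (grad (phi n)) by exact: (smooth_grad_L2v oO OL).
have M0 : 0 <= M by apply: le_trans (NM 0%N); exact: (semi_inner_ge0 SI (Lphi 0%N)).
(* The difference of two members has energy at most [4 * M], so the energy term of the Poincare
   inequality contributes at most [e / 2]. *)
pose e1 := e / (8 * (M + 1)).
have M1 : 0 < M + 1 by rewrite ltr_wpDl.
have e10 : 0 < e1 by rewrite divr_gt0// mulr_gt0.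
have [I [c [Q [c0 mQ QL HP]]]] := @box_poincare R d L e1 L0 e10.
pose V := fine (muE (box L)).
pose m i n := \int[muE]_(x in Q i) phi n x.
have /choice[Mn HMn] := fun n => box_bound L (cphi n).
have V0 : 0 <= V by exact: fine_ge0.
have mB i n : `|m i n| <= Num.sqrt (V * M).
  have QM x : Q i x -> `|phi n x| <= Mn n by move=> Qx; apply: HMn; exact: box_norm (QL i _ Qx).
  have mphi : measurable_fun (Q i) (phi n) by exact: continuous_measurable_rV.
  rewrite -sqrtr_sqr ler_sqrt; last by rewrite mulr_ge0.
  apply: le_trans (Rintegral_sqr_le (mQ i) (rbox_mQ (mQ i) (QL i)) mphi QM) _.
  apply: ler_pM.
  - exact: fine_ge0.
  - by apply: Rintegral_ge0 => x _; exact: sqr_ge0.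
  - apply: fine_le.
    + by rewrite ge0_fin_numE//; exact: rbox_mQ (mQ i) (QL i).
    + by rewrite ge0_fin_numE//; exact: box_fin.
    + by apply: le_measure; rewrite ?inE//; exact: measurable_bx.
  - apply: le_trans (NM n).
    rewrite (Rintegral_domain_box OL) => [|x Ox]; last by rewrite (test_out (tphi n) Ox) mul0r.
    apply: le_Rintegral_set => //; first exact: measurable_bx.
      by apply: box_integrable; exact: continuous_sqr.
    by move=> x _; exact: sqr_ge0.
have /choice[l Hl] : forall i, exists l : R, m i @ U --> l.
  by move=> i; exact: ultra_bounded_cvg (mB i).
pose C := \sum_i c i.
have C0 : 0 <= C by exact: sumr_ge0.
(* If all functionals of two members differ by at most [del], their weighted squares sum to at most
   [C * del ^+ 2], hence to at most [e / 2]. *)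
pose del := Num.sqrt (e / (2 * (C + 1))).
have C1 : 0 < C + 1 by rewrite ltr_wpDl.
have del0 : 0 < del by rewrite sqrtr_gt0 divr_gt0// mulr_gt0.
exists [set n | forall i, `|l i - m i n| < del / 2].
  apply: filter_forall => i.
  by have /cvgrPdist_lt := Hl i; apply; rewrite divr_gt0.
move=> k j Ak Aj.
have tkj := test_sub (tphi k) (tphi j).
have skj := test_smooth tkj.
have Nkj : \int[muE]_(x in Omega) ((phi k x - phi j x) * (phi k x - phi j x)) =
    \int[muE]_(x in box L) ((phi k x - phi j x) ^+ 2).
  by rewrite (Rintegral_domain_box OL)// => x Ox; rewrite (test_out tkj Ox) mul0r.
have Ekj : \sum_(i < d) \int[muE]_(x in box L)
    ('D_(delta_mx ord0 i) (fun x => phi k x - phi j x) x ^+ 2) <= 4 * M.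
  apply: (@le_trans _ _ (\int[muE]_(x in Omega) dot (grad (phi k) x - grad (phi j) x)
      (grad (phi k) x - grad (phi j) x))).
    rewrite (_ : \int[muE]_(x in Omega) _ = \int[muE]_(x in Omega)
      dot (grad (fun x => phi k x - phi j x) x) (grad (fun x => phi k x - phi j x) x)); last first.
      by apply: eq_Rintegral => x _; rewrite grad_sub.
    rewrite (dot_gradE oO OL)//; apply: ler_sum => i _.
    rewrite (Rintegral_domain_box OL)// => x Ox.
    by rewrite (test_out (test_derive _ tkj) Ox) expr0n.
  have := semi_inner_sub_le SV (Lgrad k) (Lgrad j).
  move/le_trans; apply; rewrite (_ : 4 * M = 2 * M + 2 * M); last by ring.
  by apply: lerD; rewrite ler_pM2l//; exact: EM.
rewrite Nkj; apply: le_trans (HP _ (smooth_C1 skj)) _.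
rewrite (splitr e); apply: lerD; last first.
  apply: (@le_trans _ _ (e1 * (4 * M))); first by rewrite ler_pM2l.
  rewrite /e1 mulrAC ler_pdivrMr ?mulr_gt0//; nra.
have mdif i : (\int[muE]_(x in Q i) (phi k x - phi j x)) ^+ 2 <= e / (2 * (C + 1)).
  have iQ n : muE.-integrable (Q i) (EFin \o phi n).
    by apply: integrableS (box_integrable L (cphi n)) => //; exact: measurable_bx.
  rewrite RintegralB// -[leRHS]sqr_sqrtr; last by rewrite divr_ge0 ?mulr_ge0// ltW.
  rewrite -[leLHS]ger0_norm ?sqr_ge0// normrX lerXn2r ?nnegrE ?sqrtr_ge0//.
  have -> : \int[muE]_(x in Q i) phi k x - \int[muE]_(x in Q i) phi j x =
     (l i - m i j) - (l i - m i k) by rewrite /m; ring.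
  apply: le_trans (ler_normB _ _) _; rewrite -/del (splitr del).
  by apply: lerD; apply: ltW; [exact: Aj|exact: Ak].
apply: (@le_trans _ _ (\sum_i c i * (e / (2 * (C + 1))))).
  by apply: ler_sum => i _; exact: ler_wpM2l.
rewrite -mulr_suml -/C mulrA ler_pdivrMr ?mulr_gt0//; nra.
Qed.

End rellich.

Section limits.
Context (R : realType).

Lemma cvg_le_lim (f g : nat -> R) (a b : R) :
  f @ \oo --> a -> g @ \oo --> b -> (forall n, f n <= g n) -> a <= b.
Proof.
move=> fa gb fg; rewrite -(cvg_lim _ fa)// -(cvg_lim _ gb)//.
by apply: ler_lim; [exact: (cvgP _ fa)|exact: (cvgP _ gb)|exact: nearW].
Qed.

Lemma cvg_eq_lim (f g : nat -> R) (a b : R) :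
  f @ \oo --> a -> g @ \oo --> b -> (forall n, f n = g n) -> a = b.
Proof.
move=> fa gb fg; apply/eqP; rewrite eq_le.
by rewrite (cvg_le_lim fa gb) ?(cvg_le_lim gb fa)// => n; rewrite fg.
Qed.

(** The first-order condition at a minimum, from which the eigenvalue equation is read off. At
    [t = - b / (|a| + 1)] the linear term outweighs the quadratic one whatever the sign of [a]. *)
Lemma quadratic_ge0_eq0 (a b : R) : (forall t, 0 <= t ^+ 2 * a + 2 * t * b) -> b = 0.
Proof.
move=> H; have [//|b0] := eqVneq b 0.
have b2 : 0 < b ^+ 2 by rewrite lt_def sqr_ge0 expf_neq0.
have c0 : 0 < `|a| + 1 by rewrite ltr_wpDl.
have := H (- b / (`|a| + 1)).
have -> : (- b / (`|a| + 1)) ^+ 2 * a + 2 * (- b / (`|a| + 1)) * b =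
  b ^+ 2 * (a - 2 * (`|a| + 1)) / (`|a| + 1) ^+ 2 by field; rewrite gt_eqF.
rewrite pmulr_lge0 ?invr_gt0 ?exprn_gt0// pmulr_rge0//.
by have := ler_norm a; have := normr_ge0 a; lra.
Qed.

End limits.

(** * The infimum of the Rayleigh quotient is an eigenvalue *)

Section first_eigenvalue.
Context (R : realType) (d : nat) (Omega : set 'rV[R]_d) (L : R).
Hypotheses (L0 : 0 < L) (oO : open Omega).
Hypothesis (OL : forall x, Omega x -> forall i, `|x ord0 i| < L).
Local Notation muE := (lebesgue_rV R d).
Let mO := domain_measurable oO.
Let B0 (f g : 'rV[R]_d -> R^o) := \int[muE]_(x in Omega) (f x * g x).
Let BV (G H : 'rV[R]_d -> 'rV[R]_d) := \int[muE]_(x in Omega) dot (G x) (H x).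
Let SI : semi_inner (L2 muE Omega : set ('rV[R]_d -> R^o)) B0 := L2_semi_inner muE mO.
Let SV : semi_inner (L2v Omega : set ('rV[R]_d -> 'rV[R]_d)) BV := L2v_semi_inner mO.

Lemma grad_scale (a : R) (phi : 'rV[R]_d -> R) : smooth phi ->
  grad (fun x => a * phi x) = a *: grad phi.
Proof.
move=> sphi; apply/funext => x; apply/rowP => i; rewrite !mxE.
by rewrite deriveZ//; exact: smooth_derivable.
Qed.

Lemma grad_add (phi psi : 'rV[R]_d -> R) : smooth phi -> smooth psi ->
  grad (fun x => phi x + psi x) = grad phi + grad psi.
Proof.
move=> sphi spsi; apply/funext => x; apply/rowP => i; rewrite !mxE.
by rewrite deriveD//; exact: smooth_derivable.
Qed.

Lemma L2v_coord_le i (G : 'rV[R]_d -> 'rV[R]_d) : L2v Omega G ->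
  \int[muE]_(x in Omega) (G x ord0 i * G x ord0 i) <= BV G G.
Proof.
move=> LG; apply: le_Rintegral => //.
- by apply: L2_integrableM => //; exact: LG.
- exact: L2v_integrable.
- move=> x _; rewrite /dot (bigD1 i)//= lerDl.
  by apply: sumr_ge0 => j _; rewrite -expr2 sqr_ge0.
Qed.

Lemma H10_approx u G : H10 Omega u G -> exists phi : nat -> 'rV[R]_d -> R,
  [/\ forall n, test_function Omega (phi n),
     B0 (fun x => phi n x - u x) (fun x => phi n x - u x) @[n --> \oo] --> 0
   & BV (fun x => grad (phi n) x - G x) (fun x => grad (phi n) x - G x)
       @[n --> \oo] --> 0].
Proof.
move=> [[Lu LG _] [phi [tphi Hu HG]]]; exists phi; split => //.
- apply/(L2_cvgP mO _ Lu) => // n; apply: (continuous_L2 oO OL).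
  exact/smooth_continuous/test_smooth/tphi.
- apply/(L2v_cvgP mO _ LG) => // n; apply: (smooth_grad_L2v oO OL).
  exact/test_smooth/tphi.
Qed.

Lemma poincare_H10 (c : R) :
  (forall phi, test_function Omega phi -> c * B0 phi phi <= BV (grad phi) (grad phi)) ->
  forall u G, H10 Omega u G -> c * B0 u u <= BV G G.
Proof.
move=> H u G hu; have [phi [tphi Hu HG]] := H10_approx hu.
have [[Lu LG _] _] := hu.
have Lphi n : L2 muE Omega (phi n).
  by apply: (continuous_L2 oO OL); exact/smooth_continuous/test_smooth/tphi.
have Lgrad n : L2v Omega (grad (phi n)).
  by apply: (smooth_grad_L2v oO OL); exact/test_smooth/tphi.
have C1 : B0 (phi n) (phi n) @[n --> \oo] --> B0 u u.
  exact: (semi_inner_cvg SI).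
have C2 : BV (grad (phi n)) (grad (phi n)) @[n --> \oo] --> BV G G.
  exact: (semi_inner_cvg SV).
have C3 : c * B0 (phi n) (phi n) @[n --> \oo] --> c * B0 u u.
  by apply: cvgM => //; exact: cvg_cst.
by apply: (cvg_le_lim C3 C2) => n; exact: H.
Qed.

Lemma self0 (V : lmodType R) (S : set V) (B : V -> V -> R) (u : V) :
  semi_inner S B -> S u -> B (u - u) (u - u) @[n --> \oo] --> 0.
Proof.
move=> SB Su; rewrite subrr (semi_inner0 SB (semi_innerS0 SB)).
exact: cvg_cst.
Qed.

(** The direct method of the calculus of variations: a normalized minimizing sequence has a strong
    limit of norm one and energy [lam], and perturbing it by test functions gives the eigenvalue
    equation. The function [phi0] makes the set of quotients nonempty. *)
Lemma rayleigh_minimizer (phi0 : 'rV[R]_d -> R) :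
  test_function Omega phi0 -> 0 < B0 phi0 phi0 ->
  exists lam : R, dirichlet_eigenvalue Omega lam /\
    forall phi, test_function Omega phi -> lam * B0 phi phi <= BV (grad phi) (grad phi).
Proof.
move=> t0 N0.
have Lt phi : test_function Omega phi -> L2 muE Omega phi.
  by move=> tphi; apply: (continuous_L2 oO OL); exact/smooth_continuous/test_smooth/tphi.
have Lg phi : test_function Omega phi -> L2v Omega (grad phi).
  by move=> tphi; apply: (smooth_grad_L2v oO OL); exact/test_smooth/tphi.
pose S := [set r | exists phi, [/\ test_function Omega phi, B0 phi phi = 1
   & r = BV (grad phi) (grad phi)]].
have tZ a phi : test_function Omega phi -> test_function Omega (fun x => a * phi x).
  move=> tphi; have tphi0 := test_sub tphi tphi.
  have := test_lin a tphi tphi0; congr test_function; apply/funext => x.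
  by rewrite subrr addr0.
have normalize phi : test_function Omega phi -> 0 < B0 phi phi ->
    S (BV (grad phi) (grad phi) / B0 phi phi).
  move=> tphi Np; set a := (Num.sqrt (B0 phi phi))^-1.
  have a2 : a ^+ 2 = (B0 phi phi)^-1 by rewrite exprVn sqr_sqrtr// ltW.
  exists (fun x => a * phi x); split; first exact: tZ.
    have := semi_innerZ SI a (Lt _ tphi) (semi_innerSZ SI a (Lt _ tphi)).
    rewrite (semi_innerZr SI a (Lt _ tphi) (Lt _ tphi)) mulrA -expr2 a2.
    by rewrite mulVf ?gt_eqF.
  rewrite grad_scale; last exact: test_smooth tphi.
  rewrite (semi_innerZ SV a (Lg _ tphi) (semi_innerSZ SV a (Lg _ tphi))).
  by rewrite (semi_innerZr SV a (Lg _ tphi) (Lg _ tphi)) mulrA -expr2 a2 mulrC.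
have S0 : S !=set0 by exists (BV (grad phi0) (grad phi0) / B0 phi0 phi0); exact: normalize.
have Slb : has_lbound S.
  exists 0 => _ [phi [tphi _ ->]]; exact: (semi_inner_ge0 SV (Lg _ tphi)).
pose lam := inf S.
have lamP phi : test_function Omega phi -> lam * B0 phi phi <= BV (grad phi) (grad phi).
  move=> tphi; have := semi_inner_ge0 SI (Lt _ tphi).
  rewrite le_eqVlt => /predU1P[<-|Np].
    by rewrite mulr0; exact: (semi_inner_ge0 SV (Lg _ tphi)).
  by rewrite -ler_pdivlMr//; apply: ge_inf => //; exact: normalize.
have lam0 : 0 <= lam.
  by apply: lb_le_inf => // _ [phi [tphi _ ->]]; exact: (semi_inner_ge0 SV (Lg _ tphi)).
have /choice[phi Hphi] : forall n : nat, exists phi, [/\ test_function Omega phi,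
    B0 phi phi = 1 & BV (grad phi) (grad phi) <= lam + n.+1%:R^-1].
  move=> n; have n0 : 0 < n.+1%:R^-1 :> R by rewrite invr_gt0.
  have [_ [phi [tphi Np ->]] /ltW Ep] := inf_adherent n0 (conj S0 Slb).
  by exists phi.
have tphi n : test_function Omega (phi n) by case: (Hphi n).
have Nphi n : B0 (phi n) (phi n) = 1 by case: (Hphi n).
have Ephi n : BV (grad (phi n)) (grad (phi n)) <= lam + n.+1%:R^-1 by case: (Hphi n).
have Lphi n := Lt _ (tphi n).
have Lgrad n := Lg _ (tphi n).
have [U [UU ooU]] := ultraFilterLemma eventually_filter.
(* The parallelogram law in both forms: the sum of two members has energy at least [lam] times its
   squared norm, so the energy of the difference is at most the excess of the two energies over
   [lam] plus [lam] times its own squared norm. *)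
have Ecauchy k l : BV (grad (phi k) - grad (phi l)) (grad (phi k) - grad (phi l)) <=
    2 * k.+1%:R^-1 + 2 * l.+1%:R^-1 + lam * B0 (phi k \- phi l) (phi k \- phi l).
  have arith (D P n s Ek El a b : R) : D + P = 2 * Ek + 2 * El -> n + s = 2 * 1 + 2 * 1 ->
      lam * s <= P -> Ek <= lam + a -> El <= lam + b -> D <= 2 * a + 2 * b + lam * n.
    move=> DP ns sP Eka Elb; have sE : s = 4 - n by lra.
    by move: sP; rewrite sE mulrBr; lra.
  have parV := semi_inner_parallelogram SV (Lgrad k) (Lgrad l).
  have par0 := semi_inner_parallelogram SI (Lphi k) (Lphi l).
  rewrite !Nphi in par0.
  apply: (arith _ _ _ _ _ _ _ _ parV par0 _ (Ephi k) (Ephi l)).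
  have := lamP _ (test_lin 1 (tphi k) (tphi l)).
  rewrite (_ : (fun x => 1 * phi k x + phi l x) = (fun x => phi k x + phi l x)); last first.
    by apply/funext => x; rewrite mul1r.
  by rewrite grad_add//; exact: test_smooth.
have cauchyU (e : R) : 0 < e -> exists2 A, U A & (forall k, A k -> k.+1%:R^-1 <= e) /\
    forall k l, A k -> A l -> B0 (phi k \- phi l) (phi k \- phi l) <= e /\
    BV (grad (phi k) - grad (phi l)) (grad (phi k) - grad (phi l)) <= e.
  move=> e0; have lam1 : 0 < lam + 1 by rewrite ltr_wpDl.
  (* The bound [e] for the energy is spent as [2 * (e / 8) + 2 * (e / 8)] on the excess and
     [lam * e1 <= e / 2] on the norm. *)
  pose e1 := e / (2 * (lam + 1)).
  have e10 : 0 < e1 by rewrite divr_gt0// mulr_gt0.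
  have e18 : 0 < e / 8 by rewrite divr_gt0.
  have Nb n : B0 (phi n) (phi n) <= lam + 1 by rewrite Nphi lerDr.
  have Eb n : BV (grad (phi n)) (grad (phi n)) <= lam + 1.
    by apply: le_trans (Ephi n) _; rewrite lerD2l invf_le1 ?ler1n.
  have [A1 UA1 HA1] := rellich L0 oO OL UU e10 tphi Nb Eb.
  exists (A1 `&` [set n | n.+1%:R^-1 <= e / 8]).
    apply: filterI => //; apply: ooU.
    have [K _ HK] := near_infty_natSinv_lt (PosNum e18).
    by exists K => // n /HK /ltW.
  split=> [k [_ /= /le_trans]|k l [Ak /= k8] [Al /= l8]].
    by apply; lra.
  have N1 := HA1 _ _ Ak Al; have N2 : e1 <= e.
    by rewrite ler_pdivrMr ?mulr_gt0// ler_peMr ?ltW//; lra.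
  split; first exact: le_trans N1 N2.
  apply: le_trans (Ecauchy k l) _.
  have N3 : lam * B0 (phi k \- phi l) (phi k \- phi l) <= e / 2.
    apply: le_trans (ler_wpM2l lam0 N1) _.
    by rewrite /e1 mulrA ler_pdivrMr ?mulr_gt0//; nra.
  have arith (a b c : R) : a <= e / 8 -> b <= e / 8 -> c <= e / 2 -> 2 * a + 2 * b + c <= e.
    by move=> *; lra.
  exact: arith.
have /choice[A_ HA] : forall j : nat, exists A : set nat, [/\ U A, (forall k, A k -> k.+1%:R^-1 <= 4^-1 ^+ j :> R) &
    forall k l, A k -> A l -> B0 (phi k \- phi l) (phi k \- phi l) <= 4^-1 ^+ j /\
    BV (grad (phi k) - grad (phi l)) (grad (phi k) - grad (phi l)) <= 4^-1 ^+ j].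
  move=> j; have [|A UA [HA1 HA2]] := cauchyU (4^-1 ^+ j); first by rewrite exprn_gt0.
  by exists A.
(* Choosing [n_ j] in the first [j.+1] sets at once puts [n_ j] and [n_ j.+1] together in [A_ j],
   which gives the rate [4^-1 ^+ j] that the completeness lemma asks for. *)
have /choice[n_ Hn] : forall j : nat, exists n, forall i : 'I_j.+1, A_ i n.
  move=> j; apply: (@filter_ex _ U _ [set n | forall i : 'I_j.+1, A_ i n]).
  by apply: filter_forall => i; case: (HA i).
have An i j : (i <= j)%N -> A_ i (n_ j).
  by move=> ij; have := Hn j (inord i); rewrite inordK// ltnS.
have sub j : B0 (phi (n_ j.+1) \- phi (n_ j)) (phi (n_ j.+1) \- phi (n_ j)) <= 4^-1 ^+ j /\
    BV (grad (phi (n_ j.+1)) - grad (phi (n_ j))) (grad (phi (n_ j.+1)) - grad (phi (n_ j)))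
      <= 4^-1 ^+ j.
  by have [_ _] := HA j; apply; exact: An.
have eval0 (a : 'I_1 -> R) (i : 'I_1) : a ord0 = a i by rewrite (ord1 i).
have sub1 j : L2vec_inner muE Omega (W := R^o) (fun (_ : 'I_1) x => x)
    (phi (n_ j.+1) \- phi (n_ j)) (phi (n_ j.+1) \- phi (n_ j)) <= 4^-1 ^+ j.
  by rewrite L2_inner1E; exact: (sub j).1.
have evalr (a : 'I_d -> R) (i : 'I_d) : (\row_i a i) ord0 i = a i by rewrite mxE.
have [u [Lu Hu]] := @L2vec_complete R _ _ muE Omega mO R^o 'I_1 (fun _ x => x)
  (fun a => a ord0) (fun j => phi (n_ j)) (@scalar_lin R) eval0
  (fun j _ => Lphi (n_ j)) sub1.
have {}Lu := Lu ord0.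
have [G [LG HG]] := @L2vec_complete R _ _ muE Omega mO 'rV[R]_d 'I_d (fun i v => v ord0 i)
  (fun a => \row_i a i) (fun j => grad (phi (n_ j))) (@coord_lin R d)
  evalr (fun j => Lgrad (n_ j)) (fun j => (sub j).2).
have {}Hu : B0 (fun x => phi (n_ j) x - u x) (fun x => phi (n_ j) x - u x) @[j --> \oo] --> 0.
  rewrite (_ : (fun j => _) = (fun j => L2vec_inner muE Omega (W := R^o)
    (fun (_ : 'I_1) x => x) ((phi (n_ j) : _ -> R^o) - u) ((phi (n_ j) : _ -> R^o) - u)))//.
  by apply/funext => j; rewrite L2_inner1E.
have cB v : L2 muE Omega v -> B0 v (phi (n_ j)) @[j --> \oo] --> B0 v u.
  move=> Lv; apply: (semi_inner_cvg SI (fun=> Lv) (fun j => Lphi (n_ j)) Lv Lu) Hu.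
  exact: self0 SI Lv.
have cV H : L2v Omega H -> BV H (grad (phi (n_ j))) @[j --> \oo] --> BV H G.
  move=> LH; apply: (semi_inner_cvg SV (fun=> LH) (fun j => Lgrad (n_ j)) LH LG) HG.
  exact: self0 SV LH.
have cN : B0 (phi (n_ j)) (phi (n_ j)) @[j --> \oo] --> B0 u u.
  exact: (semi_inner_cvg SI (fun j => Lphi (n_ j)) (fun j => Lphi (n_ j)) Lu Lu Hu Hu).
have cE : BV (grad (phi (n_ j))) (grad (phi (n_ j))) @[j --> \oo] --> BV G G.
  exact: (semi_inner_cvg SV (fun j => Lgrad (n_ j)) (fun j => Lgrad (n_ j)) LG LG HG HG).
have ccst (c : R) : (fun=> c) @ \oo --> c by exact: cvg_cst.
have Nu : B0 u u = 1 by apply: (cvg_eq_lim cN (ccst 1)) => j; exact: Nphi.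
have EG : BV G G = lam.
  apply/eqP; rewrite eq_le; apply/andP; split.
    have c4 : (fun j : nat => lam + 4^-1 ^+ j) @ \oo --> lam.
      rewrite -[X in _ --> X]addr0; apply: cvgD; first exact: cvg_cst.
      by apply: cvg_expr; rewrite ger0_norm// invf_lt1 ?ltr1n.
    apply: (cvg_le_lim cE c4) => j; apply: le_trans (Ephi _) _; rewrite lerD2l.
    by have [_ + _] := HA j; apply; exact: An.
  apply: (cvg_le_lim (ccst lam) cE) => j.
  by have := lamP _ (tphi (n_ j)); rewrite Nphi mulr1.
have hH10 : H10 Omega u G.
  split; last first.
    exists (fun j => phi (n_ j)); split => //.
    - by apply/(L2_cvgP mO (fun j => Lphi (n_ j)) Lu).
    - by apply/(L2v_cvgP mO (fun j => Lgrad (n_ j)) LG).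
  split => // v tv i.
  have Lgi n j : L2 muE Omega (fun x => grad (phi n) x ord0 j) by exact: Lgrad.
  have cGi : B0 (fun x => grad (phi (n_ j)) x ord0 i - G x ord0 i)
      (fun x => grad (phi (n_ j)) x ord0 i - G x ord0 i) @[j --> \oo] --> 0.
    apply: (squeeze_cvgr (f := cst 0) (h := fun j => BV (grad (phi (n_ j)) - G) (grad (phi (n_ j)) - G))).
    - apply: nearW => j; apply/andP; split.
        exact: (semi_inner_ge0 SI (semi_innerSB SI (Lgi (n_ j) i) (LG i))).
      have := L2v_coord_le i (semi_innerSB SV (Lgrad (n_ j)) LG).
      apply: le_trans; rewrite le_eqVlt; apply/orP; left; apply/eqP.
      by apply: eq_Rintegral => x _; rewrite !mxE.
    - exact: cvg_cst.
    - exact: HG.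
  have c1 := cB _ (Lg _ tv i).
  have c2 : - B0 v (fun x => grad (phi (n_ j)) x ord0 i) @[j --> \oo] --> - B0 v (fun x => G x ord0 i).
    apply: cvgN; apply: (semi_inner_cvg SI (fun=> Lt _ tv) (fun j => Lgi (n_ j) i) (Lt _ tv) (LG i)) cGi.
    exact: self0 SI (Lt _ tv).
  rewrite -[LHS]/(B0 u (fun x => grad v x ord0 i)) -[X in - X]/(B0 (fun x => G x ord0 i) v).
  rewrite (semi_innerC SI Lu (Lg _ tv i)) (semi_innerC SI (LG i) (Lt _ tv)).
  apply: (cvg_eq_lim c1 c2) => j.
  rewrite (semi_innerC SI (Lg _ tv i) (Lphi _)) (semi_innerC SI (Lt _ tv) (Lgi _ _)).
  by have [_ _ H] := test_H1 L0 oO OL (tphi (n_ j)); exact: H.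
exists lam; split; last exact: lamP.
exists u, G; split => //; first by rewrite L2sqE// -/(B0 u u) Nu.
have test_eq v : test_function Omega v -> BV G (grad v) = lam * B0 u v.
  move=> tv; have Lv := Lt _ tv; have Lgv := Lg _ tv.
  rewrite (semi_innerC SV LG Lgv) (semi_innerC SI Lu Lv).
  apply/eqP; rewrite -subr_eq0; apply/eqP.
  (* The Rayleigh inequality for [t * v + phi (n_ j)] passes to the limit, where the constant terms
     are both [lam] and cancel. *)
  apply: (@quadratic_ge0_eq0 _ (BV (grad v) (grad v) - lam * B0 v v)) => t.
  have c1 : lam * (t ^+ 2 * B0 v v + 2 * t * B0 v (phi (n_ j)) + B0 (phi (n_ j)) (phi (n_ j)))
      @[j --> \oo] --> lam * (t ^+ 2 * B0 v v + 2 * t * B0 v u + 1).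
    apply: cvgM; first exact: cvg_cst.
    apply: cvgD; last by rewrite -Nu.
    by apply: cvgD; [exact: cvg_cst|apply: cvgM; [exact: cvg_cst|exact: cB]].
  have c2 : t ^+ 2 * BV (grad v) (grad v) + 2 * t * BV (grad v) (grad (phi (n_ j))) +
       BV (grad (phi (n_ j))) (grad (phi (n_ j)))
      @[j --> \oo] --> t ^+ 2 * BV (grad v) (grad v) + 2 * t * BV (grad v) G + lam.
    apply: cvgD; last by rewrite -EG.
    by apply: cvgD; [exact: cvg_cst|apply: cvgM; [exact: cvg_cst|exact: cV]].
  have c3 := cvg_le_lim c1 c2.
  rewrite -subr_ge0 in c3.
  have arith (a b c e : R) : 0 <= t ^+ 2 * a + 2 * t * b + lam - lam * (t ^+ 2 * c + 2 * t * e + 1) ->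
      0 <= t ^+ 2 * (a - lam * c) + 2 * t * (b - lam * e).
    by move=> /le_trans; apply; rewrite le_eqVlt; apply/orP; left; apply/eqP; ring.
  apply: arith; apply: c3 => j.
  rewrite -(semi_inner_sqrD SI _ Lv (Lphi _)) -(semi_inner_sqrD SV _ Lgv (Lgrad _)).
  have := lamP _ (test_lin t tv (tphi (n_ j))).
  rewrite (_ : grad (fun x => t * v x + phi (n_ j) x) = t *: grad v + grad (phi (n_ j)))//.
  apply/funext => x; rewrite grad_lin//; [exact: test_smooth tv|exact: test_smooth (tphi _)].
move=> v H hv; have [psi [tpsi Hv HH]] := H10_approx hv.
have [[Lv LH _] _] := hv.
have c1 : BV G (grad (psi n)) @[n --> \oo] --> BV G H.
  apply: (semi_inner_cvg SV (fun=> LG) (fun n => Lg _ (tpsi n)) LG LH) HH.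
  exact: self0 SV LG.
have c2 : lam * B0 u (psi n) @[n --> \oo] --> lam * B0 u v.
  apply: cvgM; first exact: cvg_cst.
  apply: (semi_inner_cvg SI (fun=> Lu) (fun n => Lt _ (tpsi n)) Lu Lv) Hv.
  exact: self0 SI Lu.
by apply: (cvg_eq_lim c1 c2) => n; exact: test_eq.
Qed.

End first_eigenvalue.

Section weak_limit.
Context (R : realType) (V : lmodType R) (S : set V) (B : V -> V -> R).
Hypothesis SB : semi_inner S B.

(** For a bounded sequence weak convergence may be tested on approximants: replacing [psi] by
    [psi_ n] costs at most the norm of [psi_ n - psi] times [Num.sqrt M], uniformly in [k], once for
    [g_ k] and once for [g]. *)
Lemma semi_inner_weak_lim (psi_ g_ : nat -> V) (psi g : V) (l M : R) :
  (forall n, S (psi_ n)) -> S psi -> (forall k, S (g_ k)) -> S g ->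
  B (psi_ n - psi) (psi_ n - psi) @[n --> \oo] --> 0 ->
  (forall k, B (g_ k) (g_ k) <= M) -> B g g <= M ->
  (forall n, B (psi_ n) (g_ k) @[k --> \oo] --> B (psi_ n) g) ->
  B psi (g_ k) @[k --> \oo] --> l -> B psi g = l.
Proof.
move=> Spsi_ Spsi Sg_ Sg dpsi gM gM' wk cl.
have Sd n : S (psi_ n - psi) by exact: (semi_innerSB SB).
have CS n h : S h -> B h h <= M ->
    `|B (psi_ n - psi) h| <= Num.sqrt (B (psi_ n - psi) (psi_ n - psi)) * Num.sqrt M.
  move=> Sh hM; apply: le_trans (semi_inner_CS_sqrt SB (Sd n) Sh) _.
  by apply: ler_wpM2l; [exact: sqrtr_ge0|exact: ler_wsqrtr].
have bound n : `|B psi g - l| <= 2 * (Num.sqrt (B (psi_ n - psi) (psi_ n - psi)) * Num.sqrt M).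
  have c1 : `|B psi g - B psi (g_ k)| @[k --> \oo] --> `|B psi g - l|.
    by apply: cvg_norm; apply: cvgB; [exact: cvg_cst|exact: cl].
  have c2 : 2 * (Num.sqrt (B (psi_ n - psi) (psi_ n - psi)) * Num.sqrt M) +
      `|B (psi_ n) g - B (psi_ n) (g_ k)| @[k --> \oo] -->
      2 * (Num.sqrt (B (psi_ n - psi) (psi_ n - psi)) * Num.sqrt M) + `|B (psi_ n) g - B (psi_ n) g|.
    apply: cvgD; first exact: cvg_cst.
    by apply: cvg_norm; apply: cvgB; [exact: cvg_cst|exact: wk].
  rewrite subrr normr0 addr0 in c2; apply: (cvg_le_lim c1 c2) => k.
  have -> : B psi g - B psi (g_ k) = B (psi_ n - psi) (g_ k) - B (psi_ n - psi) g +
      (B (psi_ n) g - B (psi_ n) (g_ k)).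
    by rewrite !(semi_innerB SB)//; ring.
  apply: le_trans (ler_normD _ _) _; rewrite lerD2r.
  apply: le_trans (ler_normB _ _) _; rewrite mulr_natl mulr2n.
  by apply: lerD; exact: CS.
apply/eqP; rewrite -subr_eq0 -normr_le0.
have c0 : 2 * (Num.sqrt (B (psi_ n - psi) (psi_ n - psi)) * Num.sqrt M) @[n --> \oo] -->
    2 * (0 * Num.sqrt M).
  apply: cvgM; first exact: cvg_cst.
  apply: cvgM; last exact: cvg_cst.
  by rewrite -sqrtr0; apply: continuous_cvg => //; exact: sqrt_continuous.
rewrite mul0r mulr0 in c0.
have ccst : (fun _ : nat => `|B psi g - l|) @ \oo --> `|B psi g - l| by exact: cvg_cst.
exact: (cvg_le_lim ccst c0).
Qed.

End weak_limit.

(** * Friedrichs and Green for smooth functions that vanish on the boundary *)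

Section dirichlet.
Context (R : realType) (d : nat) (Omega : set 'rV[R]_d) (L : R).
Hypotheses (L0 : 0 < L) (oO : open Omega).
Hypothesis (OL : forall x, Omega x -> forall i, `|x ord0 i| < L).
Local Notation muE := (lebesgue_rV R d).
Let mO := domain_measurable oO.
Let B0 (f g : 'rV[R]_d -> R^o) := \int[muE]_(x in Omega) (f x * g x).
Let BV (G H : 'rV[R]_d -> 'rV[R]_d) := \int[muE]_(x in Omega) dot (G x) (H x).
Let SI : semi_inner (L2 muE Omega : set ('rV[R]_d -> R^o)) B0 := L2_semi_inner muE mO.
Let SV : semi_inner (L2v Omega : set ('rV[R]_d -> 'rV[R]_d)) BV := L2v_semi_inner mO.

Lemma crude_friedrichs (phi : 'rV[R]_d -> R) : (0 < d)%N -> test_function Omega phi ->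
  (L + L) ^- 2 * B0 phi phi <= BV (grad phi) (grad phi).
Proof.
move=> d0 tphi; have sphi := test_smooth tphi.
rewrite [X in _ * X](_ : _ = \int[muE]_(x in box L) (phi x ^+ 2)); last first.
  by rewrite /B0 (Rintegral_domain_box OL)// => x Ox; rewrite (test_out tphi Ox) mul0r.
rewrite [leRHS](dot_gradE oO OL sphi) ler_pdivrMl ?exprn_gt0 ?addr_gt0//.
have ED i : \int[muE]_(x in Omega) ('D_(delta_mx ord0 i) phi x ^+ 2) =
    \int[muE]_(x in box L) ('D_(delta_mx ord0 i) phi x ^+ 2).
  rewrite (Rintegral_domain_box OL)// => x Ox.
  by rewrite (test_out (test_derive _ tphi) Ox) expr0n.
under eq_bigr do rewrite ED.
have C1 := smooth_C1 sphi; have phi0 := test_box0 OL tphi.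
clear - L0 d0 C1 phi0; move: phi C1 phi0; case: d d0 => // n _ phi C1 phi0.
apply: le_trans (box_friedrichs L0 C1 phi0) _.
rewrite ler_pM2l ?exprn_gt0 ?addr_gt0//.
rewrite (bigD1 ord_max)//= lerDl; apply: sumr_ge0 => i _.
by apply: Rintegral_ge0 => x _; exact: sqr_ge0.
Qed.

(** The crude Friedrichs inequality for the eigenfunction of [lam1] gives positivity. Some test
    function near that eigenfunction is nonzero and starts the minimization; the infimum so obtained
    is an eigenvalue, and minimality bounds it below by [lam1]. *)
Lemma dirichlet_poincare (lam1 : R) : (0 < d)%N -> min_dirichlet_eigenvalue Omega lam1 ->
  0 < lam1 /\ forall phi, test_function Omega phi ->
     lam1 * B0 phi phi <= BV (grad phi) (grad phi).
Proof.
move=> d0 [[u [G [hu Nu eig]]] lam_min].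
have [[Lu LG _] _] := hu.
rewrite (L2sqE mO Lu) lte_fin -/(B0 u u) in Nu.
have EG : BV G G = lam1 * B0 u u by exact: eig.
split.
  have := poincare_H10 oO OL (fun phi => crude_friedrichs d0) hu.
  rewrite -/(B0 u u) -/(BV G G) EG ler_pM2r//; apply: lt_le_trans.
  by rewrite invr_gt0 exprn_gt0// addr_gt0.
have [phi [tphi Hu _]] := H10_approx oO OL hu.
have Lt psi : test_function Omega psi -> L2 muE Omega psi.
  by move=> tpsi; apply: (continuous_L2 oO OL); exact/smooth_continuous/test_smooth/tpsi.
have [n Nn] : exists n, 0 < B0 (phi n) (phi n).
  apply: contrapT => /forallNP Nn.
  have c1 : B0 (phi n) (phi n) @[n --> \oo] --> B0 u u.
    exact: (semi_inner_cvg SI (fun n => Lt _ (tphi n)) (fun n => Lt _ (tphi n)) Lu Lu Hu Hu).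
  have c0 : (fun _ : nat => 0 : R) @ \oo --> 0 by exact: cvg_cst.
  have := cvg_le_lim c1 c0 _; rewrite leNgt Nu => /(_ _)/negP; apply => // k.
  by rewrite leNgt; apply/negP; exact: Nn.
have [lam [elam Hlam]] := rayleigh_minimizer L0 oO OL (tphi n) Nn.
move=> psi tpsi; apply: le_trans (Hlam _ tpsi).
by apply: ler_wpM2r; [exact: (semi_inner_ge0 SI (Lt _ tpsi))|exact: lam_min].
Qed.

Section truncation.
Context (u : 'rV[R]_d -> R) (su : smooth u).
Hypothesis (u0 : forall x, topological_boundary Omega x -> u x = 0).
Context (G g : R -> R) (sG : smooth G) (dG : forall x : R, is_derive x (1 : R) G (g x)).
Hypotheses (g01 : forall x, 0 <= g x <= 1) (G0 : forall x, `|x| <= 1 -> G x = 0).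
Hypothesis (GS : forall x, `|G x - x| <= 2).

(** The zero is imposed outside [Omega] because [u] is arbitrary outside the closure; near the
    boundary [u] is small and [G] already gives zero. *)
Definition truncate (e : R) (x : 'rV[R]_d) : R := if x \in Omega then e * G (e^-1 * u x) else 0.

Lemma out_domain x : ~ Omega x -> closure Omega x -> u x = 0.
Proof. by move=> Ox cO; apply: u0; split => // /interior_subset. Qed.

Lemma closure_domain_compact (K : set 'rV[R]_d) : closed K -> K `<=` closure Omega -> compact K.
Proof.
move=> cK KO; pose Q := [set v : 'rV[R]_d | forall i, `[- L, L]%classic (v ord0 i)].
have cQ : compact Q by apply: (@rV_compact _ _ (fun=> `[- L, L]%classic)) => i; exact: segment_compact.
apply: (subclosed_compact cK cQ) => x /KO.
have : closed Q by apply: compact_closed cQ; exact: norm_hausdorff.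
rewrite closure_id => ->; apply: closure_subset => y Oy i /=.
by rewrite in_itv/= -ler_norml ltW// OL.
Qed.

Lemma truncate_test e : 0 < e -> test_function Omega (truncate e).
Proof.
move=> e0; have cu := smooth_continuous su.
have sw : smooth (fun x => e * G (e^-1 * u x)).
  by apply: smoothZ; apply: smooth_comp => //; exact: smoothZ.
have Gsmall x : `|u x| <= e -> G (e^-1 * u x) = 0.
  move=> ux; apply: G0; rewrite normrM gtr0_norm ?invr_gt0//.
  by rewrite mulrC ler_pdivrMr// mul1r.
split.
  apply: smooth_locally => x; have [Ox|Ox] := pselect (Omega x).
    exists (fun x => e * G (e^-1 * u x)) => //.
    have : \forall y \near x, Omega y by exact: open_nbhs_nbhs.
    by apply: filterS => y Oy; rewrite /truncate mem_set.
  exists (cst 0); first exact: smooth_cst.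
  have [cO|cO] := pselect (closure Omega x); last first.
    have : \forall y \near x, (~` closure Omega) y.
      apply: open_nbhs_nbhs; split => //; apply: closed_openC; exact: closed_closure.
    apply: filterS => y cy; rewrite /truncate ifF//; apply/negP => /set_mem Oy.
    by apply: cy; exact: subset_closure.
  (* At a boundary point [u] vanishes, so [|u| < e] nearby and the truncation is zero on a whole
     neighbourhood. *)
  have : \forall y \near x, `|u x - u y| < e by have /cvgrPdist_lt := cu x; apply.
  apply: filterS => y; rewrite (out_domain Ox cO) sub0r normrN => /ltW uy.
  by rewrite /truncate; case: ifP => // _; rewrite Gsmall// mulr0.
(* This closed set avoids the boundary, where [u] vanishes, so it lies inside [Omega]. *)
exists (closure Omega `&` [set x | e <= `|u x|]); split.
- apply: closure_domain_compact; last by move=> x [].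
  apply: closedI; first exact: closed_closure.
  apply: (@closed_comp _ _ (fun x => `|u x|) [set y | e <= y]); last exact: closed_ge.
  by move=> x _; exact: (cvg_norm (cu x)).
- move=> x [cO /= ex]; apply: contrapT => Ox.
  by move: ex; rewrite (out_domain Ox cO) normr0 leNgt e0.
- move=> x /not_andP Kx; rewrite /truncate; case: ifPn => // /set_mem Ox.
  rewrite Gsmall ?mulr0//; case: Kx => [cO|/negP]; first by case: cO; exact: subset_closure.
  by rewrite -ltNge => /ltW.
Qed.

Lemma truncate_dist e x : 0 < e -> Omega x -> `|truncate e x - u x| <= 2 * e.
Proof.
move=> e0 Ox; rewrite /truncate mem_set//.
have -> : e * G (e^-1 * u x) - u x = e * (G (e^-1 * u x) - e^-1 * u x).
  by rewrite mulrBr mulrA divff ?mul1r// gt_eqF.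
by rewrite normrM gtr0_norm// mulrC ler_pM2r.
Qed.

Lemma truncate_grad e x : 0 < e -> Omega x -> grad (truncate e) x = g (e^-1 * u x) *: grad u x.
Proof.
move=> e0 Ox; apply/rowP => i; rewrite !mxE.
have : \forall y \near x, truncate e y = e * G (e^-1 * u y).
  have : \forall y \near x, Omega y by exact: open_nbhs_nbhs.
  by apply: filterS => y Oy; rewrite /truncate mem_set.
move/near_eq_derive => ->.
have seu : smooth (fun x => e^-1 * u x) by exact: smoothZ.
have sGeu : smooth (fun x => G (e^-1 * u x)) by exact: smooth_comp.
rewrite deriveZ; last exact: smooth_derivable.
rewrite derive_comp_1d; [|exact: smooth_differentiable|exact: smooth_differentiable].
rewrite deriveZ; last exact: smooth_derivable.
have /@derive_val -> := dG (e^-1 * u x).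
rewrite /GRing.scale/=; move: (g _) ('D_ _ u x) => a b.
by field; rewrite gt_eqF.
Qed.

Lemma truncate_energy e : 0 < e ->
  BV (grad (truncate e)) (grad (truncate e)) <= BV (grad u) (grad u).
Proof.
move=> e0; have st := test_smooth (truncate_test e0).
apply: le_Rintegral => //.
- by apply: L2v_integrable => //; exact: (smooth_grad_L2v oO OL).
- by apply: L2v_integrable => //; exact: (smooth_grad_L2v oO OL).
- move=> x Ox; rewrite truncate_grad// /dot; apply: ler_sum => i _.
  rewrite !mxE mulrACA -[leRHS]mul1r; apply: ler_wpM2r; first by rewrite -expr2 sqr_ge0.
  by have /andP[g0 g1] := g01 (e^-1 * u x); rewrite mulr_ile1.
Qed.

Lemma truncate_cvg :
  B0 (fun x => truncate k.+1%:R^-1 x - u x) (fun x => truncate k.+1%:R^-1 x - u x)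
    @[k --> \oo] --> 0.
Proof.
pose C := fine (muE Omega).
have C0 : 0 <= C by exact: fine_ge0.
apply: (squeeze_cvgr (f := cst 0) (h := fun k => (2 * k.+1%:R^-1) ^+ 2 * C)).
- apply: nearW => k; have k0 : 0 < k.+1%:R^-1 :> R by rewrite invr_gt0.
  have st := test_smooth (truncate_test k0).
  have cdif : continuous (fun x => truncate k.+1%:R^-1 x - u x).
    by apply: smooth_continuous; exact: smoothB.
  apply/andP; split; first by apply: Rintegral_ge0 => x _; rewrite -expr2 sqr_ge0.
  apply: le_trans (ler_norm _) _; apply: Rintegral_le_bound => //.
  + exact: domain_fin OL.
  + by apply: measurable_funM; exact: continuous_measurable_rV.
  + move=> x Ox; rewrite normrM -expr2; have := truncate_dist k0 Ox.
    by move=> H; rewrite lerXn2r// nnegrE (le_trans _ H).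
- exact: cvg_cst.
- have -> : 0 = (2 * 0) ^+ 2 * C :> R by rewrite mulr0 expr0n mul0r.
  apply: cvgM; last exact: cvg_cst.
  apply: (@continuous_cvg _ _ _ _ _ _ (fun y : R => y ^+ 2)); first exact: exprn_continuous.
  apply: cvgM; first exact: cvg_cst.
  exact: cvg_harmonic.
Qed.

Lemma truncate_friedrichs (lam : R) :
  (forall phi, test_function Omega phi -> lam * B0 phi phi <= BV (grad phi) (grad phi)) ->
  lam * B0 u u <= BV (grad u) (grad u).
Proof.
move=> H; have k0 k : 0 < k.+1%:R^-1 :> R by rewrite invr_gt0.
have Lu : L2 muE Omega u by apply: (continuous_L2 oO OL); exact: smooth_continuous.
have Lt k : L2 muE Omega (truncate k.+1%:R^-1).
  by apply: (continuous_L2 oO OL); exact/smooth_continuous/test_smooth/truncate_test.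
have c1 : lam * B0 (truncate k.+1%:R^-1) (truncate k.+1%:R^-1) @[k --> \oo] --> lam * B0 u u.
  apply: cvgM; first exact: cvg_cst.
  exact: (semi_inner_cvg SI Lt Lt Lu Lu truncate_cvg truncate_cvg).
have c2 : (fun _ : nat => BV (grad u) (grad u)) @ \oo --> BV (grad u) (grad u) by exact: cvg_cst.
apply: (cvg_le_lim c1 c2) => k.
exact: le_trans (H _ (truncate_test (k0 k))) (truncate_energy (k0 k)).
Qed.

Lemma smooth_green (phi v : 'rV[R]_d -> R) : test_function Omega phi -> smooth v ->
  BV (grad phi) (grad v) =
  - B0 (fun x => \sum_(i < d) 'D_(delta_mx ord0 i) ('D_(delta_mx ord0 i) phi) x) v.
Proof.
move=> tphi sv; rewrite /BV /B0 /dot.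
have L2s w : smooth w -> L2 muE Omega w.
  by move=> sw; apply: (continuous_L2 oO OL); exact: smooth_continuous.
have sphi := test_smooth tphi.
under eq_Rintegral do under eq_bigr do rewrite !mxE.
rewrite Rintegral_sum//; last first.
  by move=> i; apply: L2_integrableM => //; apply: L2s; exact: smooth_derive.
transitivity (\sum_(i < d) - \int[muE]_(x in Omega)
    ('D_(delta_mx ord0 i) ('D_(delta_mx ord0 i) phi) x * v x)).
  apply: eq_bigr => i _.
  have := smooth_ibp L0 oO OL i (test_derive (delta_mx ord0 i) tphi) sv.
  move=> /(congr1 -%R); rewrite opprK => E.
  transitivity (\int[muE]_(x in Omega) ('D_(delta_mx ord0 i) v x * 'D_(delta_mx ord0 i) phi x)).
    by apply: eq_Rintegral => x _; rewrite mulrC.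
  by rewrite -E; congr (- _); apply: eq_Rintegral => x _; rewrite mulrC.
rewrite sumrN -Rintegral_sum//.
  by congr (- _); apply: eq_Rintegral => x _; rewrite mulr_suml.
move=> i; apply: L2_integrableM => //; apply: L2s => //.
by apply: smooth_derive; exact: smooth_derive.
Qed.

(* [grad (truncate e)] need not converge to [grad u] where [u] vanishes, but it is bounded
   and converges when tested against gradients of test functions. *)
Lemma truncate_green (psi l : 'rV[R]_d -> R) (gpsi : 'rV[R]_d -> 'rV[R]_d) :
  H10 Omega psi gpsi -> L2_divergence Omega gpsi l ->
  BV gpsi (grad u) = - B0 l u.
Proof.
move=> hpsi [Ll hl]; have k0 k : 0 < k.+1%:R^-1 :> R by rewrite invr_gt0.
have L2s w : smooth w -> L2 muE Omega w.
  by move=> sw; apply: (continuous_L2 oO OL); exact: smooth_continuous.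
have [[_ Lg _] _] := hpsi.
have st k : smooth (truncate k.+1%:R^-1) by exact/test_smooth/truncate_test.
have [phi [tphi _ Hphi]] := H10_approx oO OL hpsi.
have cB v : L2 muE Omega v -> B0 v (truncate k.+1%:R^-1) @[k --> \oo] --> B0 v u.
  move=> Lv; apply: (semi_inner_cvg SI (fun=> Lv) (fun k => L2s _ (st k)) Lv (L2s _ su)) truncate_cvg.
  exact: self0 SI Lv.
apply: (@semi_inner_weak_lim _ _ _ BV SV (fun n => grad (phi n))
   (fun k => grad (truncate k.+1%:R^-1)) _ _ _ (BV (grad u) (grad u))) Hphi _ _ _ _.
- by move=> n; apply: (smooth_grad_L2v oO OL); exact/test_smooth/tphi.
- exact: Lg.
- by move=> k; exact: (smooth_grad_L2v oO OL).
- exact: (smooth_grad_L2v oO OL).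
- by move=> k; exact: truncate_energy.
- exact: lexx.
- move=> n; rewrite (smooth_green (tphi n) su).
  under eq_fun do rewrite (smooth_green (tphi n) (st _)).
  apply: cvgN; apply: cB.
  apply: L2_sum => // i; apply: L2s; apply: smooth_derive.
  exact/smooth_derive/test_smooth/tphi.
- rewrite (_ : (fun k => _) = (fun k => - B0 l (truncate k.+1%:R^-1))); first exact: cvgN (cB _ Ll).
  by apply/funext => k; rewrite /BV hl//; exact: truncate_test.
Qed.

End truncation.

Lemma friedrichs_smooth0 (lam : R) (u : 'rV[R]_d -> R) :
  (forall phi, test_function Omega phi -> lam * B0 phi phi <= BV (grad phi) (grad phi)) ->
  smooth u -> (forall x, topological_boundary Omega x -> u x = 0) ->
  lam * B0 u u <= BV (grad u) (grad u).
Proof.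
move=> H su u0; have [G [g [sG dG g01 G0 GS]]] := smooth_truncation R.
exact: (truncate_friedrichs su u0 sG dG g01 G0 GS).
Qed.

Lemma green_smooth0 (psi l u : 'rV[R]_d -> R) (gpsi : 'rV[R]_d -> 'rV[R]_d) :
  H10 Omega psi gpsi -> L2_divergence Omega gpsi l ->
  smooth u -> (forall x, topological_boundary Omega x -> u x = 0) ->
  BV gpsi (grad u) = - B0 l u.
Proof.
move=> hpsi hl su u0; have [G [g [sG dG g01 G0 GS]]] := smooth_truncation R.
exact: (truncate_green su u0 sG dG g01 G0 GS hpsi hl).
Qed.

End dirichlet.

(** * The cylinder *)

Section tensor.
Context (R : realType) d1 d2 (T1 : measurableType d1) (T2 : measurableType d2).
Context (m1 : {sigma_finite_measure set T1 -> \bar R}).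
Context (m2 : {sigma_finite_measure set T2 -> \bar R}).
Context (A : set T1) (B : set T2) (mA : measurable A) (mB : measurable B).

Lemma tensor_inner (f g : T1 -> R) (b c : T2 -> R) :
  L2 m1 A f -> L2 m1 A g -> L2 m2 B b -> L2 m2 B c ->
  \int[(m1 \x m2)%E]_(z in A `*` B) ((f z.1 * b z.2) * (g z.1 * c z.2)) =
  (\int[m1]_(x in A) (f x * g x)) * \int[m2]_(t in B) (b t * c t).
Proof.
move=> Lf Lg Lb Lc.
have Lfb := L2_prod mA mB Lf Lb; have Lgc := L2_prod mA mB Lg Lc.
have mAB : measurable (A `*` B) by exact: measurableX.
have ibc := L2_integrableM mB Lb Lc; have ifg := L2_integrableM mA Lf Lg.
rewrite /Rintegral fubini_rectangle1//; last exact: L2_integrableM.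
transitivity (fine (\int[m1]_(x in A) ((\int[m2]_(t in B) (b t * c t)) * (f x * g x))%:E)%E).
  congr fine; apply: eq_integral => x _ /=.
  transitivity (\int[m2]_(t in B) ((f x * g x) * (b t * c t))%:E)%E.
    by apply: eq_integral => t _; congr (_%:E); ring.
  have -> : (\int[m2]_(t in B) ((f x * g x) * (b t * c t))%:E)%E =
     (\int[m2]_(t in B) ((f x * g x) * (b t * c t)))%:E.
    rewrite /Rintegral fineK//; apply: integrable_fin_num => //.
    exact: (integrableZl mB _ ibc).
  by rewrite RintegralZl// mulrC.
by rewrite -[LHS]/(\int[m1]_(x in A) _) RintegralZl// mulrC.
Qed.

Lemma L2_le d (T : measurableType d) (m : {measure set T -> \bar R}) (D : set T)
    (f g : T -> R) : measurable D -> measurable_fun D f ->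
  (forall x, D x -> `|f x| <= `|g x|) -> L2 m D g -> L2 m D f.
Proof.
move=> mD mf fg [mg g2]; split => //; apply: le_lt_trans g2.
apply: ge0_le_integral => //.
- by move=> x _; rewrite lee_fin sqr_ge0.
- by apply/measurable_EFinP; exact: measurable_funX.
- by apply/measurable_EFinP; exact: measurable_funX.
- move=> x Dx; rewrite lee_fin -[leLHS]ger0_norm ?sqr_ge0// -[leRHS]ger0_norm ?sqr_ge0//.
  by rewrite !normrX lerXn2r ?nnegrE ?normr_ge0// fg.
Qed.

(** [f_ n b_ n - f b] is the sum of [(f_ n - f) b_ n] and [f (b_ n - b)], and the norm of a tensor
    is the product of the norms. *)
Lemma tensor_cvg (f_ : nat -> T1 -> R) (f : T1 -> R) (b_ : nat -> T2 -> R) (b : T2 -> R) :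
  (forall n, L2 m1 A (f_ n)) -> L2 m1 A f -> (forall n, L2 m2 B (b_ n)) -> L2 m2 B b ->
  \int[m1]_(x in A) ((f_ n x - f x) * (f_ n x - f x)) @[n --> \oo] --> 0 ->
  \int[m2]_(t in B) ((b_ n t - b t) * (b_ n t - b t)) @[n --> \oo] --> 0 ->
  \int[(m1 \x m2)%E]_(z in A `*` B)
    ((f_ n z.1 * b_ n z.2 - f z.1 * b z.2) * (f_ n z.1 * b_ n z.2 - f z.1 * b z.2))
    @[n --> \oo] --> 0.
Proof.
move=> Lf_ Lf Lb_ Lb cf cb.
have mAB : measurable (A `*` B) by exact: measurableX.
have S1 := L2_semi_inner m1 mA; have S2 := L2_semi_inner m2 mB.
have S3 := L2_semi_inner (m1 \x m2)%E mAB.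
have Ldf n : L2 m1 A (fun x => f_ n x - f x) by exact: L2_sub.
have Ldb n : L2 m2 B (fun t => b_ n t - b t) by exact: L2_sub.
have cbb : \int[m2]_(t in B) (b_ n t * b_ n t) @[n --> \oo] --> \int[m2]_(t in B) (b t * b t).
  exact: (semi_inner_cvg S2 Lb_ Lb_ Lb Lb cb cb).
apply: (squeeze_cvgr (f := cst 0) (h := fun n =>
  2 * ((\int[m1]_(x in A) ((f_ n x - f x) * (f_ n x - f x))) * \int[m2]_(t in B) (b_ n t * b_ n t)) +
  2 * ((\int[m1]_(x in A) (f x * f x)) * \int[m2]_(t in B) ((b_ n t - b t) * (b_ n t - b t))))).
- apply: nearW => n; apply/andP; split.
    by apply: Rintegral_ge0 => z _; rewrite -expr2 sqr_ge0.
  have Lu := L2_prod mA mB (Ldf n) (Lb_ n); have Lv := L2_prod mA mB Lf (Ldb n).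
  have Lv' := semi_innerSZ S3 (-1) Lv.
  rewrite -(tensor_inner (Ldf n) (Ldf n) (Lb_ n) (Lb_ n)) -(tensor_inner Lf Lf (Ldb n) (Ldb n)).
  have := semi_inner_sub_le S3 Lu Lv'.
  rewrite (semi_innerZ S3 (-1) Lv Lv') (semi_innerZr S3 (-1) Lv Lv) mulrA mulrNN !mul1r.
  apply: le_trans; rewrite le_eqVlt; apply/orP; left; apply/eqP.
  apply: eq_Rintegral => z _; rewrite /GRing.scale/= !fctE /GRing.scale/= /GRing.scale/=.
  by congr (_ * _); ring.
- exact: cvg_cst.
- have -> : 0 = 2 * (0 * \int[m2]_(t in B) (b t * b t)) + 2 * ((\int[m1]_(x in A) (f x * f x)) * 0) :> R.
    by rewrite mul0r !mulr0 addr0.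
  apply: cvgD; (apply: cvgM; first exact: cvg_cst).
    exact: cvgM.
  by apply: cvgM; first exact: cvg_cst.
Qed.

End tensor.

(** * Integrals over the half-line in t *)

Section half_line.
Context (R : realType).
Local Notation leb := (@lebesgue_measure R).
(** Written as in [cylinder], so that [cylinder Omega] is a rectangle by conversion. *)
Definition half_line : set (measurableTypeR R) := [set t : R | 0 < t].

Lemma half_lineE : half_line = `]0, +oo[%classic.
Proof. by apply/seteqP; split => t; rewrite /half_line/= in_itv/= andbT. Qed.

Lemma measurable_half_line : measurable half_line.
Proof. by rewrite half_lineE. Qed.

(** The upper end is [T + 1] because [f] may be nonzero at [T] and the interval is half-open. *)
Lemma half_line_compact_support (f : R -> R) (T : R) : 0 <= T ->
  continuous f -> (forall t, T < t -> f t = 0) ->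
  leb.-integrable half_line (EFin \o f) /\
  \int[leb]_(t in half_line) f t = \int[leb]_(t in `[0, T + 1[) f t.
Proof.
move=> T0 cf fT.
have iT : leb.-integrable `[0, T + 1[ (EFin \o f) by exact: continuous_itv_integrable.
have mI : measurable (`[0, T + 1[%classic : set (measurableTypeR R)) by [].
have mC : measurable (`[0, +oo[%classic : set (measurableTypeR R)) by [].
have E : f \_ `[0, +oo[ = f \_ `[0, T + 1[.
  apply/funext => t; rewrite /patch; have [tI|tI] := boolP (t \in `[0, T + 1[%classic).
    rewrite mem_set//; move/set_mem : tI; rewrite /= !in_itv/= andbT.
    by move=> /andP[].
  case: ifPn => // /set_mem; rewrite /= in_itv/= andbT => t0; rewrite fT//.
  rewrite ltNge; apply/negP => tT; move/negP : tI; apply; apply/mem_set.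
  by rewrite /= in_itv/= t0 (le_lt_trans tT)// ltrDl.
have iC : leb.-integrable `[0, +oo[ (EFin \o f).
  apply/(integrable_mkcond _ mC); rewrite restrict_EFin E -restrict_EFin.
  exact/(integrable_mkcond _ mI).
have iH : leb.-integrable `]0, +oo[ (EFin \o f).
  by apply: (integrableS mC _ _ iC) => // t; rewrite /= !in_itv/= !andbT => /ltW.
split; first by rewrite half_lineE.
by rewrite half_lineE Rintegral_itv_obnd_cbnd// Rintegral_mkcond E -Rintegral_mkcond.
Qed.

Lemma half_line_FTC (F f : R -> R) (T : R) : 0 <= T ->
  (forall t : R, is_derive t (1 : R) F (f t)) -> continuous f ->
  (forall t, T <= t -> F t = 0) ->
  leb.-integrable half_line (EFin \o f) /\ \int[leb]_(t in half_line) f t = - F 0.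
Proof.
move=> T0 dF cf FT.
have fT t : T < t -> f t = 0.
  move=> Tt; have /@derive_val <- := dF t.
  have nr : \forall s \near t, cst 0 s = F s.
    by near=> s; rewrite FT//; apply: ltW; near: s; exact: lt_nbhsr.
  by rewrite -(near_eq_derive _ nr) derive_cst.
have [fi ->] := half_line_compact_support T0 cf fT; split => //.
have T1 : 0 <= T + 1 by rewrite addr_ge0.
by rewrite (FTC_segment T1 dF cf) FT ?sub0r// lerDl.
Unshelve. all: by end_near. Qed.

Lemma is_derive_expR_lin (a t : R) :
  is_derive t (1 : R) (fun t => expR (- (a * t))) (- a * expR (- (a * t))).
Proof.
rewrite mulrC; apply: (@is_derive1_comp _ expR (fun t => - (a * t))).
by apply: is_derive_eq; rewrite /GRing.scale/= mulr1.
Qed.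

Lemma continuous_expR_lin (a : R) : continuous (fun t => expR (- (a * t))).
Proof.
move=> t; apply/differentiable_continuous/derivable1_diffP.
by have /@ex_derive := is_derive_expR_lin a t.
Qed.

Lemma integral_expR_lin (a : R) : 0 < a ->
  leb.-integrable half_line (EFin \o (fun t => expR (- (a * t)))) /\
  \int[leb]_(t in half_line) expR (- (a * t)) = a^-1.
Proof.
move=> a0.
have dF (t : R) : is_derive t (1 : R) (fun t => - a^-1 * expR (- (a * t))) (expR (- (a * t))).
  have := @is_deriveZ _ _ _ (fun t => expR (- (a * t))) (- a^-1) t 1 _ (is_derive_expR_lin a t).
  by rewrite /GRing.scale/= mulrA mulrNN mulVf ?gt_eqF// mul1r.
have cF : continuous (fun t => - a^-1 * expR (- (a * t))).
  by move=> t; apply/differentiable_continuous/derivable1_diffP; have /@ex_derive := dF t.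
have FTC : (\int[leb]_(t in `[0%R, +oo[) (expR (- (a * t)))%:E = (a^-1)%:E)%E.
  rewrite (@ge0_continuous_FTC2y _ _ (fun t => - a^-1 * expR (- (a * t))) 0 0).
  - by rewrite mulr0 oppr0 expR0 mulr1 sub0e EFinN oppeK.
  - by move=> t _; exact: expR_ge0.
  - by apply: continuous_subspaceT; exact: continuous_expR_lin.
  - rewrite -[X in _ --> X](mulr0 (- a^-1)); apply: cvgM; first exact: cvg_cst.
    have : expR (- t) @[t --> +oo] --> (0 : R) by exact: cvgr_expR.
    apply: (@cvg_comp _ _ _ (fun t => a * t) (fun t => expR (- t))).
    by apply: gt0_cvgMry => //; exact: cvg_id.
  - by move=> t _; have /@ex_derive := dF t.
  - by apply: cvg_at_right_filter; exact: cF.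
  - by move=> t _; rewrite derive1E; have /@derive_val := dF t.
have iC : leb.-integrable `[0, +oo[ (EFin \o (fun t => expR (- (a * t)))).
  apply/integrableP; split.
    apply/measurable_EFinP; apply: (measurable_funS measurableT) => //.
    by apply: continuous_measurable_fun; exact: continuous_expR_lin.
  by under eq_integral do rewrite /= ger0_norm ?expR_ge0//; rewrite FTC ltry.
have iH : leb.-integrable `]0, +oo[ (EFin \o (fun t => expR (- (a * t)))).
  by apply: (integrableS _ _ _ iC) => // t; rewrite /= !in_itv/= !andbT => /ltW.
split; first by rewrite half_lineE.
by rewrite half_lineE Rintegral_itv_obnd_cbnd// /Rintegral FTC.
Qed.

Lemma half_line_L2 (f : R -> R) (T : R) : 0 <= T -> continuous f ->
  (forall t, T < t -> f t = 0) -> L2 leb half_line f.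
Proof.
move=> T0 cf fT; split.
  by apply: (measurable_funS measurableT) => //; exact: continuous_measurable_fun.
have f2T t : T < t -> f t ^+ 2 = 0 by move=> Tt; rewrite fT// expr0n.
have [/integrableP[_ f2] _] := half_line_compact_support T0 (continuous_sqr cf) f2T.
apply: le_lt_trans f2; rewrite /L2sq le_eqVlt; apply/orP; left; apply/eqP.
by apply: eq_integral => t _ /=; rewrite ger0_norm// sqr_ge0.
Qed.

Lemma expR_lin_L2 (a : R) : 0 < a -> L2 leb half_line (fun t => expR (- (a * t))).
Proof.
move=> a0; split.
  by apply: (measurable_funS measurableT) => //; apply: continuous_measurable_fun; exact: continuous_expR_lin.
have [/integrableP[_ f2] _] := integral_expR_lin (addr_gt0 a0 a0).
apply: le_lt_trans f2; rewrite /L2sq le_eqVlt; apply/orP; left; apply/eqP.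
apply: eq_integral => t _ /=; rewrite ger0_norm ?expR_ge0// expr2 -expRD.
by congr (expR _)%:E; ring.
Qed.

Lemma expR_lin_inner (a b : R) : 0 < a -> 0 < b ->
  \int[leb]_(t in half_line) (expR (- (a * t)) * expR (- (b * t))) = (a + b)^-1.
Proof.
move=> a0 b0; have [_ <-] := integral_expR_lin (addr_gt0 a0 b0).
by apply: eq_Rintegral => t _; rewrite -expRD; congr expR; ring.
Qed.

End half_line.

Section slices.
Context (R : realType) (d : nat).
Local Notation E := 'rV[R]_d.
Implicit Types (eta : E * R -> R).

Lemma slice1_affine (t h : R) (x v : E) : (h *: v + x, t) = h *: ((v, 0) : E * R) + (x, t).
Proof. by congr pair; rewrite /= scaler0 add0r. Qed.

Lemma slice2_affine (x : E) (h t s : R) : (x, h *: s + t) = h *: ((0, s) : E * R) + (x, t).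
Proof. by congr pair; rewrite /= scaler0 add0r. Qed.

Lemma smooth_slice1 eta t : smooth eta -> smooth (fun x : E => eta (x, t)).
Proof.
apply: (@smooth_affine _ _ _ (fun x : E => (x, t)) (fun v => (v, 0))).
  by move=> h x v; exact: slice1_affine.
by move=> x; apply: differentiable_pair => //; exact: differentiable_cst.
Qed.

Lemma smooth_slice2 eta x : smooth eta -> smooth (fun t : R => eta (x, t)).
Proof.
apply: (@smooth_affine _ _ _ (fun t : R => (x, t)) (fun s => (0, s))).
  by move=> h t s; exact: slice2_affine.
by move=> t; apply: differentiable_pair => //; exact: differentiable_cst.
Qed.

Lemma grad_slice1 eta x t : grad (fun x : E => eta (x, t)) x = (grad_xt eta (x, t)).1.
Proof.
apply/rowP => i; rewrite !mxE.
exact: (@derive_affine _ _ _ (fun x : E => (x, t)) (fun v => (v, 0)) eta x (delta_mx ord0 i)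
  (fun h => slice1_affine t h x _)).
Qed.

Lemma is_derive_slice2 eta x (t : R) : smooth eta ->
  is_derive t (1 : R) (fun t : R => eta (x, t)) ((grad_xt eta (x, t)).2).
Proof.
move=> seta; rewrite /grad_xt/=.
rewrite -(@derive_affine _ _ _ (fun t : R => (x, t)) (fun s => (0, s)) eta t 1
  (fun h => slice2_affine x h t _)).
by apply: derivableP; apply: smooth_derivable; exact: smooth_slice2.
Qed.

Lemma smooth_grad_xt1 eta i : smooth eta -> smooth (fun z => (grad_xt eta z).1 ord0 i).
Proof.
move=> seta; rewrite (_ : (fun z => _) = (fun z => 'D_((delta_mx ord0 i, 0) : E * R) eta z)).
  exact: smooth_derive.
by apply/funext => z; rewrite mxE.
Qed.

Lemma smooth_grad_xt2 eta : smooth eta -> smooth (fun z => (grad_xt eta z).2).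
Proof. exact: smooth_derive. Qed.

End slices.

(** * Square-integrable fields on the cylinder *)

Section cylinder_L2.
Context (R : realType) (d : nat) (Omega : set 'rV[R]_d) (L : R).
Hypotheses (L0 : 0 < L) (oO : open Omega).
Hypothesis (OL : forall x, Omega x -> forall i, `|x ord0 i| < L).
Local Notation E := 'rV[R]_d.
Local Notation muE := (lebesgue_rV R d).
Local Notation muQ := (lebesgue_xt R d).
Local Notation leb := (@lebesgue_measure R).
Local Notation Q := (cylinder Omega : set (E * measurableTypeR R)).
Let mO := domain_measurable oO.

Lemma cylinderE : Q = Omega `*` (@half_line R). Proof. by []. Qed.

Lemma cylinder_measurable : measurable Q.
Proof. by rewrite cylinderE; apply: measurableX => //; exact: measurable_half_line. Qed.
Let mQ := cylinder_measurable.

(** A pair [(x, t)] presented by [d + 1] coordinates, so that the results on [L2vec] apply. *)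
Definition xt_coord (s : 'I_d + unit) (z : E * R) : R :=
  match s with inl i => z.1 ord0 i | inr _ => z.2 end.

Lemma xt_coord_lin s (a : R) (u v : E * R) :
  xt_coord s (a *: u + v) = a * xt_coord s u + xt_coord s v.
Proof. by case: s => [i|]/=; rewrite ?mxE. Qed.

Lemma dot_xtE (u v : E * R) : dot_xt u v = \sum_s xt_coord s u * xt_coord s v.
Proof. by rewrite big_sumType/= (big_pred1 tt) => [|[]]. Qed.

Definition L2xt (p : E * R -> E * R) : Prop :=
  (forall i, L2 muQ Q (fun z => (p z).1 ord0 i)) /\ L2 muQ Q (fun z => (p z).2).

Lemma L2xtP p : L2xt p <-> L2vec muQ Q xt_coord p.
Proof.
split=> [[p1 p2] [i|[]]|H]; [exact: p1|exact: p2|].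
by split=> [i|]; [exact: (H (inl i))|exact: (H (inr tt))].
Qed.

Lemma xt_innerE (p q : E * R -> E * R) : L2vec_inner muQ Q xt_coord p q =
  \int[muQ]_(z in Q) dot_xt (p z) (q z).
Proof. by apply: eq_Rintegral => z _; rewrite dot_xtE. Qed.

Lemma L2xt_semi_inner : semi_inner (L2xt : set (E * R -> E * R))
  (fun p q => \int[muQ]_(z in Q) dot_xt (p z) (q z)).
Proof.
have SI := L2vec_semi_inner muQ mQ xt_coord_lin.
split.
- by apply/L2xtP; exact: (semi_innerS0 SI).
- by move=> a u v /L2xtP Lu /L2xtP Lv; apply/L2xtP; exact: (semi_innerSL SI).
- move=> u v /L2xtP Lu /L2xtP Lv; have := semi_innerC SI Lu Lv.
  by rewrite !xt_innerE.
- move=> a u v w /L2xtP Lu /L2xtP Lv /L2xtP Lw.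
  by have := semi_innerL SI a Lu Lv Lw; rewrite !xt_innerE.
- by move=> u /L2xtP Lu; have := semi_inner_ge0 SI Lu; rewrite xt_innerE.
Qed.

Lemma vL2sq_xtE p : L2xt p ->
  vL2sq_xt Omega p = (\int[muQ]_(z in Q) dot_xt (p z) (p z))%:E.
Proof.
move=> /L2xtP Lp; have := L2vec_innerE mQ (c := xt_coord) Lp Lp.
by rewrite xt_innerE => <-; apply: eq_integral => z _; rewrite dot_xtE.
Qed.

Lemma L2xt_integrable p q : L2xt p -> L2xt q ->
  muQ.-integrable Q (EFin \o (fun z => dot_xt (p z) (q z))).
Proof.
move=> /L2xtP Lp /L2xtP Lq; have := L2vec_integrable mQ (c := xt_coord) Lp Lq.
by congr integrable; apply/funext => z /=; rewrite dot_xtE.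
Qed.

Lemma xt_inner_split p q : L2xt p -> L2xt q ->
  \int[muQ]_(z in Q) dot_xt (p z) (q z) =
  \sum_(i < d) \int[muQ]_(z in Q) ((p z).1 ord0 i * (q z).1 ord0 i) +
  \int[muQ]_(z in Q) ((p z).2 * (q z).2).
Proof.
move=> [Lp1 Lp2] [Lq1 Lq2].
have i1 i := L2_integrableM mQ (Lp1 i) (Lq1 i).
rewrite RintegralD//; last exact: L2_integrableM.
  by rewrite Rintegral_sum.
rewrite (_ : _ \o _ = (fun z => (\sum_(i < d) ((p z).1 ord0 i * (q z).1 ord0 i)%:E)%E)).
  by apply: integrable_sum => // i _; exact: i1.
by apply/funext => z /=; rewrite sumEFin.
Qed.

Lemma L2xt_cvgP (p_ : nat -> E * R -> E * R) p : (forall n, L2xt (p_ n)) -> L2xt p ->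
  (vL2sq_xt Omega (fun z => p_ n z - p z)%R @[n --> \oo] --> 0%E) <->
  (\int[muQ]_(z in Q) dot_xt (p_ n z - p z) (p_ n z - p z) @[n --> \oo] --> 0).
Proof.
move=> Lp_ Lp.
have -> : (fun n => vL2sq_xt Omega (fun z => p_ n z - p z)) =
    EFin \o (fun n => \int[muQ]_(z in Q) dot_xt (p_ n z - p z) (p_ n z - p z)).
  apply/funext => n /=; rewrite vL2sq_xtE//.
  exact: (semi_innerSB L2xt_semi_inner (Lp_ n) Lp).
split => [H|H]; last by apply: cvg_EFin => //; exact: nearW.
by have /fine_cvgP[] := H.
Qed.

(** Asked only over [Omega], since elements of [V_smooth] have bounded support in the closed
    cylinder and are arbitrary elsewhere. *)
Definition vanishes_after (T : R) (F : E * R -> R) :=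
  forall x t, Omega x -> T <= t -> F (x, t) = 0.

Lemma vanishes_after_L2 (T : R) (F : E * R -> R) : 0 <= T -> continuous F ->
  vanishes_after T F -> L2 muQ Q F.
Proof.
move=> T0 cF FT.
pose K := [set v : E | forall i, `[- L, L]%classic (v ord0 i)] `*` `[0, T]%classic.
have cK : compact K.
  apply: compact_setX; last exact: segment_compact.
  by apply: (@rV_compact _ _ (fun=> `[- L, L]%classic)) => i; exact: segment_compact.
have /compact_bounded[M [_ HM]] : compact (F @` K).
  by apply: continuous_compact => //; exact: continuous_subspaceT.
have FM x t : Omega x -> 0 < t -> t <= T -> `|F (x, t)| <= M + 1.
  move=> Ox t0 tT; apply: (HM (M + 1)); first by rewrite ltrDl.
  exists (x, t) => //; split => /=; last by rewrite in_itv/= (ltW t0).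
  by move=> i; rewrite /= in_itv/= -ler_norml ltW// OL.
(* A continuous weight that is at least [1] up to [T] and vanishes after [T + 1]; its product with
   the constant [M + 1] is a square-integrable majorant of [F]. *)
pose b (t : R) : R := Num.max 0 (T + 1 - t).
have Lb : L2 leb (@half_line R) b.
  apply: (@half_line_L2 _ _ (T + 1)); first by rewrite addr_ge0.
    move=> t; apply: (@continuous_max _ _ (cst 0) (fun t => T + 1 - t)); first exact: cst_continuous.
    by apply: continuousB; [exact: cst_continuous|exact: cvg_id].
  by move=> t tT; rewrite /b; apply/max_idPl; rewrite subr_le0 ltW.
have Lc : L2 muE Omega (cst (M + 1)).
  by apply: (continuous_L2 oO OL); exact: cst_continuous.
have Lg := L2_prod mO (@measurable_half_line R) Lc Lb.
apply: (L2_le mQ _ _ Lg).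
- exact: continuous_measurable_rV_R.
- move=> [x t] [/= Ox t0]; have [tT|/ltW tT] := leP t T; last by rewrite FT// normr0.
  have Mx := FM x t Ox t0 tT; have M0 := le_trans (normr_ge0 _) Mx.
  apply: (le_trans Mx); rewrite normrM (ger0_norm M0) ler_peMr//.
  apply: le_trans (ler_norm _); rewrite /b le_max; apply/orP; right; lra.
Qed.

(** The margin [1] leaves a neighbourhood of each point on which [F] vanishes. *)
Lemma vanishes_after_derive (T : R) (F : E * R -> R) v : vanishes_after T F ->
  vanishes_after (T + 1) (fun z => 'D_v F z).
Proof.
move=> FT x t Ox Tt.
have nr : \forall z \near (x, t), cst 0 z = F z.
  have n1 : \forall y \near x, Omega y by exact: open_nbhs_nbhs.
  have n2 : \forall s \near t, T < s by apply: lt_nbhsr; lra.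
  exists ([set y | Omega y], [set s | T < s]) => //.
  by move=> [y s] [/= Oy /ltW Ts]; rewrite FT.
by rewrite -(near_eq_derive _ nr) derive_cst.
Qed.

Lemma smooth_vanishing_L2 (T : R) eta : 0 <= T -> smooth eta -> vanishes_after T eta ->
  L2 muQ Q eta /\ L2xt (grad_xt eta).
Proof.
move=> T0 seta vT; have T1 : 0 <= T + 1 by rewrite addr_ge0.
split; [|split => [i|]].
- by apply: (vanishes_after_L2 T0) => //; exact: smooth_continuous.
- apply: (vanishes_after_L2 T1); first exact/smooth_continuous/smooth_grad_xt1.
  by move=> x t Ox Tt; rewrite mxE; exact: (vanishes_after_derive _ vT Ox Tt).
- apply: (vanishes_after_L2 T1); first exact/smooth_continuous/smooth_grad_xt2.
  exact: vanishes_after_derive.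
Qed.

Lemma V_smooth_vanishes eta : V_smooth Omega eta ->
  exists2 T, 0 <= T & vanishes_after T eta.
Proof.
move=> [_ [M [_ HM]] _].
exists (`|M| + 2) => [|x t Ox Tt]; first by rewrite addr_ge0.
apply: contrapT => /eqP e0.
have t0 : 0 < t by apply: lt_le_trans Tt; rewrite ltr_wpDl.
have M1 : M < `|M| + 1 by rewrite (le_lt_trans (ler_norm M))// ltrDl.
have := HM _ M1 (x, t); rewrite /= => H.
have : `|(x, t)| <= `|M| + 1.
  by apply: H; split => //; apply: subset_closure; split.
rewrite prod_normE/= ge_max => /andP[_]; apply/negP; rewrite -ltNge.
by apply: lt_le_trans (ler_norm t); apply: lt_le_trans Tt; rewrite ltrD2l ltr1n.
Qed.

End cylinder_L2.

Section Rfubini.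
Context (R : realType) d1 d2 (T1 : measurableType d1) (T2 : measurableType d2).
Context (m1 : {sigma_finite_measure set T1 -> \bar R}).
Context (m2 : {sigma_finite_measure set T2 -> \bar R}).
Context (A : set T1) (B : set T2) (mA : measurable A) (mB : measurable B).
Context (F : T1 * T2 -> R).
Hypothesis iF : (m1 \x m2)%E.-integrable (A `*` B) (EFin \o F).

(** Integrability of every slice makes the real-valued inner integral agree with the extended one;
    [f] is its value in closed form. *)
Lemma Rfubini1 (f : T1 -> R) :
  (forall x, A x -> m2.-integrable B (EFin \o (fun t => F (x, t)))) ->
  (forall x, A x -> \int[m2]_(t in B) F (x, t) = f x) ->
  \int[(m1 \x m2)%E]_(z in A `*` B) F z = \int[m1]_(x in A) f x.
Proof.
move=> isl Ff; rewrite /Rintegral fubini_rectangle1//; congr fine.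
apply: eq_integral => x /set_mem Ax; rewrite -Ff// /Rintegral fineK//.
by apply: integrable_fin_num => //; exact: isl.
Qed.

Lemma Rfubini2 (f : T2 -> R) :
  (forall t, B t -> m1.-integrable A (EFin \o (fun x => F (x, t)))) ->
  (forall t, B t -> \int[m1]_(x in A) F (x, t) = f t) ->
  \int[(m1 \x m2)%E]_(z in A `*` B) F z = \int[m2]_(t in B) f t.
Proof.
move=> isl Ff; rewrite /Rintegral fubini_rectangle2//; congr fine.
apply: eq_integral => t /set_mem Bt; rewrite -Ff// /Rintegral fineK//.
by apply: integrable_fin_num => //; exact: isl.
Qed.

End Rfubini.

(** * Trace inequality and Green's formula for smooth functions *)

Section cylinder_smooth.
Context (R : realType) (d : nat) (Omega : set 'rV[R]_d) (L : R).
Hypotheses (L0 : 0 < L) (oO : open Omega).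
Hypothesis (OL : forall x, Omega x -> forall i, `|x ord0 i| < L).
Local Notation E := 'rV[R]_d.
Local Notation muE := (lebesgue_rV R d).
Local Notation muQ := (lebesgue_xt R d).
Local Notation leb := (@lebesgue_measure R).
Local Notation Q := (cylinder Omega : set (E * measurableTypeR R)).
Let mO := domain_measurable oO.
Let mQ := cylinder_measurable oO.
Let mH := @measurable_half_line R.
Let BQ (f g : E * R -> R^o) := \int[muQ]_(z in Q) (f z * g z).
Let BX (p q : E * R -> E * R) := \int[muQ]_(z in Q) dot_xt (p z) (q z).
Let SQ : semi_inner (L2 muQ Q : set (E * R -> R^o)) BQ := L2_semi_inner muQ mQ.

Context (eta : E * R -> R) (T : R).
Hypotheses (seta : smooth eta) (T0 : 0 <= T) (vT : vanishes_after Omega T eta).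

Let Leta : L2 muQ Q eta.
Proof. by have [] := smooth_vanishing_L2 oO OL T0 seta vT. Qed.

Let Lgrad : L2xt Omega (grad_xt eta).
Proof. by have [] := smooth_vanishing_L2 oO OL T0 seta vT. Qed.

Let Leta_t : L2 muQ Q (fun z => (grad_xt eta z).2).
Proof. by case: Lgrad. Qed.

Let cslice1 t : continuous (fun x => eta (x, t)).
Proof. by apply: smooth_continuous; exact: smooth_slice1. Qed.

Let cslice2 x : continuous (fun t => eta (x, t)).
Proof. by apply: smooth_continuous; exact: smooth_slice2. Qed.

Let cslice2t x : continuous (fun t => (grad_xt eta (x, t)).2).
Proof.
apply: smooth_continuous.
exact: (@smooth_slice2 _ _ (fun z => (grad_xt eta z).2) x (smooth_grad_xt2 seta)).
Qed.

Lemma trace_identity : \int[muE]_(x in Omega) (eta (x, 0) * eta (x, 0)) =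
  - (2 * BQ eta (fun z => (grad_xt eta z).2)).
Proof.
have i1 := L2_integrableM mQ Leta Leta_t.
rewrite /BQ -(RintegralZl 2 mQ i1).
have D x (t : R) : is_derive t (1 : R) (fun t => eta (x, t) * eta (x, t))
    (2 * (eta (x, t) * (grad_xt eta (x, t)).2)).
  have dt := is_derive_slice2 x t seta.
  have := is_deriveM dt dt; rewrite /GRing.scale/=.
  by move=> H; apply: (is_derive_eq H); ring.
have cD x : continuous (fun t => 2 * (eta (x, t) * (grad_xt eta (x, t)).2)).
  move=> t; apply: cvgM; first exact: cvg_cst.
  by apply: cvgM; [exact: cslice2|exact: cslice2t].
have F0 x : Omega x -> forall t, T <= t -> eta (x, t) * eta (x, t) = 0.
  by move=> Ox t Tt; rewrite vT// mul0r.
rewrite (@Rfubini1 _ _ _ _ _ muE leb Omega (@half_line R) mO mH _ (integrableZl mQ 2 i1)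
  (fun x => -1 * (eta (x, 0) * eta (x, 0)))).
- have Le0 : L2 muE Omega (fun x => eta (x, 0)) by apply: (continuous_L2 oO OL); exact: cslice1.
  by rewrite (RintegralZl (-1) mO (L2_integrableM mO Le0 Le0)) mulN1r opprK.
- by move=> x Ox; have [] := half_line_FTC T0 (D x) (cD x) (F0 x Ox).
- by move=> x Ox; have [_ ->] := half_line_FTC T0 (D x) (cD x) (F0 x Ox); rewrite mulN1r.
Qed.

(** The slices are compared under the extended integral in [t], where Tonelli's theorem asks only
    for measurability and nonnegativity. *)
Lemma friedrichs_cylinder (lam : R) : 0 <= lam ->
  (forall phi, test_function Omega phi -> lam * \int[muE]_(x in Omega) (phi x * phi x) <=
     \int[muE]_(x in Omega) dot (grad phi x) (grad phi x)) ->
  (forall x t, topological_boundary Omega x -> 0 < t -> eta (x, t) = 0) ->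
  lam * BQ eta eta <= \sum_(i < d) BQ (fun z => (grad_xt eta z).1 ord0 i)
     (fun z => (grad_xt eta z).1 ord0 i).
Proof.
move=> lam0 H eta0.
have Lg i : L2 muQ Q (fun z => (grad_xt eta z).1 ord0 i) by case: Lgrad.
have ig i := L2_integrableM mQ (Lg i) (Lg i).
have ie := L2_integrableM mQ Leta Leta.
have isum : muQ.-integrable Q (EFin \o (fun z => dot (grad_xt eta z).1 (grad_xt eta z).1)).
  rewrite (_ : _ \o _ = (fun z => (\sum_(i < d) ((grad_xt eta z).1 ord0 i * (grad_xt eta z).1 ord0 i)%:E)%E)).
    by apply: integrable_sum => // i _; exact: ig.
  by apply/funext => z /=; rewrite sumEFin.
rewrite /BQ -Rintegral_sum// -RintegralZl//; apply: fine_le.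
- by apply: integrable_fin_num => //; exact: (integrableZl mQ lam ie).
- exact: integrable_fin_num.
have le0 z : 0 <= lam * (eta z * eta z) by rewrite mulr_ge0// -expr2 sqr_ge0.
have ge0 z : 0 <= dot (grad_xt eta z).1 (grad_xt eta z).1.
  by apply: sumr_ge0 => i _; rewrite -expr2 sqr_ge0.
have mle := measurable_int _ (integrableZl mQ lam ie).
have mge := measurable_int _ isum.
rewrite [leLHS](@tonelli_rectangle2 _ _ _ _ _ muE leb Omega (@half_line R) mO mH)//; last first.
  by move=> z _; rewrite lee_fin le0.
rewrite [leRHS](@tonelli_rectangle2 _ _ _ _ _ muE leb Omega (@half_line R) mO mH)//; last first.
  by move=> z _; rewrite lee_fin ge0.
apply: ge0_le_integral => //.
- by move=> t _; apply: integral_ge0 => x _; rewrite lee_fin le0.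
- apply: (@measurable_tonelli_rectangle2 _ _ _ _ _ muE Omega (@half_line R) mO mH
    (EFin \o (fun z => lam * (eta z * eta z)))) => //.
  by move=> z _; rewrite lee_fin le0.
- apply: (@measurable_tonelli_rectangle2 _ _ _ _ _ muE Omega (@half_line R) mO mH
    (EFin \o (fun z => dot (grad_xt eta z).1 (grad_xt eta z).1))) => //.
  by move=> z _; rewrite lee_fin ge0.
move=> t t0.
have su := smooth_slice1 t seta.
have Lu : L2 muE Omega (fun x => eta (x, t)).
  by apply: (continuous_L2 oO OL); exact: smooth_continuous.
have iu := L2_integrableM mO Lu Lu.
have Lgu : L2v Omega (grad (fun x => eta (x, t))) by exact: (smooth_grad_L2v oO OL).
have := friedrichs_smooth0 oO OL H su (fun x bx => eta0 x t bx t0).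
rewrite -lee_fin -RintegralZl//.
rewrite {1}/Rintegral fineK; last first.
  by apply: integrable_fin_num => //; exact: (integrableZl mO lam iu).
rewrite /Rintegral fineK; last first.
  by apply: integrable_fin_num => //; exact: L2v_integrable.
move=> /le_trans; apply; rewrite le_eqVlt; apply/orP; left; apply/eqP.
by apply: eq_integral => x _; rewrite grad_slice1.
Qed.

(** The square of the norm of [Num.sqrt lam * eta + eta_t] is nonnegative. This bounds
    [- 2 * Num.sqrt lam] times the inner product of [eta] and [eta_t] by [lam * BQ eta eta] plus the
    t-energy, and Friedrichs turns the former into the x-energy. *)
Lemma trace_inequality (lam : R) : 0 < lam ->
  (forall phi, test_function Omega phi -> lam * \int[muE]_(x in Omega) (phi x * phi x) <=
     \int[muE]_(x in Omega) dot (grad phi x) (grad phi x)) ->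
  (forall x t, topological_boundary Omega x -> 0 < t -> eta (x, t) = 0) ->
  \int[muE]_(x in Omega) (eta (x, 0) * eta (x, 0)) <=
  (Num.sqrt lam)^-1 * BX (grad_xt eta) (grad_xt eta).
Proof.
move=> lam0 H eta0; rewrite trace_identity.
have := friedrichs_cylinder (ltW lam0) H eta0.
rewrite [X in _ -> _ <= _ * X](xt_inner_split oO Lgrad Lgrad).
have := semi_inner_ge0 SQ (semi_innerSL SQ (Num.sqrt lam) Leta Leta_t).
rewrite (semi_inner_sqrD SQ _ Leta Leta_t) sqr_sqrtr ?(ltW lam0)//.
have c0 : 0 < Num.sqrt lam by rewrite sqrtr_gt0.
rewrite -/(BQ (fun z => (grad_xt eta z).2) (fun z => (grad_xt eta z).2)).
move: (BQ eta eta) (BQ eta _) (BQ (fun z => (grad_xt eta z).2) _) (Num.sqrt lam) c0.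
move: (\sum_(i < d) _) => S N b Nt c c0 h1 h2.
by rewrite [leRHS]mulrC ler_pdivlMr//; lra.
Qed.

Section green.
Context (a : R) (a0 : 0 < a) (psi l : E -> R) (gpsi : E -> E).
Hypotheses (hpsi : H10 Omega psi gpsi) (hl : L2_divergence Omega gpsi l).
Local Notation ex t := (expR (- (a * t))).

(** The divergence-free field attached to one mode: [a * ex * l] from the x-part cancels the
    t-derivative [l * (- a * ex)]. *)
Definition mode_flux (z : E * R) : E * R := ((a * ex z.2) *: gpsi z.1, l z.1 * ex z.2).

Let Ll : L2 muE Omega l. Proof. by case: hl. Qed.
Let Lg i : L2 muE Omega (fun x => gpsi x ord0 i). Proof. by case: hpsi => [[_ Lg _] _]. Qed.
Let Lex : L2 leb (@half_line R) (fun t => ex t). Proof. exact: expR_lin_L2. Qed.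

Lemma mode_flux_L2 : L2xt Omega mode_flux.
Proof.
split=> [i|]; last exact: (L2_prod mO mH Ll Lex).
rewrite (_ : (fun z => _) = (fun z => gpsi z.1 ord0 i * (a * ex z.2))); last first.
  by apply/funext => z; rewrite mxE mulrC.
exact: (L2_prod mO mH (Lg i) (L2_scale mH a Lex)).
Qed.

(** Adding and subtracting [a * ex * l * eta] splits the integrand into [F1] and [F2]. [F1]
    integrates to zero over each slice by Green's formula in [Omega]; [F2] is the t-derivative of
    [l * ex * eta] and leaves its value at [t = 0] on each half-line. *)
Lemma mode_flux_green :
  (forall x t, topological_boundary Omega x -> 0 < t -> eta (x, t) = 0) ->
  BX mode_flux (grad_xt eta) = - \int[muE]_(x in Omega) (l x * eta (x, 0)).
Proof.
move=> eta0.
pose F2 (z : E * R) := l z.1 * (- a * ex z.2 * eta z + ex z.2 * (grad_xt eta z).2).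
pose F1 (z : E * R) := a * ex z.2 * (dot (gpsi z.1) (grad_xt eta z).1 + l z.1 * eta z).
have LY := mode_flux_L2.
have Llex : L2 muQ Q (fun z => l z.1 * ex z.2) by exact: (L2_prod mO mH Ll Lex).
have iY := L2xt_integrable oO LY Lgrad.
have iF2 : muQ.-integrable Q (EFin \o F2).
  have i1 := L2_integrableM mQ Llex Leta_t.
  have i2 := integrableZl mQ (- a) (L2_integrableM mQ Llex Leta).
  have := integrableD mQ i2 i1; congr integrable; apply/funext => z /=.
  by rewrite /F2 /=; congr (_%:E); ring.
have E12 z : dot_xt (mode_flux z) (grad_xt eta z) = F1 z + F2 z.
  rewrite /F1 /F2 /dot_xt /= (_ : dot ((a * ex z.2) *: gpsi z.1) _ =
    a * ex z.2 * dot (gpsi z.1) (grad_xt eta z).1); first by ring.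
  by rewrite /dot mulr_sumr; apply: eq_bigr => i _; rewrite !mxE mulrA.
have iF1 : muQ.-integrable Q (EFin \o F1).
  have := integrableB mQ iY iF2; congr integrable; apply/funext => z.
  by rewrite /= -EFinB E12 addrK.
have -> : BX mode_flux (grad_xt eta) = \int[muQ]_(z in Q) F1 z + \int[muQ]_(z in Q) F2 z.
  rewrite -RintegralD//; by apply: eq_Rintegral => z _; rewrite E12.
have -> : \int[muQ]_(z in Q) F1 z = 0.
  have slice t : 0 < t -> muE.-integrable Omega (EFin \o (fun x => F1 (x, t))) /\
      \int[muE]_(x in Omega) F1 (x, t) = 0.
    move=> t0; have su := smooth_slice1 t seta.
    have Lu : L2 muE Omega (fun x => eta (x, t)).
      by apply: (continuous_L2 oO OL); exact: smooth_continuous.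
    have Lgu : L2v Omega (grad (fun x => eta (x, t))) by exact: (smooth_grad_L2v oO OL).
    have i1 := L2v_integrable mO Lg Lgu; have i2 := L2_integrableM mO Ll Lu.
    have i3 := integrableD mO i1 i2.
    have E1 x : F1 (x, t) = a * ex t *
        (dot (gpsi x) (grad (fun x => eta (x, t)) x) + l x * eta (x, t)).
      by rewrite grad_slice1.
    split.
      have := integrableZl mO (a * ex t) i3; congr integrable; apply/funext => x /=.
      by rewrite E1.
    under eq_Rintegral do rewrite E1.
    rewrite (RintegralZl _ mO i3) (RintegralD mO i1 i2).
    rewrite (green_smooth0 L0 oO OL hpsi hl su (fun x bx => eta0 x t bx t0)).
    by rewrite addNr mulr0.
  rewrite (@Rfubini2 _ _ _ _ _ muE leb Omega (@half_line R) mO mH _ iF1 (cst 0)).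
  - by rewrite Rintegral_cst ?mul0r.
  - by move=> t /slice[].
  - by move=> t /slice[].
have FTC x : Omega x -> leb.-integrable (@half_line R) (EFin \o (fun t => F2 (x, t))) /\
    \int[leb]_(t in @half_line R) F2 (x, t) = -1 * (l x * eta (x, 0)).
  move=> Ox.
  have D (t : R) : is_derive t (1 : R) (fun t => l x * (ex t * eta (x, t))) (F2 (x, t)).
    have H := is_deriveM (is_derive_expR_lin a t) (is_derive_slice2 x t seta).
    have H2 := @is_deriveZ _ _ _ _ (l x) _ _ _ H.
    by apply: (is_derive_eq H2); rewrite /F2 /GRing.scale/=; ring.
  have cF : continuous (fun t => F2 (x, t)).
    move=> t; rewrite /F2 /=; apply: cvgM; first exact: cvg_cst.
    apply: cvgD; last by apply: cvgM; [exact: continuous_expR_lin|exact: cslice2t].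
    apply: cvgM; last exact: cslice2.
    by apply: cvgM; [exact: cvg_cst|exact: continuous_expR_lin].
  have F0 t : T <= t -> l x * (ex t * eta (x, t)) = 0.
    by move=> Tt; rewrite vT// !mulr0.
  have [iF ->] := half_line_FTC T0 D cF F0.
  by split => //; rewrite mulr0 oppr0 expR0 mul1r mulN1r.
rewrite add0r (@Rfubini1 _ _ _ _ _ muE leb Omega (@half_line R) mO mH _ iF2
  (fun x => -1 * (l x * eta (x, 0)))).
- have Le0 : L2 muE Omega (fun x => eta (x, 0)) by apply: (continuous_L2 oO OL); exact: cslice1.
  by rewrite (RintegralZl (-1) mO (L2_integrableM mO Ll Le0)) mulN1r.
- by move=> x /FTC[].
- by move=> x /FTC[].
Qed.

End green.

End cylinder_smooth.

(** * The space V *)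

Lemma semi_inner_cvg_lin (R : realType) (V : lmodType R) (S : set V) (B : V -> V -> R)
    (SB : semi_inner S B) (a : R) (u_ v_ : nat -> V) u v :
  (forall n, S (u_ n)) -> (forall n, S (v_ n)) -> S u -> S v ->
  B (u_ n - u) (u_ n - u) @[n --> \oo] --> 0 ->
  B (v_ n - v) (v_ n - v) @[n --> \oo] --> 0 ->
  B (a *: u_ n + v_ n - (a *: u + v)) (a *: u_ n + v_ n - (a *: u + v)) @[n --> \oo] --> 0.
Proof.
move=> Su_ Sv_ Su Sv cu cv.
have Sdu n := semi_innerSB SB (Su_ n) Su; have Sdv n := semi_innerSB SB (Sv_ n) Sv.
have S0 := semi_innerS0 SB.
have cuv : B (u_ n - u) (v_ n - v) @[n --> \oo] --> B 0 0.
  by apply: (semi_inner_cvg SB Sdu Sdv S0 S0); under eq_fun do rewrite subr0.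
have -> : (fun n => B (a *: u_ n + v_ n - (a *: u + v)) (a *: u_ n + v_ n - (a *: u + v))) =
  (fun n => a ^+ 2 * B (u_ n - u) (u_ n - u) + 2 * a * B (u_ n - u) (v_ n - v) +
     B (v_ n - v) (v_ n - v)).
  apply/funext => n; rewrite -(semi_inner_sqrD SB a (Sdu n) (Sdv n)).
  by rewrite scalerBr opprD addrACA.
rewrite (semi_inner0 SB S0) in cuv.
have -> : 0 = a ^+ 2 * 0 + 2 * a * 0 + 0 :> R by rewrite !mulr0 !addr0.
apply: cvgD => //; apply: cvgD; (apply: cvgM; first exact: cvg_cst) => //.
Qed.

Lemma grad_xt_lin (R : realType) (d : nat) (a : R) (phi psi : 'rV[R]_d * R -> R) z :
  smooth phi -> smooth psi ->
  grad_xt (fun z => a * phi z + psi z) z = a *: grad_xt phi z + grad_xt psi z.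
Proof.
move=> sphi spsi.
have H v : 'D_v (fun z => a * phi z + psi z) z = a * 'D_v phi z + 'D_v psi z.
  have d1 := @smooth_derivable _ _ phi z v sphi; have d2 := @smooth_derivable _ _ psi z v spsi.
  by rewrite (deriveD (@derivableZ _ _ _ phi a z v d1) d2) deriveZ.
by congr pair; [apply/rowP => i; rewrite !mxE H|rewrite /= H].
Qed.

Section in_V.
Context (R : realType) (d : nat) (Omega : set 'rV[R]_d) (L : R).
Hypotheses (L0 : 0 < L) (oO : open Omega).
Hypothesis (OL : forall x, Omega x -> forall i, `|x ord0 i| < L).
Local Notation E := 'rV[R]_d.
Local Notation muE := (lebesgue_rV R d).
Local Notation muQ := (lebesgue_xt R d).
Local Notation Q := (cylinder Omega : set (E * measurableTypeR R)).
Let mO := domain_measurable oO.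
Let mQ := cylinder_measurable oO.
Let B0 (f g : E -> R^o) := \int[muE]_(x in Omega) (f x * g x).
Let BQ (f g : E * R -> R^o) := \int[muQ]_(z in Q) (f z * g z).
Let BX (p q : E * R -> E * R) := \int[muQ]_(z in Q) dot_xt (p z) (q z).
Let S0 : semi_inner (L2 muE Omega : set (E -> R^o)) B0 := L2_semi_inner muE mO.
Let SQ : semi_inner (L2 muQ Q : set (E * R -> R^o)) BQ := L2_semi_inner muQ mQ.
Let SX : semi_inner (L2xt Omega : set (E * R -> E * R)) BX := L2xt_semi_inner oO.

Lemma V_smooth_L2 eta : V_smooth Omega eta ->
  [/\ L2 muQ Q eta, L2xt Omega (grad_xt eta) & L2 muE Omega (fun x => eta (x, 0))].
Proof.
move=> Veta; have [seta _ _] := Veta; have [T T0 vT] := V_smooth_vanishes Veta.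
have [Le Lg] := smooth_vanishing_L2 oO OL T0 seta vT; split => //.
by apply: (continuous_L2 oO OL); apply: smooth_continuous; exact: smooth_slice1.
Qed.

Lemma test_V_smooth eta : test_function (cylinder Omega) eta -> V_smooth Omega eta.
Proof.
move=> teta; have [seta [K [cK KQ K0]]] := teta; split => //.
  have [M [Mr HM]] := compact_bounded cK.
  exists M; split => // x Mx z [_ z0]; apply: (HM _ Mx).
  by apply: contrapT => /K0 e0; rewrite /= e0 eqxx in z0.
move=> x t [_ xO] t0; apply: (test_out teta) => -[/= Ox _].
by apply: xO; exact: open_nbhs_nbhs.
Qed.

Lemma V_smooth_lin a eta phi : V_smooth Omega eta -> V_smooth Omega phi ->
  V_smooth Omega (fun z => a * eta z + phi z).
Proof.
move=> [seta [M [Mr HM]] e0] [sphi [N [Nr HN]] p0]; split.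
- by apply: smoothD => //; exact: smoothZ.
- exists (Num.max M N); split; first by rewrite max_real.
  move=> x; rewrite gt_max => /andP[Mx Nx] z [Qz z0].
  have [ez|ez] := eqVneq (eta z) 0; last by apply: (HM _ Mx).
  by apply: (HN _ Nx); split => //=; move: z0; rewrite /= ez mulr0 add0r.
- by move=> x t bx t0; rewrite e0// p0// mulr0 addr0.
Qed.

Lemma in_V_L2 w p g : in_V Omega w p g ->
  [/\ L2 muQ Q w, L2xt Omega p & L2 muE Omega g].
Proof. by move=> [[Lw Lp1 Lp2 _] Lg _]. Qed.

Lemma in_V_approx w p g : in_V Omega w p g -> exists phi : nat -> E * R -> R,
  [/\ forall n, V_smooth Omega (phi n),
      BX (grad_xt (phi n) - p) (grad_xt (phi n) - p) @[n --> \oo] --> 0,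
      BQ (phi n - w) (phi n - w) @[n --> \oo] --> 0
    & B0 ((fun x => phi n (x, 0)) - g) ((fun x => phi n (x, 0)) - g) @[n --> \oo] --> 0].
Proof.
move=> hw; have [Lw Lp Lg] := in_V_L2 hw; have [_ _ [phi [Vphi c1 c2 c3]]] := hw.
have H n := V_smooth_L2 (Vphi n).
exists phi; split => //.
- by apply/(L2xt_cvgP oO (fun n => let: And3 _ h _ := H n in h) Lp).
- by apply/(L2_cvgP mQ (fun n => let: And3 h _ _ := H n in h) Lw).
- by apply/(L2_cvgP mO (fun n => let: And3 _ _ h := H n in h) Lg).
Qed.

Lemma in_V_intro w p g (phi : nat -> E * R -> R) : H1_xt Omega w p -> L2 muE Omega g ->
  (forall n, V_smooth Omega (phi n)) ->
  BX (grad_xt (phi n) - p) (grad_xt (phi n) - p) @[n --> \oo] --> 0 ->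
  BQ (phi n - w) (phi n - w) @[n --> \oo] --> 0 ->
  B0 ((fun x => phi n (x, 0)) - g) ((fun x => phi n (x, 0)) - g) @[n --> \oo] --> 0 ->
  in_V Omega w p g.
Proof.
move=> Hw Lg Vphi c1 c2 c3; have [Lw Lp1 Lp2 _] := Hw; split => //.
have H n := V_smooth_L2 (Vphi n).
exists phi; split => //.
- by apply/(L2xt_cvgP oO (fun n => let: And3 _ h _ := H n in h) (conj Lp1 Lp2)).
- by apply/(L2_cvgP mQ (fun n => let: And3 h _ _ := H n in h) Lw).
- by apply/(L2_cvgP mO (fun n => let: And3 _ _ h := H n in h) Lg).
Qed.

Lemma H1_xt_lin a w1 p1 w2 p2 : H1_xt Omega w1 p1 -> H1_xt Omega w2 p2 ->
  H1_xt Omega (fun z => a * w1 z + w2 z) (fun z => a *: p1 z + p2 z).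
Proof.
move=> [Lw1 Lp1 Lq1 H1] [Lw2 Lp2 Lq2 H2].
have ep i : (fun z => (a *: p1 z + p2 z).1 ord0 i) =
    a *: ((fun z => (p1 z).1 ord0 i) : E * R -> R^o) + (fun z => (p2 z).1 ord0 i).
  by apply/funext => z /=; rewrite !mxE.
split.
- exact: (semi_innerSL SQ a Lw1 Lw2).
- by move=> i; rewrite ep; exact: (semi_innerSL SQ a (Lp1 i) (Lp2 i)).
- exact: (semi_innerSL SQ a Lq1 Lq2).
move=> phi tphi; have [Lphi [Lg1 Lg2] _] := V_smooth_L2 (test_V_smooth tphi).
have [H11 H12] := H1 _ tphi; have [H21 H22] := H2 _ tphi; split.
  move=> i; have := semi_innerL SQ a Lw1 Lw2 (Lg1 i); rewrite /BQ => ->.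
  rewrite H11 H21 mulrN -opprD; congr (- _).
  have := semi_innerL SQ a (Lp1 i) (Lp2 i) Lphi; rewrite /BQ => <-.
  by apply: eq_Rintegral => z _; rewrite !mxE.
have := semi_innerL SQ a Lw1 Lw2 Lg2; rewrite /BQ => ->.
rewrite H12 H22 mulrN -opprD; congr (- _).
by have := semi_innerL SQ a Lq1 Lq2 Lphi; rewrite /BQ => <-.
Qed.

Lemma in_V_lin a w1 p1 g1 w2 p2 g2 : in_V Omega w1 p1 g1 -> in_V Omega w2 p2 g2 ->
  in_V Omega (fun z => a * w1 z + w2 z) (fun z => a *: p1 z + p2 z)
    (fun x => a * g1 x + g2 x).
Proof.
move=> h1 h2; have [Hw1 Lg1 _] := h1; have [Hw2 Lg2 _] := h2.
have [Lw1 Lp1 _] := in_V_L2 h1; have [Lw2 Lp2 _] := in_V_L2 h2.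
have [phi [Vphi c1 c2 c3]] := in_V_approx h1; have [psi [Vpsi e1 e2 e3]] := in_V_approx h2.
have H n := V_smooth_L2 (Vphi n); have K n := V_smooth_L2 (Vpsi n).
apply: (@in_V_intro _ _ _ (fun n z => a * phi n z + psi n z)).
- exact: H1_xt_lin.
- exact: (semi_innerSL S0 a Lg1 Lg2).
- by move=> n; exact: V_smooth_lin.
- have gE n : grad_xt (fun z => a * phi n z + psi n z) = a *: grad_xt (phi n) + grad_xt (psi n).
    by apply/funext => z; rewrite grad_xt_lin//; [case: (Vphi n)|case: (Vpsi n)].
  under eq_fun do rewrite gE.
  exact: (semi_inner_cvg_lin SX a (fun n => let: And3 _ h _ := H n in h)
    (fun n => let: And3 _ h _ := K n in h) Lp1 Lp2 c1 e1).
- exact: (semi_inner_cvg_lin SQ a (fun n => let: And3 h _ _ := H n in h)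
    (fun n => let: And3 h _ _ := K n in h) Lw1 Lw2 c2 e2).
- exact: (semi_inner_cvg_lin S0 a (fun n => let: And3 _ _ h := H n in h)
    (fun n => let: And3 _ _ h := K n in h) Lg1 Lg2 c3 e3).
Qed.

End in_V.

Section in_V_traces.
Context (R : realType) (d : nat) (Omega : set 'rV[R]_d) (L : R).
Hypotheses (L0 : 0 < L) (oO : open Omega).
Hypothesis (OL : forall x, Omega x -> forall i, `|x ord0 i| < L).
Local Notation E := 'rV[R]_d.
Local Notation muE := (lebesgue_rV R d).
Local Notation muQ := (lebesgue_xt R d).
Local Notation Q := (cylinder Omega : set (E * measurableTypeR R)).
Let mO := domain_measurable oO.
Let B0 (f g : E -> R^o) := \int[muE]_(x in Omega) (f x * g x).
Let BX (p q : E * R -> E * R) := \int[muQ]_(z in Q) dot_xt (p z) (q z).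
Let S0 : semi_inner (L2 muE Omega : set (E -> R^o)) B0 := L2_semi_inner muE mO.
Let SX : semi_inner (L2xt Omega : set (E * R -> E * R)) BX := L2xt_semi_inner oO.

(** [- w] is written as [-2 * w + w], so that closure under linear combinations applies without a
    zero element of V. *)
Lemma in_V_opp w p g : in_V Omega w p g ->
  in_V Omega (fun z => - w z) (fun z => - p z) (fun x => - g x).
Proof.
move=> h; have := in_V_lin oO OL (-2) h h; congr in_V; apply/funext => z.
- by rewrite mulNr mulr_natl mulr2n opprD addrNK.
- by rewrite scaleNr scaler_nat mulr2n opprD addrNK.
- by rewrite mulNr mulr_natl mulr2n opprD addrNK.
Qed.

Lemma in_V_sum N (c : 'I_N -> R) (w_ : 'I_N -> E * R -> R) (p_ : 'I_N -> E * R -> E * R)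
    (g_ : 'I_N -> E -> R) w p g :
  (forall j, in_V Omega (w_ j) (p_ j) (g_ j)) -> in_V Omega w p g ->
  in_V Omega (fun z => \sum_j c j * w_ j z + w z) (fun z => \sum_j c j *: p_ j z + p z)
    (fun x => \sum_j c j * g_ j x + g x).
Proof.
move=> h_ h; elim: (index_enum _) => [|j r IH].
  move: h; congr in_V; apply/funext => z; by rewrite big_nil add0r.
by have := in_V_lin oO OL (c j) (h_ j) IH; congr in_V; apply/funext => z; rewrite big_cons addrA.
Qed.

Lemma in_V_trace lam w p g : 0 < lam ->
  (forall phi, test_function Omega phi -> lam * \int[muE]_(x in Omega) (phi x * phi x) <=
     \int[muE]_(x in Omega) dot (grad phi x) (grad phi x)) ->
  in_V Omega w p g ->
  \int[muE]_(x in Omega) (g x * g x) <= (Num.sqrt lam)^-1 * BX p p.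
Proof.
move=> lam0 H h; have [_ Lp Lg] := in_V_L2 h.
have [phi [Vphi c1 _ c3]] := in_V_approx oO OL h.
have K n := V_smooth_L2 oO OL (Vphi n).
have Lp_ n : L2xt Omega (grad_xt (phi n)) by case: (K n).
have Lg_ n : L2 muE Omega (fun x => phi n (x, 0)) by case: (K n).
have e1 : B0 (fun x => phi n (x, 0)) (fun x => phi n (x, 0)) @[n --> \oo] --> B0 g g.
  exact: (semi_inner_cvg S0 Lg_ Lg_ Lg Lg c3 c3).
have e2 : (Num.sqrt lam)^-1 * BX (grad_xt (phi n)) (grad_xt (phi n)) @[n --> \oo] -->
    (Num.sqrt lam)^-1 * BX p p.
  apply: cvgM; first exact: cvg_cst.
  exact: (semi_inner_cvg SX Lp_ Lp_ Lp Lp c1 c1).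
apply: (cvg_le_lim e1 e2) => n.
have [sphi _ phi0] := Vphi n; have [T T0 vT] := V_smooth_vanishes (Vphi n).
exact: (trace_inequality oO OL sphi T0 vT lam0 H phi0).
Qed.

Lemma in_V_green a psi gpsi l w p g : 0 < a ->
  H10 Omega psi gpsi -> L2_divergence Omega gpsi l -> in_V Omega w p g ->
  BX (mode_flux a l gpsi) p = - \int[muE]_(x in Omega) (l x * g x).
Proof.
move=> a0 hpsi hl h; have [_ Lp Lg] := in_V_L2 h; have [Ll _] := hl.
have [phi [Vphi c1 _ c3]] := in_V_approx oO OL h.
have K n := V_smooth_L2 oO OL (Vphi n).
have Lp_ n : L2xt Omega (grad_xt (phi n)) by case: (K n).
have Lg_ n : L2 muE Omega (fun x => phi n (x, 0)) by case: (K n).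
have LY := mode_flux_L2 oO a0 hpsi hl.
have e1 : BX (mode_flux a l gpsi) (grad_xt (phi n)) @[n --> \oo] --> BX (mode_flux a l gpsi) p.
  exact: (semi_inner_cvg SX (fun=> LY) Lp_ LY Lp (self0 SX LY) c1).
have e2 : - B0 l (fun x => phi n (x, 0)) @[n --> \oo] --> - B0 l g.
  apply: cvgN.
  exact: (semi_inner_cvg S0 (fun=> Ll) Lg_ Ll Lg (self0 S0 Ll) c3).
apply: (cvg_eq_lim e1 e2) => n.
have [sphi _ phi0] := Vphi n; have [T T0 vT] := V_smooth_vanishes (Vphi n).
exact: (mode_flux_green L0 oO OL sphi T0 vT a0 hpsi hl phi0).
Qed.

End in_V_traces.

(** * Exponentials cut off to bounded support *)

Section exponential_cutoff.
Context (R : realType) (a : R) (a0 : 0 < a).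
Local Notation leb := (@lebesgue_measure R).
Local Notation ex t := (expR (- (a * t))).
Let mH := @measurable_half_line R.

Lemma smooth_expR_lin : smooth (fun t : R => ex t).
Proof.
rewrite (_ : (fun t : R => _) = (fun t => (- a) ^+ 0 * ex t)); last first.
  by apply/funext => t; rewrite expr0 mul1r.
apply: (@smooth_chain _ (fun k t => (- a) ^+ k * ex t)) => k x.
have := @is_deriveZ _ _ _ (fun t => ex t) ((- a) ^+ k) x 1 _ (is_derive_expR_lin a x).
by move=> H; apply: (is_derive_eq H); rewrite exprSr -mulrA.
Qed.

Lemma derive_step_bounded (B : R -> R) : smooth B ->
  (forall x, x <= 1 -> B x = 0) -> (forall x, 2 <= x -> B x = 1) ->
  exists2 M, 0 <= M & forall x, `|'D_(1 : R) B x| <= M.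
Proof.
move=> sB B0 B1.
have cB' : continuous (fun x => 'D_(1 : R) B x) by exact/smooth_continuous/smooth_derive.
have /compact_bounded[M [_ HM]] : compact ((fun x => 'D_(1 : R) B x) @` `[1, 2]%classic).
  apply: continuous_compact; first exact: continuous_subspaceT.
  exact: segment_compact.
exists (`|M| + 1) => [|x]; first by rewrite addr_ge0.
have [x1|x1] := ltP x 1.
  have nr : \forall s \near x, cst 0 s = B s.
    by near=> s; rewrite B0//; apply: ltW; near: s; exact: lt_nbhsl.
  by rewrite -(near_eq_derive _ nr) derive_cst normr0 addr_ge0.
have [x2|x2] := ltP 2 x.
  have nr : \forall s \near x, cst 1 s = B s.
    by near=> s; rewrite B1//; apply: ltW; near: s; exact: lt_nbhsr.
  by rewrite -(near_eq_derive _ nr) derive_cst normr0 addr_ge0.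
apply: (HM (`|M| + 1)); first by rewrite (le_lt_trans (ler_norm M))// ltrDl.
by exists x => //=; rewrite in_itv/= x1 x2.
Unshelve. all: by end_near. Qed.

Lemma half_line_cvg0 (K : R) (f : nat -> R -> R) :
  (forall n, L2 leb (@half_line R) (f n)) ->
  (forall n t, 0 < t -> f n t * f n t <= K * n.+1%:R^-1 * ex t) ->
  \int[leb]_(t in @half_line R) (f n t * f n t) @[n --> \oo] --> 0.
Proof.
move=> Lf fK; have [ie Ie] := integral_expR_lin a0.
apply: (squeeze_cvgr (f := cst 0) (h := fun n => K * a^-1 * harmonic n)).
- apply: nearW => n; apply/andP; split.
    by apply: Rintegral_ge0 => t _; rewrite -expr2 sqr_ge0.
  rewrite /harmonic/= mulrAC -Ie -RintegralZl//.
  apply: le_Rintegral => //; first exact: L2_integrableM.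
    exact: (integrableZl mH _ ie).
  by move=> t t0; exact: fK.
- exact: cvg_cst.
- rewrite -[X in _ --> X](mulr0 (K * a^-1)); apply: cvgM; first exact: cvg_cst.
  exact: cvg_harmonic.
Qed.

(** The approximants are [ex t * (1 - B (t / n.+1))] with the smooth step [B]. The error sits at
    large [t], where the exponential is small, and the derivative of the cut-off adds a term with
    the factor [1 / n.+1]. *)
Lemma exponential_cutoff : exists b : nat -> R -> R,
  [/\ forall n, smooth (b n), forall n, b n 0 = 1,
      forall n t, 2 * n.+1%:R <= t -> b n t = 0,
      \int[leb]_(t in @half_line R) ((b n t - ex t) * (b n t - ex t)) @[n --> \oo] --> 0
    & \int[leb]_(t in @half_line R) (('D_(1 : R) (b n) t - (- a * ex t)) *
        ('D_(1 : R) (b n) t - (- a * ex t))) @[n --> \oo] --> 0].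
Proof.
have [B [sB B01 B0 B1]] := smooth_step R.
have [M M0 HM] := derive_step_bounded sB B0 B1.
pose c n : R := n.+1%:R^-1.
have c0 n : 0 < c n by rewrite invr_gt0.
have c1 n : c n <= 1 by rewrite invf_le1// ler1n.
pose b n (t : R) := ex t * (1 - B (0 + c n * t)).
have sb n : smooth (b n).
  apply: smoothM; first exact: smooth_expR_lin.
  by apply: smoothB; [exact: smooth_cst|exact: smooth_shift1d].
have D n (t : R) : 'D_(1 : R) (b n) t =
    - a * ex t * (1 - B (0 + c n * t)) - ex t * (c n * 'D_(1 : R) B (0 + c n * t)).
  have DB : is_derive t (1 : R) (fun t => B (0 + c n * t)) ('D_(1 : R) B (0 + c n * t) * c n).
    have dB : is_derive (0 + c n * t) (1 : R) B ('D_(1 : R) B (0 + c n * t)).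
      by apply: derivableP; exact: smooth_derivable.
    have dA : is_derive t (1 : R) (fun t => 0 + c n * t) (c n).
      by apply: is_derive_eq; rewrite /GRing.scale/=; ring.
    exact: (@is_derive1_comp _ B (fun t => 0 + c n * t) _ _ _ dB dA).
  have D1 := is_deriveB (is_derive_cst (1 : R) t (1 : R)) DB.
  have D2 := is_deriveM (is_derive_expR_lin a t) D1.
  have /@derive_val -> := D2.
  rewrite /GRing.scale/= -[X in X * (- a * _)]/(1 - B (0 + c n * t)); ring.
have b0 n t : 2 * n.+1%:R <= t -> b n t = 0.
  move=> tn; rewrite /b B1 ?subrr ?mulr0// add0r mulrC /c.
  by rewrite ler_pdivlMr.
have n2 n : (0 : R) <= 2 * n.+1%:R by rewrite mulr_ge0.
have Lb n : L2 leb (@half_line R) (b n).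
  apply: (half_line_L2 (n2 n)); first exact: smooth_continuous.
  by move=> t /ltW; exact: b0.
have Lb' n : L2 leb (@half_line R) (fun t => 'D_(1 : R) (b n) t).
  apply: (half_line_L2 (n2 n)); first exact/smooth_continuous/smooth_derive.
  move=> t tn; have nr : \forall s \near t, cst 0 s = b n s.
    by near=> s; rewrite b0//; apply: ltW; near: s; exact: lt_nbhsr.
  by rewrite -(near_eq_derive _ nr) derive_cst.
have Le := expR_lin_L2 a0.
have e01 t : 0 < t -> 0 < ex t <= 1.
  by move=> t0; rewrite expR_gt0 expR_le1 oppr_le0 mulr_ge0// ltW.
(* [B s <= s] for positive [s], because [B] vanishes up to [1] and never exceeds [1]; the remaining
   factor [t] is absorbed by [ex t * t <= a^-1]. *)
have eB n t : 0 < t -> ex t * ex t * (B (0 + c n * t) * B (0 + c n * t)) <= a^-1 * c n * ex t.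
  move=> t0; have /andP[e0 e1] := e01 _ t0; rewrite add0r.
  have /andP[B0' B1'] := B01 (c n * t).
  have Bs : B (c n * t) <= c n * t.
    have [s1|/ltW s1] := leP (c n * t) 1; first by rewrite B0// mulr_ge0// ltW.
    exact: le_trans s1.
  have et : ex t * t <= a^-1.
    rewrite expRN mulrC ler_pdivrMr ?expR_gt0// ler_pdivlMl//.
    by apply: le_trans (expR_ge1Dx _); rewrite lerDr.
  have BB : B (c n * t) * B (c n * t) <= c n * t.
    by apply: le_trans Bs; rewrite ler_piMr.
  have -> : a^-1 * c n * ex t = (ex t * c n) * a^-1 by ring.
  apply: (@le_trans _ _ ((ex t * c n) * (ex t * t))).
    have -> : (ex t * c n) * (ex t * t) = ex t * ex t * (c n * t) by ring.
    by rewrite ler_wpM2l// mulr_ge0// ltW.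
  by rewrite ler_wpM2l// mulr_ge0// ltW.
exists b; split => //.
- by move=> n; rewrite /b !mulr0 addr0 oppr0 expR0 B0// subr0 mulr1.
- apply: (@half_line_cvg0 a^-1 (fun n t => b n t - ex t)) => [n|n t t0].
    exact: (L2_sub mH).
  apply: le_trans (eB n t t0); rewrite le_eqVlt; apply/orP; left; apply/eqP.
  by rewrite /b; ring.
(* The error of the derivative is [p - q] with [p = a * ex * B] and [q = ex * c n * B']. The
   constant comes from [(p - q) ^+ 2 <= 2 * p ^+ 2 + 2 * q ^+ 2], where [M] bounds the derivative of
   [B]. *)
- apply: (@half_line_cvg0 (2 * a ^+ 2 * a^-1 + 2 * M ^+ 2)
    (fun n t => 'D_(1 : R) (b n) t - (- a * ex t))) => [n|n t t0].
    by apply: (L2_sub mH) => //; exact: (L2_scale mH).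
  rewrite D; have := eB n t t0; have := HM (0 + c n * t).
  have /andP[e0 e1] := e01 _ t0; rewrite -/(c n).
  move: (B (0 + c n * t)) ('D_1 B (0 + c n * t)) => u v vM eu.
  have vv : v * v <= M ^+ 2.
    by rewrite -expr2 -real_normK ?num_real// lerXn2r ?nnegrE.
  have h2 : (ex t * ex t) * (c n * c n) * (v * v) <= ex t * c n * M ^+ 2.
    apply: ler_pM => //.
    - by rewrite !mulr_ge0// ltW.
    - by rewrite -expr2 sqr_ge0.
    - have ce : c n * c n <= c n by rewrite ler_piMr// ltW.
      have ee : ex t * ex t <= ex t by rewrite ler_piMr// ltW.
      by apply: ler_pM => //; rewrite mulr_ge0// ltW.
  have h3 := ler_wpM2l (sqr_ge0 a) eu.
  move: h2 h3; move: (ex t) (c n) (a^-1) => e k ai h2 h3.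
  set p := a * e * u; set q := e * (k * v).
  have -> : - a * e * (1 - u) - e * (k * v) - - a * e = p - q by rewrite /p /q; ring.
  have h4 : p * p <= a ^+ 2 * (ai * k * e).
    by apply: le_trans h3; rewrite le_eqVlt; apply/orP; left; apply/eqP; rewrite /p; ring.
  have h5 : q * q <= e * k * M ^+ 2.
    by apply: le_trans h2; rewrite le_eqVlt; apply/orP; left; apply/eqP; rewrite /q; ring.
  have -> : (2 * a ^+ 2 * ai + 2 * M ^+ 2) * k * e =
    2 * (a ^+ 2 * (ai * k * e)) + 2 * (e * k * M ^+ 2) by ring.
  have := sqr_ge0 (p + q); move: h4 h5; clear; nra.
Unshelve. all: by end_near. Qed.

End exponential_cutoff.

(** * The modes psi(x) exp(- a t) belong to V *)

Section mode.
Context (R : realType) (d : nat) (Omega : set 'rV[R]_d) (L : R).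
Hypotheses (L0 : 0 < L) (oO : open Omega).
Hypothesis (OL : forall x, Omega x -> forall i, `|x ord0 i| < L).
Local Notation E := 'rV[R]_d.
Local Notation muE := (lebesgue_rV R d).
Local Notation muQ := (lebesgue_xt R d).
Local Notation leb := (@lebesgue_measure R).
Local Notation Q := (cylinder Omega : set (E * measurableTypeR R)).
Let mO := domain_measurable oO.
Let mQ := cylinder_measurable oO.
Let mH := @measurable_half_line R.

Lemma test_slice phi t : test_function (cylinder Omega) phi ->
  test_function Omega (fun x => phi (x, t)).
Proof.
move=> [sphi [K [cK KQ K0]]]; split; first exact: smooth_slice1.
exists (fst @` K); split.
- by apply: continuous_compact => //; apply: continuous_subspaceT => z; exact: cvg_fst.
- by move=> _ [z /KQ[Oz _] <-].
- by move=> x nx; apply: K0 => Kx; apply: nx; exists (x, t).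
Qed.

Lemma smooth_tensor (phi : E -> R) (b : R -> R) : smooth phi -> smooth b ->
  smooth (fun z : E * R => phi z.1 * b z.2).
Proof.
move=> sphi sb; apply: smoothM.
  apply: (@smooth_affine _ _ _ (fun z : E * R => z.1) (fun z => z.1)) => // z.
  by apply: (@linear_differentiable _ _ _ fst) => x; exact: cvg_fst.
apply: (@smooth_affine _ _ _ (fun z : E * R => z.2) (fun z => z.2)) => // z.
by apply: (@linear_differentiable _ _ _ snd) => x; exact: cvg_snd.
Qed.

Lemma grad_xt_tensor (phi : E -> R) (b : R -> R) z : smooth phi -> smooth b ->
  grad_xt (fun z => phi z.1 * b z.2) z = (b z.2 *: grad phi z.1, phi z.1 * 'D_(1 : R) b z.2).
Proof.
move=> sphi sb; have st := smooth_tensor sphi sb; case: z => x t /=.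
rewrite [LHS]surjective_pairing; congr pair.
  rewrite -grad_slice1 /= (_ : (fun y => _) = (fun y => b t * phi y)).
    by rewrite grad_scale.
  by apply/funext => y; rewrite mulrC.
have /@derive_val <- := is_derive_slice2 x t st.
rewrite /= (@deriveZ _ _ _ b (phi x))//; exact: smooth_derivable.
Qed.

Context (a : R) (a0 : 0 < a) (psi : E -> R) (gpsi : E -> E) (hpsi : H10 Omega psi gpsi).
Local Notation ex t := (expR (- (a * t))).

Definition mode (z : E * R) : R := psi z.1 * ex z.2.
Definition mode_grad (z : E * R) : E * R := (ex z.2 *: gpsi z.1, psi z.1 * (- a * ex z.2)).

Let Lpsi : L2 muE Omega psi. Proof. by case: hpsi => [[]]. Qed.
Let Lg i : L2 muE Omega (fun x => gpsi x ord0 i). Proof. by case: hpsi => [[_ Lg _] _]. Qed.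
Let Lex : L2 leb (@half_line R) (fun t => ex t). Proof. exact: expR_lin_L2. Qed.
Let Lex' : L2 leb (@half_line R) (fun t => - a * ex t). Proof. exact: (L2_scale mH). Qed.

Let mode_gradE i : (fun z => (mode_grad z).1 ord0 i) = (fun z => gpsi z.1 ord0 i * ex z.2).
Proof. by apply/funext => z; rewrite mxE mulrC. Qed.

Lemma mode_L2 : L2 muQ Q mode. Proof. exact: (L2_prod mO mH Lpsi Lex). Qed.

Lemma mode_grad_L2 : L2xt Omega mode_grad.
Proof.
split=> [i|]; last exact: (L2_prod mO mH Lpsi Lex').
by rewrite mode_gradE; exact: (L2_prod mO mH (Lg i) Lex).
Qed.

(** For an x-derivative, each slice of a test function of the cylinder is a test function of
    [Omega], and the weak gradient of [psi] applies. For the t-derivative, the fundamental theorem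
    of calculus is used along each half-line; the end value vanishes because the points [(x, 0)] lie
    outside the open cylinder. *)
Lemma mode_H1 : H1_xt Omega mode mode_grad.
Proof.
have [Lm1 Lm2] := mode_grad_L2; split => //; first exact: mode_L2.
move=> phi tphi; have Vphi := test_V_smooth oO tphi.
have [Lphi [Lg1 Lg2] _] := V_smooth_L2 oO OL Vphi.
have [sphi _ _] := Vphi; have [T T0 vT] := V_smooth_vanishes Vphi.
have E0 x y : x + y = 0 -> x = - y :> R by move=> /eqP; rewrite addr_eq0 => /eqP.
split => [i|]; apply: E0.
  have i1 := L2_integrableM mQ mode_L2 (Lg1 i); have i2 := L2_integrableM mQ (Lm1 i) Lphi.
  rewrite -(RintegralD mQ i1 i2).
  have iF := integrableD mQ i1 i2.
  pose dphi t x := grad (fun x => phi (x, t)) x ord0 i.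
  have sl t : muE.-integrable Omega (EFin \o (fun x => psi x * dphi t x + gpsi x ord0 i * phi (x, t))) /\
      \int[muE]_(x in Omega) (psi x * dphi t x + gpsi x ord0 i * phi (x, t)) = 0.
    have tt := test_slice t tphi; have [[_ _ ibp] _] := hpsi.
    have st := test_smooth tt.
    have Lp : L2 muE Omega (fun x => phi (x, t)).
      by apply: (continuous_L2 oO OL); exact: smooth_continuous.
    have Ld : L2 muE Omega (dphi t) by exact: (smooth_grad_L2v oO OL).
    have j1 := L2_integrableM mO Lpsi Ld; have j2 := L2_integrableM mO (Lg i) Lp.
    split; first exact: (integrableD mO j1 j2).
    by rewrite (RintegralD mO j1 j2) (ibp _ tt i) addNr.
  have FE x t : mode (x, t) * (grad_xt phi (x, t)).1 ord0 i +
      (mode_grad (x, t)).1 ord0 i * phi (x, t) =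
      ex t * (psi x * dphi t x + gpsi x ord0 i * phi (x, t)).
    by rewrite /mode /mode_grad /dphi grad_slice1 /= !mxE; ring.
  rewrite (@Rfubini2 _ _ _ _ _ muE leb Omega (@half_line R) mO mH _ iF (cst 0)).
  - by rewrite Rintegral_cst ?mul0r.
  - move=> t _; have [it _] := sl t.
    have := integrableZl mO (ex t) it; congr integrable; apply/funext => x /=.
    by rewrite FE.
  - move=> t _; have [it I0] := sl t.
    by under eq_Rintegral do rewrite FE; rewrite (RintegralZl _ mO it) I0 mulr0.
have i1 := L2_integrableM mQ mode_L2 Lg2; have i2 := L2_integrableM mQ Lm2 Lphi.
rewrite -(RintegralD mQ i1 i2).
have iF := integrableD mQ i1 i2.
have FTC x : Omega x -> leb.-integrable (@half_line R) (EFin \o (fun t =>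
     mode (x, t) * (grad_xt phi (x, t)).2 + (mode_grad (x, t)).2 * phi (x, t))) /\
   \int[leb]_(t in @half_line R) (mode (x, t) * (grad_xt phi (x, t)).2 +
      (mode_grad (x, t)).2 * phi (x, t)) = 0.
  move=> Ox.
  have D (t : R) : is_derive t (1 : R) (fun t => psi x * (ex t * phi (x, t)))
      (mode (x, t) * (grad_xt phi (x, t)).2 + (mode_grad (x, t)).2 * phi (x, t)).
    have H := is_deriveM (is_derive_expR_lin a t) (is_derive_slice2 x t sphi).
    have H2 := @is_deriveZ _ _ _ _ (psi x) _ _ _ H.
    by apply: (is_derive_eq H2); rewrite /mode /mode_grad /GRing.scale/=; ring.
  have cphi : continuous (fun t => phi (x, t)) by apply: smooth_continuous; exact: smooth_slice2.
  have cdphi : continuous (fun t => (grad_xt phi (x, t)).2).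
    apply: smooth_continuous.
    exact: (@smooth_slice2 _ _ (fun z => (grad_xt phi z).2) x (smooth_grad_xt2 sphi)).
  have cF : continuous (fun t => mode (x, t) * (grad_xt phi (x, t)).2 +
      (mode_grad (x, t)).2 * phi (x, t)).
    move=> t; rewrite /mode /mode_grad /=.
    apply: cvgD; (apply: cvgM; last by [exact: cphi|exact: cdphi]).
      by apply: cvgM; [exact: cvg_cst|exact: continuous_expR_lin].
    apply: cvgM; first exact: cvg_cst.
    by apply: cvgM; [exact: cvg_cst|exact: continuous_expR_lin].
  have F0 t : T <= t -> psi x * (ex t * phi (x, t)) = 0.
    by move=> Tt; rewrite vT// !mulr0.
  have [iF' ->] := half_line_FTC T0 D cF F0; split => //.
  by rewrite (test_out tphi) ?mulr0 ?oppr0// => -[_] /=; rewrite ltxx.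
rewrite (@Rfubini1 _ _ _ _ _ muE leb Omega (@half_line R) mO mH _ iF (cst 0)).
- by rewrite Rintegral_cst ?mul0r.
- by move=> x /FTC[].
- by move=> x /FTC[].
Qed.

Lemma tensor_V_smooth phi (b : R -> R) T : 0 <= T -> test_function Omega phi -> smooth b ->
  (forall t, T <= t -> b t = 0) -> V_smooth Omega (fun z => phi z.1 * b z.2).
Proof.
move=> T0 tphi sb bT; have [sphi [K [cK KO K0]]] := tphi; split.
- exact: smooth_tensor.
- have [M [Mr HM]] := compact_bounded cK.
  exists (Num.max M T); split; first by rewrite max_real// num_real.
  move=> x; rewrite gt_max => /andP[Mx Tx] z [Qz /= z0].
  (* [b] is arbitrary at negative [t], but support is measured in the closed cylinder, which
     excludes such points. *)
  have z2 : 0 <= z.2.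
    have cl : closed [set z : E * R | 0 <= z.2].
      by apply: (@closed_comp _ _ snd [set t : R | 0 <= t]) => [? _|]; [exact: cvg_snd|exact: closed_ge].
    have /closure_subset sub : cylinder Omega `<=` [set z : E * R | 0 <= z.2] by move=> y [_ /ltW].
    by move/sub : Qz; rewrite -(closure_id _).1.
  rewrite prod_normE ge_max; apply/andP; split.
    apply: (HM _ Mx); apply: contrapT => /K0 p0.
    by rewrite p0 mul0r eqxx in z0.
  rewrite ger0_norm// leNgt; apply/negP => xz.
  by rewrite bT ?mulr0 ?eqxx// in z0; rewrite ltW// (lt_trans Tx).
- move=> x t [_ xO] t0; rewrite /= (test_out tphi) ?mul0r// => Ox.
  by apply: xO; exact: open_nbhs_nbhs.
Qed.

(** The approximants are the tensors [phi n * b n] of test functions tending to [psi] and cut-off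
    exponentials. As [b n 0 = 1], their traces are the [phi n] themselves, so the trace of the mode
    is [psi]. *)
Lemma mode_in_V : in_V Omega mode mode_grad psi.
Proof.
have [phi [tphi c0 cg]] := H10_approx oO OL hpsi.
have [b [sb b1 bT cb cb']] := exponential_cutoff a0.
have n2 n : (0 : R) <= 2 * n.+1%:R by rewrite mulr_ge0.
have sphi n := test_smooth (tphi n).
have Lphi n : L2 muE Omega (phi n) by apply: (continuous_L2 oO OL); exact: smooth_continuous.
have Lgphi n : L2v Omega (grad (phi n)) by exact: (smooth_grad_L2v oO OL).
have Lb n : L2 leb (@half_line R) (b n).
  apply: (half_line_L2 (n2 n)); first exact: smooth_continuous.
  by move=> t /ltW; exact: bT.
have Lb' n : L2 leb (@half_line R) (fun t => 'D_(1 : R) (b n) t).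
  apply: (half_line_L2 (n2 n)); first exact/smooth_continuous/smooth_derive.
  move=> t tn; have nr : \forall s \near t, cst 0 s = b n s.
    by near=> s; rewrite bT//; apply: ltW; near: s; exact: lt_nbhsr.
  by rewrite -(near_eq_derive _ nr) derive_cst.
apply: (in_V_intro oO OL mode_H1 Lpsi (phi := fun n z => phi n z.1 * b n z.2)).
- by move=> n; exact: (tensor_V_smooth (n2 n) (tphi n) (sb n) (bT n)).
- have Vn n := tensor_V_smooth (n2 n) (tphi n) (sb n) (bT n).
  have LX n : L2xt Omega (grad_xt (fun z => phi n z.1 * b n z.2) - mode_grad).
    have [_ h _] := V_smooth_L2 oO OL (Vn n).
    exact: (semi_innerSB (L2xt_semi_inner oO) h mode_grad_L2).
  have z0 : \sum_(i < d) (0 : R) + 0 = 0 by rewrite addr0 big1.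
  rewrite -[X in _ --> X]z0.
  under eq_fun do rewrite (xt_inner_split oO (LX _) (LX _)).
  apply: cvgD.
    apply: cvg_big => [|i _]; first exact: add_continuous.
    have ci : \int[muE]_(x in Omega) ((grad (phi n) x ord0 i - gpsi x ord0 i) *
        (grad (phi n) x ord0 i - gpsi x ord0 i)) @[n --> \oo] --> 0.
      apply: (squeeze_cvgr _ (@cvg_cst _ _ _ _ _) cg); apply: nearW => n; apply/andP; split.
        by apply: Rintegral_ge0 => x _; rewrite -expr2 sqr_ge0.
      have := L2v_coord_le oO i (semi_innerSB (L2v_semi_inner mO) (Lgphi n) Lg).
      apply: le_trans; rewrite le_eqVlt; apply/orP; left; apply/eqP.
      by apply: eq_Rintegral => x _; rewrite !mxE.
    apply: cvg_trans (tensor_cvg mO mH (fun n => Lgphi n i) (Lg i) Lb Lex ci cb).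
    apply: near_eq_cvg; apply: nearW => n; apply: eq_Rintegral => z _.
    have -> : ((grad_xt (fun z => phi n z.1 * b n z.2) - mode_grad) z).1 ord0 i =
        grad (phi n) z.1 ord0 i * b n z.2 - gpsi z.1 ord0 i * ex z.2.
      by rewrite fctE grad_xt_tensor//= !mxE; congr (_ - _); rewrite mulrC.
    by [].
  apply: cvg_trans (tensor_cvg mO mH Lphi Lpsi Lb' Lex' c0 cb').
  apply: near_eq_cvg; apply: nearW => n; apply: eq_Rintegral => z _.
  by rewrite fctE grad_xt_tensor.
- exact: (tensor_cvg mO mH Lphi Lpsi Lb Lex c0 cb).
- apply: cvg_trans c0; apply: near_eq_cvg; apply: nearW => n; apply: eq_Rintegral => x _.
  by rewrite !fctE b1 mulr1.
Unshelve. all: by end_near. Qed.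

End mode.

(** * The error estimates *)

Section semi_inner_sums.
Context (R : realType) (V : lmodType R) (S : set V) (B : V -> V -> R) (SB : semi_inner S B).
Context (N : nat) (c : 'I_N -> R) (u_ : 'I_N -> V).
Hypothesis Su_ : forall j, S (u_ j).

Lemma semi_innerS_sum : S (\sum_j c j *: u_ j).
Proof.
elim: (index_enum _) => [|j r IH]; first by rewrite big_nil; exact: (semi_innerS0 SB).
by rewrite big_cons; exact: (semi_innerSL SB).
Qed.

Lemma semi_inner_suml w : S w -> B (\sum_j c j *: u_ j) w = \sum_j c j * B (u_ j) w.
Proof.
move=> Sw; suff [] : S (\sum_j c j *: u_ j) /\
    B (\sum_j c j *: u_ j) w = \sum_j c j * B (u_ j) w by [].
elim: (index_enum _) => [|j r [IH1 IH2]].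
  by rewrite !big_nil (semi_inner0 SB Sw); split => //; exact: (semi_innerS0 SB).
rewrite !big_cons -IH2; split; first exact: (semi_innerSL SB).
exact: (semi_innerL SB).
Qed.

Lemma semi_inner_sumr w : S w -> B w (\sum_j c j *: u_ j) = \sum_j c j * B w (u_ j).
Proof.
move=> Sw; rewrite (semi_innerC SB Sw semi_innerS_sum) semi_inner_suml//.
by apply: eq_bigr => j _; rewrite (semi_innerC SB (Su_ j) Sw).
Qed.

End semi_inner_sums.

Lemma coord_le_norm (R : realType) n (x : 'rV[R]_n) i : `|x ord0 i| <= `|x|.
Proof.
rewrite [leRHS]/Num.norm/= mx_normrE.
exact: (le_bigmax 0 (fun i => `|x i.1 i.2|) (ord0, i)).
Qed.

Lemma bounded_set_coord (R : realType) n (A : set 'rV[R]_n) : bounded_set A ->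
  exists2 L, 0 < L & forall x, A x -> forall i, `|x ord0 i| < L.
Proof.
move=> [M [_ HM]]; exists (`|M| + 2); first by rewrite ltr_wpDl.
move=> x Ax i; apply: le_lt_trans (coord_le_norm x i) _.
have M1 : M < `|M| + 1 by rewrite (le_lt_trans (ler_norm M))// ltrDl.
by apply: (le_lt_trans (HM _ M1 x Ax)); rewrite ltrD2l ltr1n.
Qed.

(** * The two estimates in abstract form *)

Section error_estimate.
Context (R : realType) (V W : lmodType R) (S : set V) (B : V -> V -> R) (SB : semi_inner S B).
Context (S' : set W) (B' : W -> W -> R) (SB' : semi_inner S' B').
Context (u v : V) (r t : W) (C : R).
Hypotheses (Su : S u) (Sv : S v) (Sr : S' r) (St : S' t) (C0 : 0 < C).
Hypotheses (uvE : B u v = - B' r t) (tv : B' t t <= C * B v v).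

(** In the application [u] is [e_p], [v] is the gradient of [e_w], [r] is the residual, [t] the
    trace of [e_w] and [C] is [C_F]. *)
Let cross : `|B u v| <= Num.sqrt C * Num.sqrt (B' r r) * Num.sqrt (B v v).
Proof.
rewrite uvE normrN; apply: le_trans (semi_inner_CS_sqrt SB' Sr St) _.
rewrite (mulrC (Num.sqrt C)) -mulrA ler_wpM2l ?sqrtr_ge0//.
by rewrite -sqrtrM ?(ltW C0)//; exact: ler_wsqrtr.
Qed.

(** Cauchy-Schwarz applied to [B v v = B u v - B (u - v) v], then division by the norm of [v]. *)
Lemma error_le : Num.sqrt (B v v) <=
  Num.sqrt (B (u - v) (u - v)) + Num.sqrt C * Num.sqrt (B' r r).
Proof.
have Suv := semi_innerSB SB Su Sv.
have v0 := semi_inner_ge0 SB Sv.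
have vE : B v v = B u v - B (u - v) v by rewrite (semi_innerB SB Su Sv Sv); ring.
have h : B v v <= (Num.sqrt (B (u - v) (u - v)) + Num.sqrt C * Num.sqrt (B' r r)) *
    Num.sqrt (B v v).
  rewrite [leLHS]vE mulrDl addrC; apply: lerD.
    by apply: le_trans (semi_inner_CS_sqrt SB Suv Sv); rewrite -normrN ler_norm.
  exact: le_trans (ler_norm _) cross.
have [x0|x0] := eqVneq (Num.sqrt (B v v)) 0.
  by rewrite x0 addr_ge0 ?mulr_ge0 ?sqrtr_ge0.
have x1 : 0 < Num.sqrt (B v v) by rewrite lt_def x0 sqrtr_ge0.
by rewrite -(ler_pM2r x1) -expr2 sqr_sqrtr.
Qed.

Lemma error_sqr_le (alpha : R) : 0 < alpha ->
  (1 - alpha) * B v v + B u u <= B (u - v) (u - v) + C / alpha * B' r r.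
Proof.
move=> al0; have Suv := semi_innerSB SB Su Sv.
have v0 := semi_inner_ge0 SB Sv; have r0 := semi_inner_ge0 SB' Sr.
have -> : B (u - v) (u - v) = B u u - 2 * B u v + B v v.
  rewrite (semi_innerB SB Su Sv Suv) !(semi_innerBr SB Su Sv)// (semi_innerC SB Sv Su).
  by ring.
(* Young's inequality in squared form: the square of [B u v] is at most the product of the two
   summands, and [4 * (x * y) <= (x + y) ^+ 2]. *)
have key : 2 * `|B u v| <= alpha * B v v + C / alpha * B' r r.
  have p0 : 0 <= alpha * B v v by rewrite mulr_ge0// ltW.
  have q0 : 0 <= C / alpha * B' r r by rewrite mulr_ge0// divr_ge0// ltW.
  rewrite -ler_sqr ?nnegrE ?(addr_ge0 p0 q0) ?mulr_ge0//.
  have : `|B u v| ^+ 2 <= (alpha * B v v) * (C / alpha * B' r r).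
    have -> : alpha * B v v * (C / alpha * B' r r) = C * B' r r * B v v.
      by field; rewrite gt_eqF.
    apply: (@le_trans _ _ ((Num.sqrt C * Num.sqrt (B' r r) * Num.sqrt (B v v)) ^+ 2)).
      by rewrite ler_sqr ?nnegrE ?mulr_ge0 ?sqrtr_ge0.
    by rewrite !exprMn !sqr_sqrtr// ltW.
  have := sqr_ge0 (alpha * B v v - C / alpha * B' r r).
  move: (alpha * B v v) (C / alpha * B' r r) `|B u v|=> x y b h1 h2.
  have -> : (x + y) ^+ 2 = (x - y) ^+ 2 + 4 * (x * y) by ring.
  by rewrite exprMn -natrX addrC -[leLHS]addr0 lerD// ler_pM2l.
have := ler_norm (B u v); move: key.
move: (B u v) (B v v) (B u u) (C / alpha * B' r r) `|B u v|=> x y z w b h1 h2.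
  have -> : z - 2 * x + y + w = (1 - alpha) * y + z + ((alpha * y + w) - 2 * x) by ring.
  by rewrite lerDl subr_ge0 (le_trans _ h1)// ler_pM2l.
Qed.

End error_estimate.

(** * The norm of a modal sum *)

Section modal_sums.
Context (R : realType) (d : nat) (Omega : set 'rV[R]_d) (L : R).
Hypotheses (L0 : 0 < L) (oO : open Omega).
Hypothesis (OL : forall x, Omega x -> forall i, `|x ord0 i| < L).
Local Notation E := 'rV[R]_d.
Local Notation muE := (lebesgue_rV R d).
Local Notation muQ := (lebesgue_xt R d).
Local Notation Q := (cylinder Omega : set (E * measurableTypeR R)).
Let mO := domain_measurable oO.
Let mQ := cylinder_measurable oO.
Let mH := @measurable_half_line R.
Let BQ (f g : E * R -> R^o) := \int[muQ]_(z in Q) (f z * g z).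
Let SQ : semi_inner (L2 muQ Q : set (E * R -> R^o)) BQ := L2_semi_inner muQ mQ.

Lemma mode_sum_inner N (k a : 'I_N -> R) (r : 'I_N -> E -> R) :
  (forall j, 0 < a j) -> (forall j, L2 muE Omega (r j)) ->
  let F (z : E * R) := \sum_j k j * (r j z.1 * expR (- (a j * z.2))) in
  \int[muQ]_(z in Q) (F z * F z) =
  \sum_(j < N) \sum_(i < N) k j * k i / (a j + a i) * \int[muE]_(x in Omega) (r j x * r i x).
Proof.
move=> a0 Lr F.
pose u j : E * R -> R^o := fun z => r j z.1 * expR (- (a j * z.2)).
have Lu j : L2 muQ Q (u j) by exact: (L2_prod mO mH (Lr j) (expR_lin_L2 (a0 j))).
have FE : F = (\sum_j k j *: u j : E * R -> R^o) by apply/funext => z; rewrite fct_sumE.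
rewrite -[LHS]/(BQ F F) FE.
rewrite (semi_inner_suml SQ _ Lu (semi_innerS_sum SQ k Lu)); apply: eq_bigr => j _.
rewrite (semi_inner_sumr SQ _ Lu (Lu j)) mulr_sumr; apply: eq_bigr => i _.
have := tensor_inner mO mH (Lr j) (Lr i) (expR_lin_L2 (a0 j)) (expR_lin_L2 (a0 i)).
rewrite (expR_lin_inner (a0 j) (a0 i)) => T.
rewrite [X in _ * (_ * X)]T; ring.
Qed.

End modal_sums.

Theorem mainTheorem6 (R : realType) (d : nat) (d_ge1 : (1 <= d)%N)
    (Omega : set 'rV[R]_d) (hOmega : lipschitz_domain Omega)
    (lambda1 : R) (hlambda1 : min_dirichlet_eigenvalue Omega lambda1)
    (f : 'rV[R]_d -> R) (hf : L2 (lebesgue_rV R d) Omega f)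
    (w : 'rV[R]_d * R -> R) (p : 'rV[R]_d * R -> 'rV[R]_d * R)
    (hw : weak_solution Omega f w p)
    (N : nat) (N_ge1 : (1 <= N)%N)
    (theta : 'I_N -> R) (theta_gt0 : forall j, 0 < theta j)
    (theta_mono : forall j k : 'I_N, (j <= k)%N -> theta j <= theta k)
    (psi : 'I_N -> 'rV[R]_d -> R)
    (gpsi : 'I_N -> 'rV[R]_d -> 'rV[R]_d)
    (lpsi : 'I_N -> 'rV[R]_d -> R)
    (hpsi : forall j, H10 Omega (psi j) (gpsi j))
    (hlpsi : forall j, L2_divergence Omega (gpsi j) (lpsi j)) :
  let mu := lebesgue_rV R d in
  let C_F := (Num.sqrt lambda1)^-1 in
  let gamma j := \int[mu]_(x in Omega) (f x * psi j x) in
  let rho j x := lpsi j x + theta j * psi j x in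
  let w_tilde (z : 'rV[R]_d * R) : R :=
    \sum_(j < N) (Num.sqrt (theta j))^-1 * gamma j * psi j z.1 *
                 expR (- (Num.sqrt (theta j) * z.2)) in
  let y (z : 'rV[R]_d * R) : 'rV[R]_d * R :=
    (\sum_(j < N) (gamma j * (Num.sqrt (theta j))^-1 *
                   expR (- (Num.sqrt (theta j) * z.2))) *: gpsi j z.1,
     \sum_(j < N) gamma j * (theta j)^-1 * lpsi j z.1 *
                  expR (- (Num.sqrt (theta j) * z.2))) in
  let S_N2 : R :=
    \sum_(j < N) \sum_(k < N)
      gamma j * gamma k /
        (theta j * theta k * (Num.sqrt (theta j) + Num.sqrt (theta k))) *
      \int[mu]_(x in Omega) (rho j x * rho k x) in
  let S_N := Num.sqrt S_N2 in
  let residual2 : R :=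
    \int[mu]_(x in Omega)
      (`|\sum_(j < N) gamma j * (theta j)^-1 * lpsi j x + f x| ^+ 2) in
  let e_w z := w_tilde z - w z in
  let e_p z := y z - p z in
  exists grad_e_w : 'rV[R]_d * R -> 'rV[R]_d * R,
    [/\ H1_xt Omega e_w grad_e_w,
        (sqrte (vL2sq_xt Omega grad_e_w) <=
           (S_N + Num.sqrt C_F * Num.sqrt residual2)%:E)%E
      & forall alpha : R, 0 < alpha < 1 ->
        ((1 - alpha)%:E * vL2sq_xt Omega grad_e_w + vL2sq_xt Omega e_p <=
           (S_N2 + C_F / alpha * residual2)%:E)%E].
Proof.
move=> mu C_F gamma rho w_tilde y S_N2 S_N residual2 e_w e_p.
have [oO _ bO _] := hOmega.
have [L L0 OL] := bounded_set_coord bO.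
have mO := domain_measurable oO.
have [lam0 lamP] := dirichlet_poincare L0 oO OL d_ge1 hlambda1.
have [[g hg] weak] := hw.
have [_ Lp _] := in_V_L2 hg.
pose a j : R := Num.sqrt (theta j).
have a0 j : 0 < a j by rewrite sqrtr_gt0.
have aa j : a j ^+ 2 = theta j by rewrite sqr_sqrtr// ltW.
pose c j : R := (a j)^-1 * gamma j.
pose kap j : R := gamma j * (theta j)^-1.
(* [w_tilde] is the sum of the modes with coefficients [c j], and [y] the sum of their fluxes with
   coefficients [kap j]; this relation makes the x-components of the two gradients equal. *)
have ck j : kap j * a j = c j.
  by rewrite /kap /c -aa; field; rewrite gt_eqF.
pose P (z : 'rV[R]_d * R) : 'rV[R]_d * R := \sum_j c j *: mode_grad (a j) (psi j) (gpsi j) z - p z.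
pose tr (x : 'rV[R]_d) : R := \sum_j c j * psi j x - g x.
have hP : in_V Omega e_w P tr.
  have := in_V_sum oO OL c (fun j => mode_in_V oO OL (a0 j) (hpsi j)) (in_V_opp oO OL hg).
  congr in_V; apply/funext => z; rewrite /e_w; congr (_ - _).
  by apply: eq_bigr => j _; rewrite /mode /c /a !mulrA.
have [_ LP Ltr] := in_V_L2 hP.
have SX := L2xt_semi_inner oO.
have S0 := L2_semi_inner mu mO.
pose X := ('rV[R]_d * R -> 'rV[R]_d * R)%type.
pose BX (q r : X) := \int[lebesgue_xt R d]_(z in cylinder Omega) dot_xt (q z) (r z).
pose flux j : X := mode_flux (a j) (lpsi j) (gpsi j).
have Lflux j : L2xt Omega (flux j) by exact: (mode_flux_L2 oO (a0 j) (hpsi j) (hlpsi j)).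
have yE : y = \sum_j kap j *: flux j.
  apply/funext => z; rewrite fct_sumE [RHS]surjective_pairing; congr pair.
    rewrite (raddf_sum fst)/=; apply: eq_bigr => j _.
    by rewrite scalerA; congr (_ *: _); rewrite [RHS]mulrA ck /c [_ * gamma j]mulrC.
  rewrite (raddf_sum snd)/=; apply: eq_bigr => j _.
  by rewrite -[_ *: _]/(_ * _) mulrA.
have Ly : L2xt Omega y by rewrite yE; exact: (semi_innerS_sum SX).
have Lep : L2xt Omega e_p by exact: (semi_innerSB SX Ly Lp).
have Llpsi j : L2 mu Omega (lpsi j) by case: (hlpsi j).
have Lpsi j : L2 mu Omega (psi j) by case: (hpsi j) => [[]].
pose res (x : 'rV[R]_d) : R := \sum_j kap j * lpsi j x + f x.
have Lsum : L2 mu Omega (\sum_j kap j *: (lpsi j : _ -> R^o)) by exact: (semi_innerS_sum S0).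
have resE : res = \sum_j kap j *: (lpsi j : _ -> R^o) + f.
  by apply/funext => x; rewrite fctE fct_sumE.
have Lres : L2 mu Omega res by rewrite resE; exact: (semi_innerSD S0 Lsum hf).
have cross : BX e_p P = - \int[mu]_(x in Omega) (res x * tr x).
  have -> : BX e_p P = BX y P - BX p P by exact: (semi_innerB SX Ly Lp LP).
  have -> : BX p P = \int[mu]_(x in Omega) (f x * tr x) by exact: weak hP.
  have -> : BX y P = \sum_j kap j * BX (flux j) P.
    by rewrite yE; exact: (semi_inner_suml SX _ Lflux LP).
  have := semi_innerD S0 Lsum hf Ltr; rewrite -resE => ->.
  rewrite (semi_inner_suml S0 _ Llpsi Ltr) opprD; congr (_ - _).
  rewrite -sumrN; apply: eq_bigr => j _.
  by rewrite /BX (in_V_green L0 oO OL (a0 j) (hpsi j) (hlpsi j) hP) mulrN.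
have trP : \int[mu]_(x in Omega) (tr x * tr x) <= C_F * BX P P.
  exact: (in_V_trace oO OL lam0 lamP hP).
have C0 : 0 < C_F by rewrite invr_gt0 sqrtr_gt0.
(* In the t-component the mode contributes [c j * a j = kap j * theta j] times [psi j], which
   completes [lpsi j] to [rho j]. *)
have DE z : (e_p - P) z = (0, \sum_j kap j * (rho j z.1 * expR (- (a j * z.2)))).
  rewrite fctE /e_p /P opprB addrA subrK yE fct_sumE -sumrB.
  rewrite [LHS]surjective_pairing; congr pair.
    rewrite (raddf_sum fst)/= big1// => j _.
    by rewrite !scalerA mulrA ck subrr.
  rewrite (raddf_sum snd)/=; apply: eq_bigr => j _.
  rewrite -[_ *: _ in X in X - _]/(_ * _) -[_ *: _ in X in _ - X]/(_ * _) -ck /rho -aa; ring.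
have Lrho j : L2 mu Omega (rho j).
  by apply: (L2_add mO) => //; exact: (L2_scale mO).
have SNE : BX (e_p - P) (e_p - P) = S_N2.
  transitivity (\sum_(j < N) \sum_(i < N) kap j * kap i / (a j + a i) *
      \int[mu]_(x in Omega) (rho j x * rho i x)).
    rewrite -(mode_sum_inner oO kap a0 Lrho); apply: eq_Rintegral => z _.
    by rewrite !DE /dot_xt /= /dot big1 ?add0r// => i _; rewrite mxE mul0r.
  apply: eq_bigr => j _; apply: eq_bigr => i _; congr (_ * _).
  rewrite /kap -/(a j) -/(a i); field.
  by apply/and3P; split; rewrite gt_eqF // ?addr_gt0.
have resE2 : residual2 = \int[mu]_(x in Omega) (res x * res x).
  by apply: eq_Rintegral => x _; rewrite real_normK ?num_real ?expr2.
(* The weak gradient of [e_w] is the one that comes with its membership in V. *)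
exists P; split; first by case: hP.
- rewrite (vL2sq_xtE oO LP) /= lee_fin /S_N -SNE resE2.
  exact: (error_le SX S0 Lep LP Lres Ltr C0 cross trP).
- move=> alpha /andP[al0 _].
  rewrite (vL2sq_xtE oO LP) (vL2sq_xtE oO Lep) -EFinM -EFinD lee_fin -SNE resE2.
  exact: (error_sqr_le SX S0 Lep LP Lres Ltr C0 cross trP al0).
Qed.
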